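(* Let $(n_j)_j,(m_j)_j$ be strictly increasing sequences of positive integers with $\sum_j 1/m_j\le0.1$, $n_j^a/m_j\to\infty$ for every $a>0$, and $n_j/n_{j+1}<1/m_j$ for all $j$. Let $X$ be the completion of $c_{00}(\mathbb{N})$ under the norm implicitly defined by $\|x\|=\max\{\|x\|_\infty,(\sum_{j=1}^\infty\|x\|_j^2)^{1/2}\}$, where $\|x\|_j=\sup\{\frac1{m_j}\sum_{q=1}^{n_j}\|E_q(x)\|:E_1<\dots<E_{n_j}\}$, the supremum over finite subsets $E_1<\dots<E_{n_j}$ of $\mathbb{N}$ and $E(x)$ denoting the restriction of $x$ to $E$. Then for every $k\in\mathbb{N}$ and every $(e_n)_n\in\mathcal{SM}_k(X)$, the Banach space generated by $(e_n)_n$ contains no isomorphic copy of $\ell^p$ ($1\le p<\infty$) nor of $c_0$.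
   Context: $E_1<E_2$ means $\max E_1<\min E_2$. $[M]^k$: $k$-subsets of $M\subseteq\mathbb{N}$ (increasing enumerations, $M(l)$ the $l$-th element). Plegma family: $(s_j)_{j=1}^l$ in $[M]^k$ with $s_1(i)<\dots<s_l(i)$ ($i\le k$), $s_l(i)<s_1(i+1)$ ($i<k$). A $k$-sequence $(x_s)_{s\in[\mathbb{N}]^k}$ in $X$ generates the Hamel basis $(e_n)$ of a seminormed space $(E,\|\cdot\|_* )$ as a $k$-spreading model via infinite $M$ if for a null sequence $\delta_l>0$: $|\|\sum_{j=1}^m a_jx_{s_j}\|-\|\sum_{j=1}^m a_je_j\|_*|\le\delta_l$ for all $m\le l$, plegma $(s_j)_{j=1}^m$ in $[M]^k$ with $s_1(1)\ge M(l)$, $a_j\in[-1,1]$; $\mathcal{SM}_k(X)$ is the set of all such $(e_n)$. The Banach space generated by $(e_n)$ is the completion of its span modulo null vectors (for trivial $(e_n)$, i.e. $\|e_1-e_2\|_*=0$, this is at most one-dimensional). *)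

(* Defs.v *)
From Stdlib Require Import Reals Lra List.
Open Scope R_scope.

Definition finsupp (x : nat -> R) : Prop :=
  exists N0 : nat, forall n, (N0 <= n)%nat -> x n = 0.

Definition vadd (x y : nat -> R) : nat -> R := fun n => x n + y n.
Definition vsub (x y : nat -> R) : nat -> R := fun n => x n - y n.
Definition vscal (c : R) (x : nat -> R) : nat -> R := fun n => c * x n.

Fixpoint rsum (n : nat) (f : nat -> R) : R :=
  match n with O => 0 | S n' => rsum n' f + f n' end.

Definition is_supnorm (x : nat -> R) (v : R) : Prop :=
  is_lub (fun r => exists i, r = Rabs (x i)) v.

Definition restr (E : nat -> bool) (x : nat -> R) : nat -> R :=
  fun i => if E i then x i else 0.

Definition finite_set (E : nat -> bool) : Prop :=
  exists B, forall i, E i = true -> (i < B)%nat.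
Definition nonempty_set (E : nat -> bool) : Prop := exists i, E i = true.

Definition successive_family (n : nat) (E : nat -> nat -> bool) : Prop :=
  (forall q, (q < n)%nat -> finite_set (E q) /\ nonempty_set (E q)) /\
  (forall q q' i i', (q < q')%nat -> (q' < n)%nat ->
      E q i = true -> E q' i' = true -> (i < i')%nat).

Definition jset (nseq mseq : nat -> nat) (N : (nat -> R) -> R)
  (x : nat -> R) (j : nat) : R -> Prop :=
  fun r => exists E, successive_family (nseq j) E /\
     r = / INR (mseq j) * rsum (nseq j) (fun q => N (restr (E q) x)).

Definition implicit_norm (nseq mseq : nat -> nat) (N : (nat -> R) -> R) : Prop :=
  forall x, finsupp x ->
    exists (t : nat -> R) (S sup : R),
      (forall j, is_lub (jset nseq mseq N x j) (t j)) /\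
      infinite_sum (fun j => (t j) ^ 2) S /\
      is_supnorm x sup /\
      N x = Rmax sup (sqrt S).

(** Elements of the completion of (c00, N): N-Cauchy sequences in c00. *)
Definition cauchy_in (N : (nat -> R) -> R) (u : nat -> nat -> R) : Prop :=
  (forall t, finsupp (u t)) /\
  forall eps, eps > 0 -> exists T : nat, forall t t',
    (T <= t)%nat -> (T <= t')%nat -> N (vsub (u t) (u t')) < eps.

Definition compl_norm_is (N : (nat -> R) -> R) (u : nat -> nat -> R) (v : R) : Prop :=
  Un_cv (fun t => N (u t)) v.

Definition strictly_incr_list (s : list nat) : Prop :=
  forall i, (S i < length s)%nat -> (nth i s 0 < nth (S i) s 0)%nat.

(** An infinite M subset of N, given by its increasing enumeration Menum
    (M(l) = Menum (l-1), l >= 1). *)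
Definition infinite_enum (Menum : nat -> nat) : Prop :=
  forall l, (Menum l < Menum (S l))%nat.

Definition in_Mk (Menum : nat -> nat) (k : nat) (s : list nat) : Prop :=
  length s = k /\ strictly_incr_list s /\ forall i, In i s -> exists l, Menum l = i.

Definition plegma (Menum : nat -> nat) (k m : nat) (s : nat -> list nat) : Prop :=
  (forall j, (j < m)%nat -> in_Mk Menum k (s j)) /\
  (forall i j, (i < k)%nat -> (S j < m)%nat -> (nth i (s j) 0 < nth i (s (S j)) 0)%nat) /\
  ((0 < m)%nat -> forall i, (S i < k)%nat ->
      (nth i (s (pred m)) 0 < nth (S i) (s 0%nat) 0)%nat).

Definition k_sequence (N : (nat -> R) -> R) (k : nat)
  (xs : list nat -> nat -> nat -> R) : Prop :=
  forall s, length s = k -> strictly_incr_list s -> cauchy_in N (xs s).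

Definition comb (m : nat) (a : nat -> R) (s : nat -> list nat)
  (xs : list nat -> nat -> nat -> R) : nat -> nat -> R :=
  fun t i => rsum m (fun j => a j * xs (s j) t i).

Definition trunc (m : nat) (a : nat -> R) : nat -> R :=
  fun j => if Nat.ltb j m then a j else 0.

Definition seminorm_c00 (nu : (nat -> R) -> R) : Prop :=
  (forall a b, finsupp a -> finsupp b -> nu (vadd a b) <= nu a + nu b) /\
  (forall c a, finsupp a -> nu (vscal c a) = Rabs c * nu a).

(** (e_n) in SM_k(X): the seminormed space (c00, nu) with unit vector basis
    is generated as a k-spreading model by a k-sequence of X. *)
Definition is_k_spreading_model (N : (nat -> R) -> R) (k : nat)
  (nu : (nat -> R) -> R) : Prop :=
  seminorm_c00 nu /\
  exists (xs : list nat -> nat -> nat -> R) (Menum : nat -> nat) (delta : nat -> R),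
    k_sequence N k xs /\ infinite_enum Menum /\
    (forall l, (1 <= l)%nat -> 0 < delta l) /\ Un_cv delta 0 /\
    forall (l m : nat) (s : nat -> list nat) (a : nat -> R),
      (1 <= l)%nat -> (1 <= m)%nat -> (m <= l)%nat ->
      plegma Menum k m s ->
      (Menum (pred l) <= nth 0 (s 0%nat) 0)%nat ->
      (forall j, (j < m)%nat -> -1 <= a j <= 1) ->
      exists v, compl_norm_is N (comb m a s xs) v /\
                Rabs (v - nu (trunc m a)) <= delta l.

(** x^p for x >= 0, with 0^p = 0 *)
Definition rpow0 (x p : R) : R := if Rle_dec x 0 then 0 else Rpower x p.

Definition lp_norm (n : nat) (c : nat -> R) (p : R) : R :=
  rpow0 (rsum n (fun i => rpow0 (Rabs (c i)) p)) (/ p).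

Fixpoint max_abs (n : nat) (c : nat -> R) : R :=
  match n with O => 0 | S n' => Rmax (max_abs n' c) (Rabs (c n')) end.

Definition ycomb (n : nat) (c : nat -> R) (y : nat -> nat -> nat -> R) : nat -> nat -> R :=
  fun t j => rsum n (fun i => c i * y i t j).

(** The Banach space generated by (e_n) (completion of (c00,nu) modulo null
    vectors) contains an isomorphic copy of l^p: there is a sequence in it
    equivalent to the unit vector basis of l^p. *)
Definition contains_lp (nu : (nat -> R) -> R) (p : R) : Prop :=
  exists (y : nat -> nat -> nat -> R) (C : R),
    0 < C /\ (forall i, cauchy_in nu (y i)) /\
    forall (n : nat) (c : nat -> R), exists L,
      compl_norm_is nu (ycomb n c y) L /\
      / C * lp_norm n c p <= L <= C * lp_norm n c p.

Definition contains_c0 (nu : (nat -> R) -> R) : Prop :=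
  exists (y : nat -> nat -> nat -> R) (C : R),
    0 < C /\ (forall i, cauchy_in nu (y i)) /\
    forall (n : nat) (c : nat -> R), exists L,
      compl_norm_is nu (ycomb n c y) L /\
      / C * max_abs n c <= L <= C * max_abs n c.

(* Main.v *)
(* Along a free ultrafilter the k-sequence (x_s) has iterated coordinatewise limits, one for
   each initial segment of s. The differences of consecutive limits split x_s into a constant
   vector and k "levels"; for a plegma family, the pieces of all levels are almost disjoint
   blocks of the basis, and the constant vector disappears from combinations whose
   coefficients sum to zero.

   If the spreading model contained l^p (p > 1) or c_0, linear algebra would give normalized
   zero-sum blocks of (e_n) equivalent to its basis; summing n_j of them and splitting each
   level at the blocks, the definition of the norm gives norm >= c n_j / (k m_j), which
   exceeds n_j^(1/p).

   For l^1, convex combinations must stay bounded away from zero. But if u and w are far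
   convex combinations whose levels have norm <= R, and w is a long average, then (u + w)/2
   has levels of norm <= 3R/4: the profiles (||u||_i)_i and (||w||_i)_i in l^2 are almost
   orthogonal, since for small i the average w has ||w||_i <= 1.02 R/m_i, while the
   weak limit of the profile of u is small for large i. Iterating makes all levels small. *)
From mathcomp Require filter.
From Stdlib Require Import Reals Lra Lia List Bool Arith.
From Stdlib Require Import Classical ClassicalEpsilon FunctionalExtensionality.
Require Import Defs.
Open Scope R_scope.
Set Bullet Behavior "Strict Subproofs".

(** * Finite sums and truncated Euclidean norms *)

(** The implicit equation is all that is known about [N]: its value at 0, homogeneity and the
    triangle inequality must be derived from it, and [N_comb] does this by induction on the support.
    The bound 1/10 on the sum of the [1 / m_j] serves twice: it absorbs an excess in that induction,
    and it bounds the low part of the inner product of two profiles. The limits of the vectors [x_s]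
    are only coordinatewise and leave [c00]. They are controlled through their initial segments
    ([leN]), and bounded completeness makes their tails small; this is what confines each level to
    intervals. A product ultrafilter replaces passages to subsequences: finitely many almost sure
    properties hold together for one family, and a limit found for a short family remains valid for
    a longer one. The case of [l^1] needs a separate argument because a lower bound of order
    [n_j / m_j] for sums of [n_j] blocks is compatible with [l^1], where such sums have norm of
    order [n_j]. *)

Lemma rsum_S n f : rsum (S n) f = rsum n f + f n.
Proof. reflexivity. Qed.

Lemma rsum_ext n f g :
  (forall i, (i < n)%nat -> f i = g i) -> rsum n f = rsum n g.
Proof.
  induction n as [|n IH]; intros H; simpl; [reflexivity|].
  rewrite IH by (intros; apply H; lia). now rewrite H by lia.
Qed.

Lemma rsum_le n f g :
  (forall i, (i < n)%nat -> f i <= g i) -> rsum n f <= rsum n g.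
Proof.
  induction n as [|n IH]; intros H; simpl; [lra|].
  apply Rplus_le_compat; [apply IH; intros; apply H; lia | apply H; lia].
Qed.

Lemma rsum_plus n f g : rsum n (fun i => f i + g i) = rsum n f + rsum n g.
Proof. induction n as [|n IH]; simpl; [lra | rewrite IH; lra]. Qed.

Lemma rsum_scal n c f : rsum n (fun i => c * f i) = c * rsum n f.
Proof. induction n as [|n IH]; simpl; [lra | rewrite IH; lra]. Qed.

Lemma rsum_scal_r n c f : rsum n (fun i => f i * c) = rsum n f * c.
Proof. induction n as [|n IH]; simpl; [lra | rewrite IH; lra]. Qed.

Lemma rsum_minus n f g : rsum n (fun i => f i - g i) = rsum n f - rsum n g.
Proof. induction n as [|n IH]; simpl; [lra | rewrite IH; lra]. Qed.

Lemma rsum_const n c : rsum n (fun _ => c) = INR n * c.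
Proof.
  induction n as [|n IH]; [simpl; lra|].
  rewrite S_INR. simpl rsum. rewrite IH. lra.
Qed.

Lemma rsum_zero n f : (forall i, (i < n)%nat -> f i = 0) -> rsum n f = 0.
Proof.
  intros H. rewrite (rsum_ext n f (fun _ => 0) H), rsum_const. lra.
Qed.

Lemma rsum_nonneg n f : (forall i, (i < n)%nat -> 0 <= f i) -> 0 <= rsum n f.
Proof.
  intros H. rewrite <- (rsum_zero n (fun _ => 0)) by auto. now apply rsum_le.
Qed.

Lemma rsum_single n f q :
  (q < n)%nat -> (forall i, (i < n)%nat -> i <> q -> f i = 0) -> rsum n f = f q.
Proof.
  induction n as [|n IH]; intros Hq H; [lia|]. simpl.
  destruct (Nat.eq_dec q n) as [->|Hne].
  - rewrite rsum_zero by (intros; apply H; lia). lra.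
  - rewrite IH by (auto; lia). rewrite (H n) by lia. lra.
Qed.

Lemma rsum_ge_term n f q :
  (q < n)%nat -> (forall i, (i < n)%nat -> 0 <= f i) -> f q <= rsum n f.
Proof.
  induction n as [|n IH]; intros Hq H; [lia|]. simpl.
  assert (0 <= rsum n f) by (apply rsum_nonneg; intros; apply H; lia).
  assert (0 <= f n) by (apply H; lia).
  destruct (Nat.eq_dec q n) as [->|Hne]; [lra|].
  enough (f q <= rsum n f) by lra. apply IH; [lia|]. intros; apply H; lia.
Qed.

Lemma rsum_exchange n m (f : nat -> nat -> R) :
  rsum n (fun i => rsum m (fun j => f i j)) = rsum m (fun j => rsum n (fun i => f i j)).
Proof.
  induction n as [|n IH]; simpl; [now rewrite rsum_zero|].
  now rewrite IH, rsum_plus.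
Qed.

Lemma rsum_app n m f : rsum (n + m) f = rsum n f + rsum m (fun i => f (n + i)%nat).
Proof.
  induction m as [|m IH]; [rewrite Nat.add_0_r; simpl; lra|].
  rewrite Nat.add_succ_r. simpl. rewrite IH. lra.
Qed.

Lemma rsum_extend n m f :
  (n <= m)%nat -> (forall i, (n <= i)%nat -> f i = 0) -> rsum m f = rsum n f.
Proof.
  intros Hnm H. replace m with (n + (m - n))%nat by lia.
  rewrite rsum_app, (rsum_zero (m - n)) by (intros; apply H; lia). lra.
Qed.

Lemma rsum_mono_length n m f :
  (n <= m)%nat -> (forall i, 0 <= f i) -> rsum n f <= rsum m f.
Proof.
  intros Hnm H. replace m with (n + (m - n))%nat by lia.
  rewrite rsum_app. enough (0 <= rsum (m - n) (fun i => f (n + i)%nat)) by lra.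
  now apply rsum_nonneg.
Qed.

Lemma rsum_telescope n f : rsum n (fun i => f (S i) - f i) = f n - f 0%nat.
Proof. induction n as [|n IH]; simpl; [lra | rewrite IH; lra]. Qed.

Lemma rsum_sum_f_R0 n f : rsum (S n) f = sum_f_R0 f n.
Proof.
  induction n as [|n IH]; [simpl; lra|].
  change (rsum (S (S n)) f) with (rsum (S n) f + f (S n)). now rewrite IH.
Qed.

(** Once [N_spec] has unfolded the implicit equation, elements of l^2 enter only through bounds on
    these truncations that are uniform in [n]. *)
Definition l2 (n : nat) (f : nat -> R) : R := sqrt (rsum n (fun i => f i ^ 2)).

Lemma l2_sqr_nonneg n f : 0 <= rsum n (fun i => f i ^ 2).
Proof. apply rsum_nonneg; intros; apply pow2_ge_0. Qed.

Lemma l2_nonneg n f : 0 <= l2 n f.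
Proof. apply sqrt_pos. Qed.

Lemma l2_sqr n f : l2 n f ^ 2 = rsum n (fun i => f i ^ 2).
Proof. unfold l2. rewrite pow2_sqrt; [reflexivity | apply l2_sqr_nonneg]. Qed.

Lemma l2_le_iff n f B : 0 <= B -> (l2 n f <= B <-> rsum n (fun i => f i ^ 2) <= B ^ 2).
Proof.
  intros HB. rewrite <- l2_sqr. pose proof (l2_nonneg n f).
  split; intros H'; [nra|]. apply Rnot_lt_le; intros Hlt. nra.
Qed.

Lemma rsum_cauchy_schwarz n f g : rsum n (fun i => f i * g i) <= l2 n f * l2 n g.
Proof.
  induction n as [|n IH].
  { simpl. pose proof (l2_nonneg 0 f); pose proof (l2_nonneg 0 g). nra. }
  assert (HS : forall h, l2 (S n) h ^ 2 = l2 n h ^ 2 + h n ^ 2)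
    by (intros h; now rewrite !l2_sqr).
  simpl rsum.
  pose proof (HS f) as Hf. pose proof (HS g) as Hg.
  set (A' := l2 (S n) f) in *. set (B' := l2 (S n) g) in *.
  set (A := l2 n f) in *. set (B := l2 n g) in *.
  assert (0 <= A) by apply l2_nonneg. assert (0 <= B) by apply l2_nonneg.
  assert (0 <= A') by apply l2_nonneg. assert (0 <= B') by apply l2_nonneg.
  apply Rle_trans with (A * B + f n * g n); [lra|].
  (* Cauchy-Schwarz in the plane for the vectors [(A, f n)] and [(B, g n)]. *)
  assert (Hsq : (A * B + f n * g n) ^ 2 <= (A' * B') ^ 2).
  { replace ((A' * B') ^ 2) with (A' ^ 2 * B' ^ 2) by ring. rewrite Hf, Hg.
    pose proof (pow2_ge_0 (A * g n - B * f n)). nra. }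
  assert (0 <= A' * B') by nra.
  apply Rnot_lt_le; intros Hlt. nra.
Qed.

Lemma l2_triangle n f g : l2 n (fun i => f i + g i) <= l2 n f + l2 n g.
Proof.
  pose proof (l2_nonneg n f); pose proof (l2_nonneg n g).
  apply l2_le_iff; [lra|].
  rewrite (rsum_ext n _ (fun i => (f i ^ 2 + g i ^ 2) + 2 * (f i * g i))) by (intros; ring).
  rewrite !rsum_plus, rsum_scal, <- !l2_sqr.
  pose proof (rsum_cauchy_schwarz n f g). nra.
Qed.

Lemma l2_scal n c f : l2 n (fun i => c * f i) = Rabs c * l2 n f.
Proof.
  unfold l2. rewrite (rsum_ext n _ (fun i => c ^ 2 * f i ^ 2)) by (intros; ring).
  rewrite rsum_scal, sqrt_mult by (try apply l2_sqr_nonneg; apply pow2_ge_0).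
  now rewrite <- (sqrt_Rsqr_abs c), Rsqr_pow2.
Qed.

Lemma l2_mono n f g :
  (forall i, (i < n)%nat -> 0 <= f i <= g i) -> l2 n f <= l2 n g.
Proof.
  intros H. apply sqrt_le_1_alt, rsum_le. intros i Hi.
  specialize (H i Hi). apply pow_incr; lra.
Qed.

Lemma l2_le_rsum n f : (forall i, (i < n)%nat -> 0 <= f i) -> l2 n f <= rsum n f.
Proof.
  intros H. apply l2_le_iff; [now apply rsum_nonneg|].
  induction n as [|n IH]; [simpl; lra|]. rewrite !rsum_S.
  assert (0 <= rsum n f) by (apply rsum_nonneg; intros; apply H; lia).
  assert (0 <= f n) by (apply H; lia).
  assert (rsum n (fun i => f i ^ 2) <= rsum n f ^ 2) by (apply IH; intros; apply H; lia).
  assert (0 <= rsum n f * f n) by now apply Rmult_le_pos.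
  replace ((rsum n f + f n) ^ 2) with (rsum n f ^ 2 + f n ^ 2 + 2 * (rsum n f * f n)) by ring.
  lra.
Qed.

Lemma l2_ge_term n f i : (i < n)%nat -> 0 <= f i -> f i <= l2 n f.
Proof.
  intros Hi Hf. pose proof (l2_nonneg n f). pose proof (l2_sqr n f) as Hs.
  assert (f i ^ 2 <= rsum n (fun i => f i ^ 2))
    by (apply (rsum_ge_term n (fun i => f i ^ 2)); [assumption | intros; apply pow2_ge_0]).
  rewrite <- Hs in H0. apply Rnot_lt_le; intros Hlt.
  pose proof (Rmult_le_0_lt_compat _ _ _ _ H H Hlt Hlt). nra.
Qed.

(** * Ultrafilters *)

Definition ultra {A : Type} (W : (A -> Prop) -> Prop) : Prop :=
  W (fun _ => True) /\ ~ W (fun _ => False) /\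
  (forall P Q : A -> Prop, (forall a, P a -> Q a) -> W P -> W Q) /\
  (forall P Q : A -> Prop, W P -> W Q -> W (fun a => P a /\ Q a)) /\
  (forall P : A -> Prop, W P \/ W (fun a => ~ P a)).

(** The ultrafilter lemma extends the filter of cofinite sets; containing that filter is what
    freeness means. *)
Lemma free_ultrafilter_exists :
  exists U : (nat -> Prop) -> Prop, ultra U /\ forall m, U (fun n => le m n).
Proof.
  set (F := fun P : nat -> Prop => exists m, forall n, le m n -> P n).
  assert (FF : filter.ProperFilter F).
  { split.
    - intros [m Hm]. exact (Hm m (le_n m)).
    - split.
      + exists 0%nat. intros; exact I.
      + intros P Q [m Hm] [m' Hm']. exists (max m m'). intros n Hn.
        split; [apply Hm | apply Hm']; lia.
      + intros P Q HPQ [m Hm]. exists m. intros n Hn. apply HPQ, Hm, Hn. }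
  destruct (filter.ultraFilterLemma FF) as [G [HG FG]].
  destruct HG as [GP Gmax] eqn:E.
  exists G. destruct GP as [G0 [GT GI GS]]. split.
  - split; [exact GT|]. split; [exact G0|]. split.
    + intros P Q HPQ. exact (GS P Q HPQ).
    + split. { intros P Q HP HQ. exact (GI P Q HP HQ). }
      intros P. exact (filter.in_ultra_setVsetC P HG).
  - intros m. apply FG. exists m. auto.
Qed.

Lemma Rabs_le_bounds x B : Rabs x <= B -> - B <= x <= B.
Proof. unfold Rabs. destruct (Rcase_abs x); lra. Qed.

Lemma ultra_mono {A} (W : (A -> Prop) -> Prop) (P Q : A -> Prop) :
  ultra W -> (forall a, P a -> Q a) -> W P -> W Q.
Proof. intros HW. apply HW. Qed.

Lemma ultra_and {A} (W : (A -> Prop) -> Prop) (P Q : A -> Prop) :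
  ultra W -> W P -> W Q -> W (fun a => P a /\ Q a).
Proof. intros HW. apply HW. Qed.

Lemma ultra_true {A} (W : (A -> Prop) -> Prop) (P : A -> Prop) :
  ultra W -> (forall a, P a) -> W P.
Proof. intros HW H. apply (ultra_mono W (fun _ => True)); auto. apply HW. Qed.

Lemma ultra_ex {A} (W : (A -> Prop) -> Prop) (P : A -> Prop) :
  ultra W -> W P -> exists a, P a.
Proof.
  intros HW HP. apply NNPP. intros Hno. apply HW.
  apply (ultra_mono W P); auto. intros a Ha. apply Hno. eauto.
Qed.

Lemma ultra_forall_lt {A} (W : (A -> Prop) -> Prop) n (P : nat -> A -> Prop) :
  ultra W -> (forall i, (i < n)%nat -> W (P i)) -> W (fun a => forall i, (i < n)%nat -> P i a).
Proof.
  intros HW. induction n as [|n IH]; intros H.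
  - apply ultra_true; auto. intros; lia.
  - apply (ultra_mono W (fun a => (forall i, (i < n)%nat -> P i a) /\ P n a)); auto.
    + intros a [H1 H2] i Hi. destruct (Nat.eq_dec i n) as [->|]; auto. apply H1. lia.
    + apply ultra_and; auto.
Qed.

Definition is_ulim {A} (W : (A -> Prop) -> Prop) (F : A -> R) (l : R) : Prop :=
  forall eps, 0 < eps -> W (fun a => Rabs (F a - l) < eps).

(** The limit is the supremum of those [x] that bound [F] from below on a [W]-large set; boundedness
    of [F] makes the set of these [x] nonempty and bounded. *)
Lemma ulim_exists {A} (W : (A -> Prop) -> Prop) F B :
  ultra W -> (forall a, Rabs (F a) <= B) -> exists l, is_ulim W F l.
Proof.
  intros HW HB.
  destruct (completeness (fun x => W (fun a => x <= F a))) as [l Hl].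
  - exists B. intros x Hx. apply ultra_ex in Hx as [a Ha]; auto.
    specialize (HB a). apply Rabs_le_bounds in HB. lra.
  - exists (- B). apply ultra_true; auto. intros a. specialize (HB a).
    apply Rabs_le_bounds in HB. lra.
  - exists l. intros eps Heps.
    assert (H1 : W (fun a => l - eps < F a)).
    { apply NNPP. intros Hno. enough (l <= l - eps) by lra. apply Hl.
      intros x Hx. apply Rnot_lt_le. intros Hlt. apply Hno.
      apply (ultra_mono W _ _ HW) with (2 := Hx). intros a Ha. lra. }
    assert (H2 : W (fun a => ~ (l + eps <= F a))).
    { destruct HW as [_ [_ [_ [_ HW]]]]. destruct (HW (fun a => l + eps <= F a)) as [H|H]; auto.
      apply Hl in H. lra. }
    apply (ultra_mono W _ _ HW) with (2 := ultra_and W _ _ HW H1 H2).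
    intros a [Ha Ha']. apply Rabs_def1; lra.
Qed.

Lemma is_ulim_ge {A} (W : (A -> Prop) -> Prop) F l B :
  ultra W -> is_ulim W F l -> W (fun a => B <= F a) -> B <= l.
Proof.
  intros HW Hl HB. apply Rnot_lt_le. intros Hlt.
  destruct (ultra_ex W _ HW (ultra_and W _ _ HW HB (Hl (B - l) ltac:(lra)))) as [a [Ha Ha']].
  apply Rabs_def2 in Ha'. lra.
Qed.

Lemma is_ulim_unique {A} (W : (A -> Prop) -> Prop) F l l' :
  ultra W -> is_ulim W F l -> is_ulim W F l' -> l = l'.
Proof.
  intros HW Hl Hl'. apply NNPP. intros Hne.
  assert (He : 0 < Rabs (l - l') / 2) by (pose proof (Rabs_pos_lt (l - l') ltac:(lra)); lra).
  destruct (ultra_ex W _ HW (ultra_and W _ _ HW (Hl _ He) (Hl' _ He))) as [a [Ha Ha']].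
  pose proof (Rabs_triang (l - F a) (F a - l')) as Ht.
  replace (l - F a + (F a - l')) with (l - l') in Ht by ring.
  rewrite (Rabs_minus_sym l (F a)) in Ht. lra.
Qed.

Definition ulim {A} (W : (A -> Prop) -> Prop) (F : A -> R) : R :=
  epsilon (inhabits 0) (is_ulim W F).

Lemma ulim_spec {A} (W : (A -> Prop) -> Prop) F B :
  ultra W -> (forall a, Rabs (F a) <= B) -> is_ulim W F (ulim W F).
Proof. intros HW HB. unfold ulim. apply epsilon_spec. eapply ulim_exists; eauto. Qed.

Lemma is_ulim_rsum {A} (W : (A -> Prop) -> Prop) n (F : nat -> A -> R) l c :
  ultra W -> (forall i, is_ulim W (F i) (l i)) ->
  is_ulim W (fun a => rsum n (fun i => F i a * c i)) (rsum n (fun i => l i * c i)).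
Proof.
  intros HW H. induction n as [|n IH]; simpl; intros eps Heps.
  - apply ultra_true; auto. intros _. rewrite Rminus_diag, Rabs_R0. assumption.
  - set (C := Rabs (c n) + 1). assert (HC : 0 < C) by (pose proof (Rabs_pos (c n)); unfold C; lra).
    assert (He : 0 < eps / 2 / C) by (apply Rdiv_lt_0_compat; lra).
    apply (ultra_mono W _ _ HW) with
      (2 := ultra_and W _ _ HW (IH (eps / 2) ltac:(lra)) (H n _ He)).
    intros a [H1 H2].
    replace (_ - _) with ((rsum n (fun i => F i a * c i) - rsum n (fun i => l i * c i))
       + (F n a - l n) * c n) by ring.
    eapply Rle_lt_trans; [apply Rabs_triang|]. rewrite Rabs_mult.
    assert (Rabs (F n a - l n) * Rabs (c n) <= eps / 2 / C * C).
    { apply Rmult_le_compat; try apply Rabs_pos; [lra | unfold C; lra]. }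
    replace (eps / 2 / C * C) with (eps / 2) in H0 by (field; lra). lra.
Qed.

(** Only [m] coordinates matter, so almost every [h a] is within [e] of [b] in all of them at once;
    the total error [m e] is chosen smaller than a hypothetical excess. *)
Lemma l2_ulim_le {A} (W : (A -> Prop) -> Prop) (h : A -> nat -> R) b B m :
  ultra W -> (forall i, is_ulim W (fun a => h a i) (b i)) -> (forall i, 0 <= b i) ->
  W (fun a => l2 m (h a) <= B) -> l2 m b <= B.
Proof.
  intros HW Hb Hb0 HB. apply Rnot_lt_le. intros Hlt.
  set (e := (l2 m b - B) / (INR m + 1)).
  pose proof (pos_INR m) as Hm.
  assert (He : 0 < e) by (apply Rdiv_lt_0_compat; lra).
  destruct (ultra_ex _ _ HW (ultra_and _ _ _ HW HB
    (ultra_forall_lt _ m _ HW (fun i _ => Hb i e He)))) as [c [HcB Hc]].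
  assert (l2 m b <= B + INR m * e).
  { apply Rle_trans with (l2 m (fun i => h c i + e)).
    - apply l2_mono. intros i Hi. split; [auto|].
      specialize (Hc i Hi). apply Rabs_def2 in Hc. lra.
    - eapply Rle_trans; [apply l2_triangle|]. apply Rplus_le_compat; [apply HcB|].
      rewrite <- rsum_const. apply l2_le_rsum. intros; lra. }
  assert (e * (INR m + 1) = l2 m b - B) by (unfold e; field; lra). lra.
Qed.

(** [s j r] is the entry of rank [r], counted from 0, in the [j]-th set of a prospective plegma
    family. Entries are unrestricted so that they can be filled in one at a time; the plegma
    conditions hold almost surely afterwards. *)
Definition cfg := nat -> nat -> nat.

Definition upd (s : cfg) (p : nat * nat) (n : nat) : cfg :=
  fun j r => if (j =? fst p) && (r =? snd p) then n else s j r.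

Lemma upd_same s j r n : upd s (j, r) n j r = n.
Proof. unfold upd. simpl. now rewrite !Nat.eqb_refl. Qed.

Lemma upd_other s j r n j' r' : (j' <> j \/ r' <> r) -> upd s (j, r) n j' r' = s j' r'.
Proof.
  intros H. unfold upd. simpl. destruct (Nat.eqb_spec j' j); destruct (Nat.eqb_spec r' r);
    simpl; auto; lia.
Qed.

Definition agree (D : nat -> nat -> Prop) (s s' : cfg) : Prop :=
  forall j r, D j r -> s j r = s' j r.

Lemma agree_upd D s s' p n : agree D s s' -> agree D (upd s p n) (upd s' p n).
Proof. intros H j r Hjr. unfold upd. destruct (_ && _); auto. Qed.

Lemma agree_upd_out (D : nat -> nat -> Prop) s p n :
  ~ D (fst p) (snd p) -> agree D (upd s p n) s.
Proof.
  intros H j r Hjr. unfold upd.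
  destruct (Nat.eqb_spec j (fst p)); destruct (Nat.eqb_spec r (snd p)); simpl; auto.
  subst. contradiction.
Qed.

Lemma agree_sym D s s' : agree D s s' -> agree D s' s.
Proof. intros H j r Hjr. symmetry. auto. Qed.

(** * Choosing configurations by a product ultrafilter *)

Section Product.
Variable U : (nat -> Prop) -> Prop.
Hypothesis HU : ultra U.

(* The product ultrafilter: the coordinates listed in ps are chosen one after the other,
   each from a U-large set depending on the previous ones. *)
Fixpoint prodU (ps : list (nat * nat)) (s : cfg) (P : cfg -> Prop) : Prop :=
  match ps with
  | nil => P s
  | p :: ps' => U (fun n => prodU ps' (upd s p n) P)
  end.

Lemma prodU_ultra ps s : ultra (prodU ps s).
Proof.
  revert s. induction ps as [|p ps IH]; intros s; simpl.
  - repeat split; auto. intros P. apply classic.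
  - repeat split.
    + apply ultra_true; auto. intros n. apply (IH (upd s p n)).
    + intros H. apply HU. apply (ultra_mono U _ _ HU) with (2 := H).
      intros n. apply (IH (upd s p n)).
    + intros P Q HPQ. apply (ultra_mono U _ _ HU). intros n.
      now apply (ultra_mono _ _ _ (IH (upd s p n))).
    + intros P Q HP HQ. apply (ultra_mono U _ _ HU) with (2 := ultra_and U _ _ HU HP HQ).
      intros n [H1 H2]. now apply (ultra_and _ _ _ (IH (upd s p n))).
    + intros P. destruct HU as [_ [_ [_ [_ H]]]].
      destruct (H (fun n => prodU ps (upd s p n) P)) as [H1|H1]; [now left|right].
      apply (ultra_mono U _ _ HU) with (2 := H1). intros n Hn.
      destruct (IH (upd s p n)) as [_ [_ [_ [_ H2]]]]. destruct (H2 P); tauto.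
Qed.

Lemma prodU_agree (D : nat -> nat -> Prop) (P : cfg -> Prop) :
  (forall s s', agree D s s' -> P s -> P s') ->
  forall ps s s', agree D s s' -> prodU ps s P -> prodU ps s' P.
Proof.
  intros HP ps. induction ps as [|p ps IH]; intros s s' Hs; simpl; [now apply HP|].
  apply (ultra_mono U _ _ HU). intros n. now apply IH, agree_upd.
Qed.

(** Quantifying over a coordinate on which [P] does not depend is vacuous, so such coordinates may
    be inserted. This carries limits from a short plegma family to a longer one. *)
Lemma prodU_filter (keep : nat * nat -> bool) (P : cfg -> Prop) :
  (forall s s', agree (fun j r => keep (j, r) = true) s s' -> P s -> P s') ->
  forall ps s, prodU (filter keep ps) s P -> prodU ps s P.
Proof.
  intros HP ps. induction ps as [|p ps IH]; intros s; simpl; [auto|].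
  destruct (keep p) eqn:Hk; simpl.
  - apply (ultra_mono U _ _ HU). auto.
  - intros H. apply ultra_true; auto. intros n. apply IH.
    apply (prodU_agree _ P HP) with s; [|assumption].
    apply agree_sym, agree_upd_out. destruct p; simpl. now rewrite Hk.
Qed.

(** The rule for inductive constructions along the choice: an invariant that survives almost every
    choice of the next coordinate holds for almost every complete configuration. *)
Lemma prodU_invariant (ps : list (nat * nat)) (Q : nat -> cfg -> Prop) :
  (forall i s, (i < length ps)%nat -> Q i s ->
     U (fun n => Q (S i) (upd s (nth i ps (0%nat, 0%nat)) n))) ->
  forall s, Q 0%nat s -> prodU ps s (Q (length ps)).
Proof.
  revert Q. induction ps as [|p ps IH]; intros Q HQ s Hs; simpl; [assumption|].
  apply (ultra_mono U _ _ HU) with (2 := HQ 0%nat s ltac:(simpl; lia) Hs). simpl.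
  intros n Hn. apply (IH (fun i => Q (S i))); [|assumption].
  intros i s' Hi Hs'. apply (HQ (S i) s'); [simpl; lia | assumption].
Qed.

Lemma l2_tail f B eta : (forall n, l2 n f <= B) -> 0 < eta ->
  exists m0, forall m, l2 m (fun i => if i <? m0 then 0 else f i) <= eta.
Proof.
  intros HB Heta.
  assert (HB0 : 0 <= B) by (eapply Rle_trans; [apply (l2_nonneg 0 f) | apply HB]).
  destruct (completeness (fun x => exists n, x = rsum n (fun i => f i ^ 2))) as [S HS].
  - exists (B ^ 2). intros x [n ->]. apply l2_le_iff; auto.
  - exists 0. now exists 0%nat.
  - assert (exists m0, S - eta ^ 2 < rsum m0 (fun i => f i ^ 2)) as [m0 Hm0].
    { apply NNPP. intros Hno. enough (S <= S - eta ^ 2) by nra. apply HS.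
      intros x [n ->]. apply Rnot_lt_le. intros Hlt. apply Hno. eauto. }
    exists m0. intros m. apply l2_le_iff; [lra|].
    apply Rle_trans with (rsum (m0 + m) (fun i => (if i <? m0 then 0 else f i) ^ 2)).
    { apply rsum_mono_length; [lia | intros; apply pow2_ge_0]. }
    rewrite rsum_app, rsum_zero.
    2:{ intros i Hi. rewrite (proj2 (Nat.ltb_lt i m0) Hi). ring. }
    rewrite (rsum_ext m _ (fun i => f (m0 + i)%nat ^ 2)).
    2:{ intros i _. destruct (Nat.ltb_spec (m0 + i) m0); [lia | reflexivity]. }
    assert (rsum (m0 + m) (fun i => f i ^ 2) <= S) by (apply HS; eauto).
    rewrite rsum_app in H. lra.
Qed.

(** The fixed vector [b'] has a tail of norm at most [eta], where Cauchy-Schwarz bounds the product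
    by [B * eta] for all [n] at once; on the first [m0] coordinates the convergence of [bn]
    suffices. *)
Lemma weak_limit_inner (b' b : nat -> R) (bn : nat -> nat -> R) B V eps :
  (forall m, l2 m b' <= B) -> (forall n m, l2 m (bn n) <= B) ->
  (forall i, 0 <= b' i) -> (forall n i, 0 <= bn n i) ->
  (forall i, is_ulim U (fun n => bn n i) (b i)) ->
  (forall m, rsum m (fun i => b i * b' i) <= V) -> 0 < eps ->
  U (fun n => forall m, rsum m (fun i => bn n i * b' i) <= V + eps).
Proof.
  intros Hb' Hbn Hp' Hpn Hlim HV Heps.
  assert (HB0 : 0 <= B) by (eapply Rle_trans; [apply (l2_nonneg 0 b') | apply Hb']).
  set (eta := eps / 2 / (B + 1)).
  assert (Heta : 0 < eta) by (apply Rdiv_lt_0_compat; lra).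
  assert (HBeta : B * eta <= eps / 2).
  { apply Rle_trans with ((B + 1) * eta); [nra|]. unfold eta. right. field. lra. }
  destruct (l2_tail b' B eta Hb' Heta) as [m0 Hm0].
  apply (ultra_mono U _ _ HU) with
    (2 := is_ulim_rsum U m0 (fun i n => bn n i) b b' HU Hlim (eps / 2) ltac:(lra)).
  intros n Hn m. apply Rabs_def2 in Hn. specialize (HV m0).
  set (g := fun i => if i <? m0 then 0 else b' i).
  apply Rle_trans with (rsum (m0 + m) (fun i => bn n i * b' i)).
  { apply rsum_mono_length; [lia|]. intros i. now apply Rmult_le_pos. }
  rewrite rsum_app.
  assert (rsum m (fun i => bn n (m0 + i)%nat * b' (m0 + i)%nat) <= B * eta).
  { apply Rle_trans with (rsum (m0 + m) (fun i => bn n i * g i)).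
    - rewrite rsum_app, (rsum_zero m0).
      + rewrite Rplus_0_l. right. apply rsum_ext. intros i _. unfold g.
        destruct (Nat.ltb_spec (m0 + i) m0); [lia | reflexivity].
      + intros i Hi. unfold g. rewrite (proj2 (Nat.ltb_lt i m0) Hi). ring.
    - eapply Rle_trans; [apply rsum_cauchy_schwarz|].
      apply Rmult_le_compat; try apply l2_nonneg; [apply Hbn | apply Hm0]. }
  lra.
Qed.

(* Weak limits of p and q may be taken separately in an inner product when no coordinate
   of the configuration influences both. *)
Lemma prodU_inner (p q : cfg -> nat -> R) (Dp Dq : nat -> nat -> Prop) B :
  (forall j r, Dp j r -> ~ Dq j r) ->
  (forall s s', agree Dp s s' -> forall i, p s i = p s' i) ->
  (forall s s', agree Dq s s' -> forall i, q s i = q s' i) ->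
  (forall s i, 0 <= p s i) -> (forall s i, 0 <= q s i) ->
  (forall s n, l2 n (p s) <= B) -> (forall s n, l2 n (q s) <= B) ->
  forall ps s b b' V eps,
  (forall i, is_ulim (prodU ps s) (fun c => p c i) (b i)) ->
  (forall i, is_ulim (prodU ps s) (fun c => q c i) (b' i)) ->
  (forall m, rsum m (fun i => b i * b' i) <= V) -> 0 < eps ->
  prodU ps s (fun c => forall m, rsum m (fun i => p c i * q c i) <= V + eps).
Proof.
  intros Hdisj Hp Hq Hp0 Hq0 HpB HqB ps.
  induction ps as [|p0 ps IH]; intros s b b' V eps Hb Hb' HV Heps.
  { simpl in *.
    assert (Hlim : forall x y, (forall e, 0 < e -> Rabs (x - y) < e) -> x = y).
    { intros x y H. apply NNPP. intros Hne.
      specialize (H (Rabs (x - y)) ltac:(apply Rabs_pos_lt; lra)). lra. }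
    intros m. rewrite (rsum_ext m _ (fun i => b i * b' i)).
    - specialize (HV m). lra.
    - intros i _. f_equal; apply Hlim; [apply Hb | apply Hb']. }
  (* With the first coordinate fixed to [n], the weak limit over the remaining ones is [bn n]. These
     limits tend to [bh] along [U], and are constant in [n] if [h] ignores that coordinate. *)
  assert (Hlims : forall (h : cfg -> nat -> R) (Dh : nat -> nat -> Prop) bh,
    (forall s s', agree Dh s s' -> forall i, h s i = h s' i) ->
    (forall s i, 0 <= h s i) -> (forall s n, l2 n (h s) <= B) ->
    (forall i, is_ulim (prodU (p0 :: ps) s) (fun c => h c i) (bh i)) ->
    exists bn : nat -> nat -> R,
      (forall n i, is_ulim (prodU ps (upd s p0 n)) (fun c => h c i) (bn n i)) /\
      (forall i, is_ulim U (fun n => bn n i) (bh i)) /\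
      (forall n i, 0 <= bn n i) /\ (forall n m, l2 m (bn n) <= B) /\
      (~ Dh (fst p0) (snd p0) -> forall n i, bn n i = bh i)).
  { intros h Dh bh Hh Hh0 HhB Hbh.
    assert (Hhabs : forall c i, Rabs (h c i) <= B).
    { intros c i. rewrite Rabs_pos_eq by auto.
      eapply Rle_trans; [|apply (HhB c (S i))]. apply l2_ge_term; [lia | auto]. }
    set (bn := fun n i => ulim (prodU ps (upd s p0 n)) (fun c => h c i)).
    assert (Hbn : forall n i, is_ulim (prodU ps (upd s p0 n)) (fun c => h c i) (bn n i)).
    { intros n i. apply ulim_spec with B; [apply prodU_ultra | auto]. }
    assert (Hlim : forall i, is_ulim U (fun n => bn n i) (bh i)).
    { intros i e He. apply (ultra_mono U _ _ HU) with (2 := Hbh i (e / 2) ltac:(lra)).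
      intros n Hn. pose proof (prodU_ultra ps (upd s p0 n)) as HW.
      destruct (ultra_ex _ _ HW (ultra_and _ _ _ HW Hn (Hbn n i (e / 2) ltac:(lra)))) as [c [H1 H2]].
      replace (bn n i - bh i) with (- (h c i - bn n i) + (h c i - bh i)) by ring.
      eapply Rle_lt_trans; [apply Rabs_triang|]. rewrite Rabs_Ropp. lra. }
    exists bn. repeat split; auto.
    - intros n i. apply (is_ulim_ge _ _ _ _ (prodU_ultra _ _) (Hbn n i)).
      apply ultra_true; [apply prodU_ultra | auto].
    - intros n m. apply (l2_ulim_le (prodU ps (upd s p0 n)) h); auto; [apply prodU_ultra| |].
      + intros i. apply (is_ulim_ge _ _ _ _ (prodU_ultra _ _) (Hbn n i)).
        apply ultra_true; [apply prodU_ultra | auto].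
      + apply ultra_true; [apply prodU_ultra | auto].
    - intros HD n i. apply (is_ulim_unique U (fun n => bn n i)); auto.
      intros e He. apply ultra_true; auto. intros n'.
      replace (bn n' i) with (bn n i); [now rewrite Rminus_diag, Rabs_R0|].
      apply (is_ulim_unique (prodU ps (upd s p0 n')) (fun c => h c i)); auto; [apply prodU_ultra|].
      intros e' He'. specialize (Hbn n i e' He').
      apply (prodU_agree Dh) with (upd s p0 n); auto.
      + intros c c' Hcc. now rewrite (Hh c c' Hcc).
      + intros j r Hjr. rewrite (agree_upd_out Dh s p0 n HD j r Hjr).
        now rewrite (agree_upd_out Dh s p0 n' HD j r Hjr). }
  destruct (Hlims p Dp b Hp Hp0 HpB Hb) as [bn [Hbn [Hbl [Hbp [HbB Hbc]]]]].
  destruct (Hlims q Dq b' Hq Hq0 HqB Hb') as [bn' [Hbn' [Hbl' [Hbp' [HbB' Hbc']]]]].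
  (* At most one of the two factors depends on the coordinate being chosen. The other already equals
     its limit and serves as the fixed vector in [weak_limit_inner]. *)
  assert (HUn : U (fun n => forall m, rsum m (fun i => bn n i * bn' n i) <= V + eps / 2)).
  { assert (Hb0 : forall i, 0 <= b i).
    { intros i. apply (is_ulim_ge _ _ _ _ HU (Hbl i)). apply ultra_true; auto. }
    assert (Hb0' : forall i, 0 <= b' i).
    { intros i. apply (is_ulim_ge _ _ _ _ HU (Hbl' i)). apply ultra_true; auto. }
    destruct (classic (Dq (fst p0) (snd p0))) as [HD|HD].
    - assert (HDp : ~ Dp (fst p0) (snd p0)) by (intros H; now apply (Hdisj _ _ H)).
      apply (ultra_mono U _ _ HU) with
        (2 := weak_limit_inner b b' bn' B V (eps / 2)
           ltac:(intros m; replace b with (bn 0%nat) by (apply functional_extensionality; auto); auto)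
           HbB' Hb0 Hbp' Hbl'
           ltac:(intros m; rewrite (rsum_ext m _ (fun i => b i * b' i)) by (intros; ring); auto)
           ltac:(lra)).
      intros n Hn m. rewrite (rsum_ext m _ (fun i => bn' n i * b i)); auto.
      intros i _. rewrite (Hbc HDp). ring.
    - apply (ultra_mono U _ _ HU) with
        (2 := weak_limit_inner b' b bn B V (eps / 2)
           ltac:(intros m; replace b' with (bn' 0%nat) by (apply functional_extensionality; auto); auto)
           HbB Hb0' Hbp Hbl HV ltac:(lra)).
      intros n Hn m. rewrite (rsum_ext m _ (fun i => bn n i * b' i)); auto.
      intros i _. now rewrite (Hbc' HD). }
  simpl. apply (ultra_mono U _ _ HU) with (2 := HUn). intros n Hn.
  (* Half of [eps] is spent on the first coordinate; the other half goes to the induction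
     hypothesis. *)
  replace (V + eps) with (V + eps / 2 + eps / 2) by lra.
  apply (IH (upd s p0 n) (bn n) (bn' n)); auto. lra.
Qed.

End Product.

(* The order in which a plegma family (s_j)_{j<L} of k-sets is chosen: all first elements,
   then all second elements, and so on. *)
Fixpoint positions (k L : nat) : list (nat * nat) :=
  match k with
  | O => nil
  | S k' => positions k' L ++ map (fun j => (j, k')) (seq 0 L)
  end.

Lemma positions_length k L : length (positions k L) = (k * L)%nat.
Proof.
  induction k as [|k IH]; simpl; [reflexivity|].
  rewrite length_app, IH, length_map, length_seq. lia.
Qed.

Lemma positions_nth k L r j : (r < k)%nat -> (j < L)%nat ->
  nth (r * L + j) (positions k L) (0%nat, 0%nat) = (j, r).
Proof.
  induction k as [|k IH]; intros Hr Hj; [lia|]. simpl.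
  destruct (Nat.eq_dec r k) as [->|Hne].
  - rewrite app_nth2; rewrite positions_length; [|lia].
    replace (k * L + j - k * L)%nat with j by lia.
    rewrite (nth_indep _ _ (0%nat, k)) by (rewrite length_map, length_seq; lia).
    rewrite (map_nth (fun j : nat => (j, k)) (seq 0 L) 0%nat j), seq_nth by assumption. reflexivity.
  - rewrite app_nth1; [apply IH; lia|]. rewrite positions_length. nia.
Qed.

Lemma position_index k L p : (p < k * L)%nat ->
  exists r j, (r < k)%nat /\ (j < L)%nat /\ p = (r * L + j)%nat.
Proof.
  intros Hp. assert (L <> 0)%nat by (intros ->; lia).
  exists (p / L)%nat, (p mod L)%nat. repeat split.
  - apply Nat.Div0.div_lt_upper_bound. lia.
  - apply Nat.mod_upper_bound. assumption.
  - rewrite Nat.mul_comm. now apply Nat.div_mod.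
Qed.

Lemma position_lt L r j r' j' : (j < L)%nat -> (j' < L)%nat ->
  (r' * L + j' < r * L + j)%nat -> (r' < r \/ (r' = r /\ j' < j))%nat.
Proof.
  intros Hj Hj' H. destruct (Nat.lt_trichotomy r' r) as [|[->|Hlt]]; [lia | lia |].
  pose proof (Nat.mul_le_mono_r (S r) r' L Hlt). simpl in *. lia.
Qed.

Lemma position_inj L r j r' j' : (j < L)%nat -> (j' < L)%nat ->
  (r' * L + j' = r * L + j)%nat -> r' = r /\ j' = j.
Proof.
  intros Hj Hj' H. destruct (Nat.lt_trichotomy r' r) as [Hlt|[->|Hlt]]; [|lia|].
  - pose proof (Nat.mul_le_mono_r (S r') r L Hlt). simpl in *. lia.
  - pose proof (Nat.mul_le_mono_r (S r) r' L Hlt). simpl in *. lia.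
Qed.

Lemma positions_filter k L1 L : (L1 <= L)%nat ->
  filter (fun p => fst p <? L1) (positions k L) = positions k L1.
Proof.
  intros HL. induction k as [|k IH]; simpl; [reflexivity|].
  rewrite filter_app, IH. f_equal.
  replace L with (L1 + (L - L1))%nat by lia. rewrite seq_app, map_app, filter_app.
  rewrite <- (app_nil_r (map _ (seq 0 L1))) at 2. f_equal.
  - apply forallb_filter_id, forallb_forall. intros p Hp.
    apply in_map_iff in Hp as [j [<- Hj]]. apply in_seq in Hj. apply Nat.ltb_lt. simpl. lia.
  - assert (Hn : forall l, (forall x, In x l -> (fst x <? L1) = false) ->
      filter (fun p : nat * nat => fst p <? L1) l = nil).
    { induction l as [|x l IHl]; intros Hl; simpl; [reflexivity|].
      rewrite (Hl x) by now left. apply IHl. intros; apply Hl. now right. }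
    apply Hn. intros p Hp. apply in_map_iff in Hp as [j [<- Hj]].
    apply in_seq in Hj. apply Nat.ltb_ge. simpl. lia.
Qed.

(** * The norm *)

Definition seg (a b : nat) : (nat -> R) -> nat -> R :=
  restr (fun i => (a <=? i) && (i <? b)).

Lemma seg_in a b v i : (a <= i < b)%nat -> seg a b v i = v i.
Proof.
  intros H. unfold seg, restr.
  rewrite (proj2 (Nat.leb_le a i)) by lia. now rewrite (proj2 (Nat.ltb_lt i b)) by lia.
Qed.

Lemma seg_out a b v i : (i < a \/ b <= i)%nat -> seg a b v i = 0.
Proof.
  intros H. unfold seg, restr.
  destruct (Nat.leb_spec a i); destruct (Nat.ltb_spec i b); simpl; auto; lia.
Qed.

Lemma seg_cases a b v i :
  ((a <= i < b)%nat /\ seg a b v i = v i) \/ ((i < a \/ b <= i)%nat /\ seg a b v i = 0).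
Proof.
  destruct (le_lt_dec a i); [destruct (lt_dec i b)|].
  - left; split; [lia | apply seg_in; lia].
  - right; split; [lia | apply seg_out; lia].
  - right; split; [lia | apply seg_out; lia].
Qed.

Lemma seg_finsupp a b v : finsupp (seg a b v).
Proof. exists b. intros n Hn. apply seg_out; lia. Qed.

Lemma restr_finsupp E x : finsupp x -> finsupp (restr E x).
Proof. intros [b Hb]. exists b. intros n Hn. unfold restr. destruct (E n); auto. Qed.

Lemma restr_finite_finsupp E x : finite_set E -> finsupp (restr E x).
Proof.
  intros [b Hb]. exists b. intros n Hn. unfold restr.
  destruct (E n) eqn:HE; auto. apply Hb in HE. lia.
Qed.

Lemma Rabs_restr_le E x i : Rabs (restr E x i) <= Rabs (x i).
Proof. unfold restr. destruct (E i); [lra | rewrite Rabs_R0; apply Rabs_pos]. Qed.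

Lemma Rabs_seg_le a b x i : Rabs (seg a b x i) <= Rabs (x i).
Proof. apply Rabs_restr_le. Qed.

Lemma lub_unique E a b : is_lub E a -> is_lub E b -> a = b.
Proof. intros [Ha Ha'] [Hb Hb']. apply Rle_antisym; auto. Qed.

Lemma successive_family_bounded n E : successive_family n E ->
  exists b, forall q i, (q < n)%nat -> E q i = true -> (i < b)%nat.
Proof.
  intros [HE _]. induction n as [|n IH].
  - exists 0%nat. intros; lia.
  - destruct IH as [b Hb]; [intros; apply HE; lia|].
    destruct (HE n) as [[b' Hb'] _]; [lia|]. exists (max b b').
    intros q i Hq Hi. destruct (Nat.eq_dec q n) as [->|Hne].
    + apply Hb' in Hi. lia.
    + apply Hb in Hi; lia.
Qed.

(** The measure on which the induction in [N_comb] runs. *)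
Fixpoint supp_count (b : nat) (x : nat -> R) : nat :=
  match b with
  | O => O
  | S b' => (supp_count b' x + if Req_EM_T (x b') 0 then 0 else 1)%nat
  end.

Lemma supp_count_restr_le b E x : (supp_count b (restr E x) <= supp_count b x)%nat.
Proof.
  induction b as [|b IH]; simpl; [lia|].
  destruct (Req_EM_T (x b) 0) as [H|H]; destruct (Req_EM_T (restr E x b) 0) as [H'|H']; try lia.
  exfalso. apply H'. unfold restr. destruct (E b); auto.
Qed.

Lemma supp_count_restr_lt b E x i :
  (i < b)%nat -> x i <> 0 -> E i = false -> (supp_count b (restr E x) < supp_count b x)%nat.
Proof.
  induction b as [|b IH]; intros Hi Hx HE; [lia|]. simpl.
  destruct (Nat.eq_dec i b) as [->|Hne].
  - destruct (Req_EM_T (x b) 0); [contradiction|].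
    destruct (Req_EM_T (restr E x b) 0) as [H'|H'].
    + pose proof (supp_count_restr_le b E x). lia.
    + exfalso. apply H'. unfold restr. now rewrite HE.
  - assert (i < b)%nat by lia. specialize (IH H Hx HE).
    destruct (Req_EM_T (x b) 0) as [H0|H0]; destruct (Req_EM_T (restr E x b) 0) as [H'|H']; try lia.
    exfalso. apply H'. unfold restr. destruct (E b); auto.
Qed.

Section Norm.
Variables (nseq mseq : nat -> nat) (N : (nat -> R) -> R).
Hypothesis Hn_pos : forall j, (0 < nseq j)%nat.
Hypothesis Hm_pos : forall j, (0 < mseq j)%nat.
Hypothesis Hsum : exists S, infinite_sum (fun j => / INR (mseq j)) S /\ S <= 1 / 10.
Hypothesis Hgrowth : forall a, 0 < a ->
      cv_infty (fun j => Rpower (INR (nseq j)) a / INR (mseq j)).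
Hypothesis HN : implicit_norm nseq mseq N.

Lemma INR_mseq_pos j : 0 < INR (mseq j).
Proof. apply lt_0_INR, Hm_pos. Qed.

Lemma inv_mseq_pos j : 0 < / INR (mseq j).
Proof. apply Rinv_0_lt_compat, INR_mseq_pos. Qed.

Lemma rsum_inv_mseq n : rsum n (fun j => / INR (mseq j)) <= 1 / 10.
Proof.
  destruct Hsum as [S [HS HS']].
  assert (Hp : forall j, 0 <= / INR (mseq j)) by (intros; left; apply inv_mseq_pos).
  apply Rle_trans with (rsum (Datatypes.S n) (fun j => / INR (mseq j))).
  - simpl. specialize (Hp n). lra.
  - rewrite rsum_sum_f_R0. apply Rle_trans with S; [|assumption].
    apply sum_incr; [exact HS | exact Hp].
Qed.

(** The seminorm of index [i] in the theorem. The choice by [epsilon] gives it a meaning whenever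
    the supremum is finite, in particular for infinitely supported vectors bounded in the sense of
    [leN]. *)
Definition Tn (i : nat) (v : nat -> R) : R :=
  epsilon (inhabits 0) (is_lub (jset nseq mseq N v i)).

(** The form in which the implicit equation is used from here on: maximum and series are replaced by
    bounds on coordinates and on truncations of the profile [Tn j x], with [N x] the least common
    bound. *)
Lemma N_spec x : finsupp x ->
  (forall j, is_lub (jset nseq mseq N x j) (Tn j x)) /\
  (forall i, Rabs (x i) <= N x) /\
  (forall n, l2 n (fun j => Tn j x) <= N x) /\
  (forall B, (forall i, Rabs (x i) <= B) -> (forall n, l2 n (fun j => Tn j x) <= B) -> N x <= B).
Proof.
  intros Hx. destruct (HN x Hx) as [t [S [sup [Ht [HS [Hsup HNx]]]]]].
  assert (HT : forall j, is_lub (jset nseq mseq N x j) (Tn j x)).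
  { intros j. unfold Tn. apply epsilon_spec. eauto. }
  assert (HTt : (fun j => Tn j x) = t).
  { apply functional_extensionality. intros j. eapply lub_unique; eauto. }
  rewrite HTt.
  assert (Hsq : forall n, rsum n (fun i => t i ^ 2) <= S).
  { intros n. apply Rle_trans with (rsum (Datatypes.S n) (fun i => t i ^ 2)).
    - simpl rsum. pose proof (pow2_ge_0 (t n)). lra.
    - rewrite rsum_sum_f_R0. apply sum_incr; [exact HS | intros; apply pow2_ge_0]. }
  repeat split; auto.
  - apply HT.
  - apply HT.
  - intros i. rewrite HNx. apply Rle_trans with sup; [|apply Rmax_l].
    apply Hsup. eauto.
  - intros n. rewrite HNx. apply Rle_trans with (sqrt S); [|apply Rmax_r].
    apply sqrt_le_1_alt, Hsq.
  - intros B HB HB2. rewrite HNx. apply Rmax_lub.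
    + apply Hsup. intros r [i ->]. apply HB.
    + assert (0 <= B) by (eapply Rle_trans; [apply (l2_nonneg 0 t) | apply HB2]).
      rewrite <- (sqrt_pow2 B) by assumption. apply sqrt_le_1_alt.
      apply Rnot_lt_le. intros Hlt.
      destruct (HS (S - B ^ 2)) as [n Hn]; [lra|].
      specialize (Hn n (le_n n)). unfold Rdist in Hn. rewrite <- rsum_sum_f_R0 in Hn.
      pose proof (proj1 (l2_le_iff (Datatypes.S n) t B H) (HB2 _)).
      rewrite Rabs_left1 in Hn by lra. lra.
Qed.

Lemma N_nonneg x : finsupp x -> 0 <= N x.
Proof.
  intros Hx. eapply Rle_trans; [apply (Rabs_pos (x 0%nat)) | now apply N_spec].
Qed.

Lemma Tn_ge x j E : finsupp x -> successive_family (nseq j) E ->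
  / INR (mseq j) * rsum (nseq j) (fun q => N (restr (E q) x)) <= Tn j x.
Proof. intros Hx HE. apply (proj1 (N_spec x Hx)). exists E. auto. Qed.

Lemma Tn_le_N x j : finsupp x -> Tn j x <= N x.
Proof.
  intros Hx. destruct (Rle_dec 0 (Tn j x)).
  - eapply Rle_trans; [|apply (proj1 (proj2 (proj2 (N_spec x Hx))) (S j))].
    apply (l2_ge_term (S j) (fun j => Tn j x)); [lia | assumption].
  - pose proof (N_nonneg x Hx). lra.
Qed.

Lemma singleton_successive n : successive_family n (fun q i => i =? q).
Proof.
  split.
  - intros q _. split.
    + exists (S q). intros i Hi. apply Nat.eqb_eq in Hi. lia.
    + exists q. apply Nat.eqb_refl.
  - intros q q' i i' Hq _ Hi Hi'.
    apply Nat.eqb_eq in Hi. apply Nat.eqb_eq in Hi'. lia.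
Qed.

Lemma finsupp_zero : finsupp (fun _ => 0).
Proof. exists 0%nat. auto. Qed.

Lemma nseq_over_mseq_unbounded B : exists j, B < INR (nseq j) / INR (mseq j).
Proof.
  destruct (Hgrowth 1 Rlt_0_1 B) as [j Hj]. exists j. specialize (Hj j (le_n j)).
  rewrite Rpower_1 in Hj; [assumption | apply lt_0_INR, Hn_pos].
Qed.

(** The equation might a priori have a positive value at 0. Testing with [nseq j] singletons shows
    that this value is at least [n_j / m_j] times itself, and [n_j / m_j > 1] for some [j]. *)
Lemma N_zero : N (fun _ => 0) = 0.
Proof.
  pose proof (N_nonneg _ finsupp_zero) as Hp.
  destruct (Req_dec (N (fun _ => 0)) 0) as [|Hne]; [assumption|exfalso].
  destruct (nseq_over_mseq_unbounded 1) as [j Hj].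
  pose proof (Tn_ge _ j _ finsupp_zero (singleton_successive (nseq j))) as H1.
  pose proof (Tn_le_N (fun _ => 0) j finsupp_zero) as H2.
  rewrite (rsum_ext _ _ (fun _ => N (fun _ => 0))) in H1.
  2:{ intros i _. f_equal. apply functional_extensionality. intros i'.
      unfold restr. destruct (i' =? i); auto. }
  rewrite rsum_const in H1.
  assert (INR (nseq j) / INR (mseq j) * N (fun _ => 0) <= N (fun _ => 0))
    by (unfold Rdiv; nra).
  nra.
Qed.

Lemma N_zero_ext x : (forall i, x i = 0) -> N x = 0.
Proof.
  intros H. replace x with (fun _ : nat => 0); [apply N_zero|].
  now apply functional_extensionality.
Qed.

Lemma N_over_mseq_le_Tn x j : finsupp x -> N x * / INR (mseq j) <= Tn j x.
Proof.
  intros Hx. destruct (Hx) as [b Hb].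
  (* [E 0] swallows the whole support. The sets of a successive family must be nonempty, so the
     others are singletons beyond [b]. *)
  set (E := fun q i => if q =? 0 then i <? S b else i =? (b + q)%nat).
  assert (HE : successive_family (nseq j) E).
  { split.
    - intros q _. unfold E. destruct (Nat.eqb_spec q 0); split.
      + exists (S b). intros i Hi. now apply Nat.ltb_lt in Hi.
      + exists b. apply Nat.ltb_lt. lia.
      + exists (S (b + q)). intros i Hi. apply Nat.eqb_eq in Hi. lia.
      + exists (b + q)%nat. apply Nat.eqb_refl.
    - intros q q' i i' Hq _ Hi Hi'. unfold E in *.
      destruct (Nat.eqb_spec q' 0); [lia|]. apply Nat.eqb_eq in Hi'.
      destruct (Nat.eqb_spec q 0).
      + apply Nat.ltb_lt in Hi. lia.
      + apply Nat.eqb_eq in Hi. lia. }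
  eapply Rle_trans; [|apply (Tn_ge x j E Hx HE)].
  rewrite Rmult_comm. apply Rmult_le_compat_l; [left; apply inv_mseq_pos|].
  eapply Rle_trans; [|apply (rsum_ge_term _ _ 0%nat)].
  - right. f_equal. apply functional_extensionality. intros i.
    unfold restr, E. simpl. destruct (Nat.ltb_spec i (S b)); [reflexivity|].
    apply Hb. lia.
  - apply Hn_pos.
  - intros. now apply N_nonneg, restr_finsupp.
Qed.

Lemma Tn_nonneg x j : finsupp x -> 0 <= Tn j x.
Proof.
  intros Hx. eapply Rle_trans; [|now apply N_over_mseq_le_Tn].
  pose proof (N_nonneg x Hx). pose proof (inv_mseq_pos j). nra.
Qed.

(* Triangle inequality, homogeneity and unconditionality at once. Induction on the
   support: a family E which splits supp x is covered by the induction hypothesis, one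
   which does not contributes N x / m_j; as sum 1/m_j <= 1/10, the second kind can only
   account for a tenth of a hypothetical excess D of N x over the claimed bound. *)
Lemma N_comb x y z al be : finsupp x -> finsupp y -> finsupp z -> 0 <= al -> 0 <= be ->
  (forall i, Rabs (x i) <= al * Rabs (y i) + be * Rabs (z i)) ->
  N x <= al * N y + be * N z.
Proof.
  intros Hx Hy Hz Hal Hbe. destruct (Hx) as [b Hb].
  remember (S (supp_count b x)) as m eqn:Em.
  assert (Hm : (supp_count b x < m)%nat) by lia. clear Em.
  revert x y z Hx Hb Hy Hz Hm.
  induction m as [|m IH]; intros x y z Hx Hb Hy Hz Hm H; [lia|].
  set (V := al * N y + be * N z).
  pose proof (N_nonneg y Hy) as Hy0. pose proof (N_nonneg z Hz) as Hz0.
  assert (HV : 0 <= V) by (unfold V; nra).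
  apply Rnot_lt_le. intros Hlt. set (D := N x - V).
  assert (HD : 0 < D) by (unfold D; lra).
  set (tau := fun j => al * Tn j y + be * Tn j z).
  assert (Htau : forall j, V * / INR (mseq j) <= tau j).
  { intros j. unfold V, tau.
    pose proof (N_over_mseq_le_Tn y j Hy). pose proof (N_over_mseq_le_Tn z j Hz). nra. }
  assert (HT : forall j, Tn j x <= tau j + D * / INR (mseq j)).
  { intros j. apply (proj1 (N_spec x Hx)). intros r [E [HE ->]].
    pose proof (inv_mseq_pos j) as Hmj.
    destruct (classic (exists q, (q < nseq j)%nat /\ forall i, x i <> 0 -> E q i = true))
      as [[q [Hq Hall]]|Hnone].
    - rewrite (rsum_single _ _ q Hq).
      + replace (restr (E q) x) with x.
        * specialize (Htau j). replace (N x) with (V + D) by (unfold D; lra). lra.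
        * apply functional_extensionality. intros i. unfold restr.
          destruct (Req_EM_T (x i) 0) as [H0|H0]; [rewrite H0; now destruct (E q i)|].
          now rewrite Hall.
      + intros q' Hq' Hne. apply N_zero_ext. intros i. unfold restr.
        destruct (E q' i) eqn:HEi; [|reflexivity].
        destruct (Req_EM_T (x i) 0) as [|H0]; [assumption|exfalso].
        apply Hall in H0. destruct HE as [_ HE].
        destruct (Nat.lt_gt_cases q' q) as [Hc _]. destruct (Hc Hne) as [Hc'|Hc'].
        * pose proof (HE q' q i i Hc' Hq HEi H0). lia.
        * pose proof (HE q q' i i Hc' Hq' H0 HEi). lia.
    - apply Rle_trans with (/ INR (mseq j) *
        rsum (nseq j) (fun q => al * N (restr (E q) y) + be * N (restr (E q) z))).
      + apply Rmult_le_compat_l; [lra|]. apply rsum_le. intros q Hq.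
        apply IH; try now apply restr_finsupp.
        * intros n Hn. unfold restr. rewrite Hb by assumption. now destruct (E q n).
        * assert (exists i, x i <> 0 /\ E q i = false) as [i [Hi HEi]].
          { apply NNPP. intros Hno. apply Hnone. exists q. split; [assumption|].
            intros i Hi. apply NNPP. intros HEi. apply Hno. exists i. split; [assumption|].
            now destruct (E q i). }
          assert (i < b)%nat.
          { apply Nat.nle_gt. intros Hbi. apply Hi. now apply Hb. }
          pose proof (supp_count_restr_lt b (E q) x i H0 Hi HEi). lia.
        * intros i. unfold restr. destruct (E q i); [apply H|].
          rewrite Rabs_R0. lra.
      + rewrite rsum_plus, !rsum_scal.
        pose proof (Tn_ge y j E Hy HE). pose proof (Tn_ge z j E Hz HE).
        unfold tau. assert (0 <= D * / INR (mseq j)) by nra. nra. }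
  assert (HNx : N x <= V + D * (1 / 10)).
  { apply (N_spec x Hx).
    - intros i. eapply Rle_trans; [apply H|].
      pose proof (proj1 (proj2 (N_spec y Hy)) i). pose proof (proj1 (proj2 (N_spec z Hz)) i).
      unfold V. nra.
    - intros n.
      apply Rle_trans with (l2 n (fun j => (al * Tn j y + be * Tn j z) + D * / INR (mseq j))).
      { apply l2_mono. intros i _. split; [now apply Tn_nonneg | apply HT]. }
      eapply Rle_trans; [apply l2_triangle|].
      pose proof (l2_triangle n (fun j => al * Tn j y) (fun j => be * Tn j z)) as H1.
      rewrite !l2_scal, !Rabs_pos_eq in H1 by assumption.
      rewrite l2_scal, Rabs_pos_eq by lra.
      assert (l2 n (fun j => / INR (mseq j)) <= 1 / 10).
      { eapply Rle_trans; [apply l2_le_rsum | apply rsum_inv_mseq].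
        intros; left; apply inv_mseq_pos. }
      pose proof (proj1 (proj2 (proj2 (N_spec y Hy))) n).
      pose proof (proj1 (proj2 (proj2 (N_spec z Hz))) n).
      unfold V. nra. }
  unfold D in *. lra.
Qed.

Lemma N_mono x y : finsupp x -> finsupp y ->
  (forall i, Rabs (x i) <= Rabs (y i)) -> N x <= N y.
Proof.
  intros Hx Hy H. pose proof (N_comb x y y 1 0 Hx Hy Hy) as H1.
  enough (N x <= 1 * N y + 0 * N y) by lra. apply H1; try lra.
  intros i. specialize (H i). lra.
Qed.

(* The bound B for the norm of a vector v which need not be finitely supported, where N has
   no meaning. *)
Definition leN (v : nat -> R) (B : R) : Prop := forall c, N (seg 0 c v) <= B.

Lemma leN_of_N x : finsupp x -> leN x (N x).
Proof.
  intros Hx c. apply N_mono; [apply seg_finsupp | assumption |].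
  intros; apply Rabs_seg_le.
Qed.

Lemma N_of_leN x B : finsupp x -> leN x B -> N x <= B.
Proof.
  intros [b Hb] H. replace x with (seg 0 b x); [apply H|].
  apply functional_extensionality. intros i.
  destruct (seg_cases 0 b x i) as [[Hi ->]|[Hi ->]]; [reflexivity|].
  symmetry. apply Hb. lia.
Qed.

Lemma leN_weaken v A B : leN v A -> A <= B -> leN v B.
Proof. intros H HAB c. eapply Rle_trans; [apply H | assumption]. Qed.

Lemma leN_comb v y z al be A B : 0 <= al -> 0 <= be -> leN y A -> leN z B ->
  (forall i, Rabs (v i) <= al * Rabs (y i) + be * Rabs (z i)) ->
  leN v (al * A + be * B).
Proof.
  intros Hal Hbe Hy Hz H c.
  apply Rle_trans with (al * N (seg 0 c y) + be * N (seg 0 c z)).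
  - apply N_comb; try apply seg_finsupp; try assumption.
    intros i. destruct (seg_cases 0 c v i) as [[Hi ->]|[Hi ->]].
    + rewrite !seg_in by assumption. apply H.
    + rewrite !seg_out, Rabs_R0 by assumption. lra.
  - specialize (Hy c). specialize (Hz c). nra.
Qed.

Lemma leN_zero v : (forall i, v i = 0) -> leN v 0.
Proof.
  intros H c. right. apply N_zero_ext. intros i.
  destruct (seg_cases 0 c v i) as [[_ ->]|[_ ->]]; auto.
Qed.

Lemma leN_mono v y A : leN y A -> (forall i, Rabs (v i) <= Rabs (y i)) -> leN v A.
Proof.
  intros Hy H. apply leN_weaken with (1 * A + 0 * A); [|lra].
  apply leN_comb with y y; try lra; auto. intros i. specialize (H i). lra.
Qed.

Lemma leN_plus v y z A B : leN y A -> leN z B -> (forall i, v i = y i + z i) -> leN v (A + B).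
Proof.
  intros Hy Hz H. apply leN_weaken with (1 * A + 1 * B); [|lra].
  apply leN_comb with y z; try lra; auto.
  intros i. rewrite H, !Rmult_1_l. apply Rabs_triang.
Qed.

Lemma leN_scal v y c A : leN y A -> (forall i, v i = c * y i) -> leN v (Rabs c * A).
Proof.
  intros Hy H. apply leN_weaken with (Rabs c * A + 0 * A); [|lra].
  apply leN_comb with y y; try lra; auto; [apply Rabs_pos|].
  intros i. rewrite H, Rabs_mult. lra.
Qed.

Lemma leN_opp v y A : leN y A -> (forall i, v i = - y i) -> leN v A.
Proof. intros Hy H. apply leN_mono with y; auto. intros i. rewrite H, Rabs_Ropp. lra. Qed.

Lemma leN_rsum n (a : nat -> R) (y : nat -> nat -> R) A :
  (forall j, (j < n)%nat -> leN (y j) (A j)) ->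
  leN (fun i => rsum n (fun j => a j * y j i)) (rsum n (fun j => Rabs (a j) * A j)).
Proof.
  induction n as [|n IH]; intros H; simpl.
  - now apply leN_zero.
  - eapply leN_plus; [apply IH; intros; apply H; lia | | intros; reflexivity].
    apply leN_scal with (y n); [apply H; lia | reflexivity].
Qed.

Lemma leN_rsum1 n (y : nat -> nat -> R) A :
  (forall j, (j < n)%nat -> leN (y j) (A j)) ->
  leN (fun i => rsum n (fun j => y j i)) (rsum n A).
Proof.
  induction n as [|n IH]; intros H; simpl.
  - now apply leN_zero.
  - eapply leN_plus; [apply IH; intros; apply H; lia | apply H; lia | reflexivity].
Qed.

Lemma leN_seg v A a b : leN v A -> leN (seg a b v) A.
Proof. intros H. apply leN_mono with v; auto. intros; apply Rabs_seg_le. Qed.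

Lemma leN_coord v A i : leN v A -> Rabs (v i) <= A.
Proof.
  intros H. eapply Rle_trans; [|apply (H (S i))].
  rewrite <- (seg_in 0 (S i) v i) at 1 by lia. apply N_spec, seg_finsupp.
Qed.

(** Every admissible family lies in an initial segment, where [N] is bounded by [A]; hence the
    supremum is finite even when [v] has infinite support. *)
Lemma leN_is_lub v A j : leN v A -> is_lub (jset nseq mseq N v j) (Tn j v).
Proof.
  intros H. unfold Tn. apply epsilon_spec.
  destruct (completeness (jset nseq mseq N v j)) as [l Hl].
  - exists A. intros r [E [HE ->]].
    destruct (successive_family_bounded _ _ HE) as [b Hb].
    eapply Rle_trans; [|apply (H b)].
    eapply Rle_trans; [|apply (Tn_le_N _ j), seg_finsupp].
    eapply Rle_trans; [|apply (Tn_ge _ j E); [apply seg_finsupp | assumption]].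
    right. f_equal. apply rsum_ext. intros q Hq. f_equal.
    apply functional_extensionality. intros i. unfold restr at 1 2.
    destruct (E q i) eqn:HEi; [|reflexivity].
    rewrite seg_in; [reflexivity|]. apply Hb in HEi; auto. lia.
  - exists (/ INR (mseq j) * rsum (nseq j) (fun q => N (restr (fun i => i =? q) v))).
    exists (fun q i => i =? q). split; [apply singleton_successive | reflexivity].
  - eauto.
Qed.

Lemma leN_Tn_comb j v y z al be A B C : 0 <= al -> 0 <= be -> leN v C -> leN y A -> leN z B ->
  (forall i, Rabs (v i) <= al * Rabs (y i) + be * Rabs (z i)) ->
  Tn j v <= al * Tn j y + be * Tn j z.
Proof.
  intros Hal Hbe Hv Hy Hz H. apply (leN_is_lub v C j Hv). intros r [E [HE ->]].
  apply Rle_trans with (/ INR (mseq j) *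
        rsum (nseq j) (fun q => al * N (restr (E q) y) + be * N (restr (E q) z))).
  - apply Rmult_le_compat_l; [left; apply inv_mseq_pos|]. apply rsum_le. intros q Hq.
    destruct HE as [HE _]. destruct (HE q Hq) as [Hf _].
    apply N_comb; try now apply restr_finite_finsupp. all: try assumption.
    intros i. unfold restr. destruct (E q i); [apply H|]. rewrite Rabs_R0. lra.
  - rewrite rsum_plus, !rsum_scal.
    assert (/ INR (mseq j) * rsum (nseq j) (fun q => N (restr (E q) y)) <= Tn j y)
      by (apply (leN_is_lub y A j Hy); exists E; auto).
    assert (/ INR (mseq j) * rsum (nseq j) (fun q => N (restr (E q) z)) <= Tn j z)
      by (apply (leN_is_lub z B j Hz); exists E; auto).
    nra.
Qed.

Lemma leN_Tn_nonneg j v A : leN v A -> 0 <= Tn j v.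
Proof.
  intros H.
  refine (Rle_trans _ _ _ _ (proj1 (leN_is_lub v A j H) _
    (ex_intro _ (fun q i => i =? q) (conj (singleton_successive _) eq_refl)))).
  apply Rmult_le_pos; [left; apply inv_mseq_pos|]. apply rsum_nonneg.
  intros q _. apply N_nonneg. exists (S q). intros i Hi. unfold restr.
  destruct (Nat.eqb_spec i q); [lia | reflexivity].
Qed.

(** A family that nearly attains the supremum sees only an initial segment; monotonicity in the
    segment then allows one [c] for all [j < n]. *)
Lemma leN_Tn_seg_approx v A eps n : leN v A -> 0 < eps ->
  exists c, forall j, (j < n)%nat -> Tn j v <= Tn j (seg 0 c v) + eps.
Proof.
  intros H Heps.
  assert (Hmono : forall j c c', (c <= c')%nat -> Tn j (seg 0 c v) <= Tn j (seg 0 c' v)).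
  { intros j c c' Hc. enough (Tn j (seg 0 c v) <= 1 * Tn j (seg 0 c' v) + 0 * Tn j v) by lra.
    apply (leN_Tn_comb j _ _ _ 1 0 A A A); try lra; try now apply leN_seg. assumption.
    intros i. destruct (seg_cases 0 c v i) as [[Hi ->]|[Hi ->]].
    - rewrite seg_in by lia. lra.
    - rewrite Rabs_R0. pose proof (Rabs_pos (seg 0 c' v i)). lra. }
  induction n as [|n [c Hc]].
  { exists 0%nat. intros; lia. }
  assert (exists c', Tn n v <= Tn n (seg 0 c' v) + eps) as [c' Hc'].
  { apply NNPP. intros Hno.
    assert (Hall : forall c', Tn n (seg 0 c' v) < Tn n v - eps).
    { intros c'. apply Rnot_le_lt. intros Hle. apply Hno. exists c'. lra. }
    enough (Tn n v <= Tn n v - eps) by lra.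
    apply (leN_is_lub v A n H). intros r [E [HE ->]].
    destruct (successive_family_bounded _ _ HE) as [b Hb].
    left. eapply Rle_lt_trans; [|apply (Hall b)].
    eapply Rle_trans; [|apply (Tn_ge _ n E); [apply seg_finsupp | assumption]].
    right. f_equal. apply rsum_ext. intros q Hq. f_equal.
    apply functional_extensionality. intros i. unfold restr at 1 2.
    destruct (E q i) eqn:HEi; [|reflexivity].
    rewrite seg_in; [reflexivity|]. apply Hb in HEi; auto. lia. }
  exists (max c c'). intros j Hj. destruct (Nat.eq_dec j n) as [->|Hne].
  - eapply Rle_trans; [apply Hc'|]. apply Rplus_le_compat_r, Hmono. lia.
  - eapply Rle_trans; [apply Hc; lia|]. apply Rplus_le_compat_r, Hmono. lia.
Qed.

Lemma leN_l2 v A n : leN v A -> l2 n (fun j => Tn j v) <= A.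
Proof.
  intros H. apply Rnot_lt_le. intros Hlt.
  set (eps := (l2 n (fun j => Tn j v) - A) / (INR n + 1)).
  assert (Hn : 0 <= INR n) by apply pos_INR.
  assert (Heps : 0 < eps) by (apply Rdiv_lt_0_compat; lra).
  destruct (leN_Tn_seg_approx v A eps n H Heps) as [c Hc].
  assert (l2 n (fun j => Tn j v) <= A + INR n * eps).
  { apply Rle_trans with (l2 n (fun j => Tn j (seg 0 c v) + eps)).
    { apply l2_mono. intros j Hj. split; [now apply leN_Tn_nonneg with A | now apply Hc]. }
    eapply Rle_trans; [apply l2_triangle|]. apply Rplus_le_compat.
    - eapply Rle_trans; [|apply (H c)]. apply N_spec, seg_finsupp.
    - rewrite <- rsum_const. apply l2_le_rsum. intros; lra. }
  assert (eps * (INR n + 1) = l2 n (fun j => Tn j v) - A) by (unfold eps; field; lra).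
  lra.
Qed.

(** [A] may be much larger than [B]: it guarantees that the suprema [Tn j v] are finite. In this way
    a crude bound on a level is improved. *)
Lemma leN_of_l2 v A B : leN v A -> (forall i, Rabs (v i) <= B) ->
  (forall n, l2 n (fun j => Tn j v) <= B) -> leN v B.
Proof.
  intros H Hc Hl c. apply N_spec; [apply seg_finsupp | |].
  - intros i. eapply Rle_trans; [apply Rabs_seg_le | apply Hc].
  - intros n. eapply Rle_trans; [|apply (Hl n)]. apply l2_mono. intros j _.
    split; [now apply Tn_nonneg, seg_finsupp|].
    enough (Tn j (seg 0 c v) <= 1 * Tn j v + 0 * Tn j v) by lra.
    apply (leN_Tn_comb j _ _ _ 1 0 A A A); try lra; auto; [now apply leN_seg|].
    intros i. pose proof (Rabs_seg_le 0 c v i). lra.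
Qed.

Lemma leN_Tn_le v A j : leN v A -> Tn j v <= A.
Proof.
  intros H. eapply Rle_trans; [|apply (leN_l2 v A (S j) H)].
  apply (l2_ge_term (S j) (fun j => Tn j v)); [lia | now apply leN_Tn_nonneg with A].
Qed.

(** * Estimates from families of successive sets *)

Lemma rsum_N_seg_le x j (c : nat -> nat) :
  finsupp x -> (forall q, (q < nseq j)%nat -> (c q < c (S q))%nat) ->
  rsum (nseq j) (fun q => N (seg (c q) (c (S q)) x)) <= INR (mseq j) * N x.
Proof.
  intros Hx Hc.
  assert (Hmon : forall q q', (q <= q')%nat -> (q' <= nseq j)%nat -> (c q <= c q')%nat).
  { intros q q' Hq. induction Hq as [|q' Hq IH]; intros Hq'; [lia|].
    specialize (Hc q'). specialize (IH ltac:(lia)). lia. }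
  pose proof (Tn_ge x j (fun q i => (c q <=? i) && (i <? c (S q))) Hx) as H1.
  pose proof (Tn_le_N x j Hx) as H2.
  pose proof (INR_mseq_pos j) as Hm.
  enough (/ INR (mseq j) * rsum (nseq j) (fun q => N (seg (c q) (c (S q)) x)) <= N x) as H3.
  { apply Rmult_le_compat_l with (r := INR (mseq j)) in H3; [|lra].
    rewrite <- Rmult_assoc, Rinv_r, Rmult_1_l in H3 by lra. exact H3. }
  eapply Rle_trans; [apply H1 | apply H2]. split.
  - intros q Hq. split.
    + exists (c (S q)). intros i Hi. apply andb_prop in Hi as [_ Hi]. now apply Nat.ltb_lt in Hi.
    + exists (c q). rewrite Nat.leb_refl. apply Nat.ltb_lt. now apply Hc.
  - intros q q' i i' Hq Hq' Hi Hi'.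
    apply andb_prop in Hi as [_ Hi]. apply Nat.ltb_lt in Hi.
    apply andb_prop in Hi' as [Hi' _]. apply Nat.leb_le in Hi'.
    pose proof (Hmon (S q) q' ltac:(lia) ltac:(lia)). lia.
Qed.

(* The basis is boundedly complete: n_j far blocks of norm > eps would give norm
   > eps n_j / m_j. *)
Lemma leN_tail v A eps : leN v A -> 0 < eps ->
  exists c0, forall a b, (c0 <= a)%nat -> N (seg a b v) <= eps.
Proof.
  intros H Heps. apply NNPP. intros Hno.
  assert (Hex : forall c0, exists b, (c0 < b)%nat /\ eps < N (seg c0 b v)).
  { intros c0. apply NNPP. intros Hno'. apply Hno. exists c0. intros a b Ha.
    apply Rnot_lt_le. intros Hlt. apply Hno'. exists (S (max b c0)). split; [lia|].
    eapply Rlt_le_trans; [apply Hlt|]. apply N_mono; try apply seg_finsupp.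
    intros i. destruct (seg_cases a b v i) as [[Hi ->]|[Hi ->]].
    - rewrite seg_in by lia. lra.
    - rewrite Rabs_R0. apply Rabs_pos. }
  set (nx := fun c0 => epsilon (inhabits 0%nat) (fun b => (c0 < b)%nat /\ eps < N (seg c0 b v))).
  assert (Hnx : forall c0, (c0 < nx c0)%nat /\ eps < N (seg c0 (nx c0) v)).
  { intros c0. unfold nx. apply epsilon_spec, Hex. }
  set (c := fun q => Nat.iter q nx 0%nat).
  destruct (nseq_over_mseq_unbounded (A / eps)) as [j Hj].
  assert (Hmon : forall q q', (q <= q')%nat -> (c q <= c q')%nat).
  { intros q q' Hq. induction Hq as [|q' Hq IH]; [lia|].
    change (c (S q')) with (nx (c q')). pose proof (proj1 (Hnx (c q'))). lia. }
  pose proof (rsum_N_seg_le (seg 0 (c (nseq j)) v) j c (seg_finsupp _ _ _)) as H1.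
  assert (H2 : INR (nseq j) * eps <= INR (mseq j) * A).
  { rewrite <- rsum_const. eapply Rle_trans; [|eapply Rle_trans; [apply H1|]].
    - apply rsum_le. intros q Hq. left. eapply Rlt_le_trans; [apply (Hnx (c q))|].
      apply N_mono; try apply seg_finsupp. intros i.
      change (nx (c q)) with (c (S q)).
      destruct (seg_cases (c q) (c (S q)) v i) as [[Hi ->]|[Hi ->]].
      + rewrite seg_in, seg_in; try lra; try lia.
        pose proof (Hmon (S q) (nseq j) ltac:(lia)). lia.
      + rewrite Rabs_R0. apply Rabs_pos.
    - intros q _. apply (Hnx (c q)).
    - apply Rmult_le_compat_l; [apply pos_INR | apply H]. }
  pose proof (INR_mseq_pos j) as Hm.
  assert (A / eps * INR (mseq j) < INR (nseq j)).
  { apply Rmult_lt_compat_r with (r := INR (mseq j)) in Hj; [|lra].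
    unfold Rdiv in Hj at 2. rewrite Rmult_assoc, Rinv_l, Rmult_1_r in Hj by lra. exact Hj. }
  assert (A / eps * INR (mseq j) * eps < INR (nseq j) * eps) by nra.
  replace (A / eps * INR (mseq j) * eps) with (INR (mseq j) * A) in H3 by (field; lra).
  lra.
Qed.

(* Staircase estimate: successive sets E_q meet successive blocks z_i in at most
   n + M pairs (q, i). *)
Lemma successive_blocks_bound n M (E : nat -> nat -> bool) (z : nat -> nat -> R) (cut : nat -> nat) B :
  successive_family n E ->
  (forall i i', (i <= i')%nat -> (cut i <= cut i')%nat) ->
  (forall i l, (l < cut i \/ cut (S i) <= l)%nat -> z i l = 0) ->
  (forall i, (i < M)%nat -> N (z i) <= B) -> 0 <= B ->
  rsum n (fun q => N (restr (E q) (fun l => rsum M (fun i => z i l)))) <= B * INR (n + M).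
Proof.
  intros HE Hcut Hz HB HB0. revert n HE HB. induction M as [|M IHM]; intros n HE HB.
  { rewrite rsum_zero.
    - apply Rmult_le_pos; [assumption | apply pos_INR].
    - intros q _. apply N_zero_ext. intros l. unfold restr. simpl. now destruct (E q l). }
  assert (Hfz : forall i, finsupp (z i)).
  { intros i. exists (cut (S i)). intros l Hl. apply Hz. lia. }
  assert (Hfs : forall K, finsupp (fun l => rsum K (fun i => z i l))).
  { intros K. exists (cut K). intros l Hl. apply rsum_zero. intros i Hi. apply Hz.
    right. pose proof (Hcut (S i) K ltac:(lia)). lia. }
  assert (Hzr : forall F, N (restr F (z M)) <= B).
  { intros F. eapply Rle_trans; [|apply (HB M); lia].
    apply N_mono; [now apply restr_finsupp | apply Hfz | intros; apply Rabs_restr_le]. }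
  induction n as [|n IHn].
  { simpl. apply Rmult_le_pos; [assumption | apply (pos_INR (S M))]. }
  (* If the last set meets a block before [z M], the earlier sets lie to the left of [z M], and
     deleting that block changes only one summand. Otherwise the last set meets at most [z M] and is
     itself deleted. Either deletion costs at most [B]. *)
  destruct (classic (exists l i, (i < M)%nat /\ E n l = true /\ z i l <> 0)) as [[l0 [i0 [Hi0 [HE0 Hz0]]]]|Hno].
  - assert (Hl0 : (l0 < cut M)%nat).
    { apply Nat.nle_gt. intros Hle. apply Hz0, Hz. right.
      pose proof (Hcut (S i0) M ltac:(lia)). lia. }
    simpl rsum at 1.
    rewrite (rsum_ext n _ (fun q => N (restr (E q) (fun l => rsum M (fun i => z i l))))).
    2:{ intros q Hq. f_equal. apply functional_extensionality. intros l. unfold restr.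
        destruct (E q l) eqn:HEl; [|reflexivity].
        rewrite (Hz M l); [lra|]. left.
        pose proof (proj2 HE q n l l0 Hq ltac:(lia) HEl HE0). lia. }
    specialize (IHM (S n) HE ltac:(intros; apply HB; lia)). rewrite rsum_S in IHM.
    assert (N (restr (E n) (fun l => rsum M (fun i => z i l) + z M l)) <=
            1 * N (restr (E n) (fun l => rsum M (fun i => z i l))) + 1 * N (restr (E n) (z M))).
    { apply N_comb; try lra.
      - apply restr_finsupp. exact (Hfs (S M)).
      - apply restr_finsupp, Hfs.
      - apply restr_finsupp, Hfz.
      - intros l. unfold restr. destruct (E n l); [|rewrite Rabs_R0; lra].
        rewrite !Rmult_1_l. apply Rabs_triang. }
    pose proof (Hzr (E n)).
    replace (S n + S M)%nat with (S (S n + M)) by lia. rewrite (S_INR (S n + M)). lra.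
  - simpl rsum at 1.
    assert (HE' : successive_family n E).
    { split; [intros q Hq; apply (proj1 HE); lia|].
      intros q q' i i' Hq Hq'. apply (proj2 HE); lia. }
    specialize (IHn HE'). simpl rsum in IHn.
    replace (restr (E n) (fun l => rsum M (fun i => z i l) + z M l)) with (restr (E n) (z M)).
    2:{ apply functional_extensionality. intros l. unfold restr.
        destruct (E n l) eqn:HEl; [|reflexivity].
        rewrite rsum_zero; [lra|]. intros i Hi. apply NNPP. intros Hne. apply Hno. eauto. }
    pose proof (Hzr (E n)).
    replace (S n + S M)%nat with (S (n + S M)) by lia. rewrite (S_INR (n + S M)). lra.
Qed.

Lemma Tn_block_sum_le j M (z : nat -> nat -> R) (cut : nat -> nat) B :
  (forall i i', (i <= i')%nat -> (cut i <= cut i')%nat) ->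
  (forall i l, (l < cut i \/ cut (S i) <= l)%nat -> z i l = 0) ->
  (forall i, (i < M)%nat -> N (z i) <= B) -> 0 <= B ->
  Tn j (fun l => rsum M (fun i => z i l)) <= / INR (mseq j) * (B * INR (nseq j + M)).
Proof.
  intros Hcut Hz HB HB0.
  assert (Hfs : finsupp (fun l => rsum M (fun i => z i l))).
  { exists (cut M). intros l Hl. apply rsum_zero. intros i Hi. apply Hz.
    right. pose proof (Hcut (S i) M ltac:(lia)). lia. }
  apply (proj1 (N_spec _ Hfs)). intros r [E [HE ->]].
  apply Rmult_le_compat_l; [left; apply inv_mseq_pos|].
  now apply successive_blocks_bound with cut.
Qed.

Lemma N_scal c x : finsupp x -> N (fun i => c * x i) = Rabs c * N x.
Proof.
  assert (Hle : forall c x, finsupp x -> N (fun i => c * x i) <= Rabs c * N x).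
  { intros c' x' Hx'. apply N_of_leN.
    - destruct Hx' as [b Hb]. exists b. intros n Hn. rewrite Hb by assumption. ring.
    - apply leN_scal with x'; [now apply leN_of_N | reflexivity]. }
  intros Hx. apply Rle_antisym; [now apply Hle|].
  destruct (Req_dec c 0) as [->|Hc].
  - rewrite Rabs_R0, Rmult_0_l. apply N_nonneg. exists 0%nat. intros; ring.
  - pose proof (Hle (/ c) (fun i => c * x i)) as H. cbv beta in H.
    replace (fun i => / c * (c * x i)) with x in H
      by (apply functional_extensionality; intros; field; assumption).
    rewrite Rabs_inv in H. pose proof (Rabs_pos_lt c Hc).
    apply Rmult_le_reg_l with (/ Rabs c); [now apply Rinv_0_lt_compat|].
    rewrite <- Rmult_assoc, Rinv_l, Rmult_1_l by lra. apply H.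
    destruct Hx as [b Hb]. exists b. intros n Hn. rewrite Hb by assumption. ring.
Qed.

Lemma N_diff x y : finsupp x -> finsupp y -> Rabs (N x - N y) <= N (fun i => x i - y i).
Proof.
  intros Hx Hy.
  assert (Hf : finsupp (fun i => x i - y i)).
  { destruct Hx as [b Hb]. destruct Hy as [b' Hb']. exists (max b b').
    intros n Hn. rewrite Hb, Hb' by lia. ring. }
  assert (N x <= N y + N (fun i => x i - y i)).
  { apply N_of_leN; [assumption|].
    apply leN_plus with y (fun i => x i - y i); try now apply leN_of_N.
    intros; ring. }
  assert (N y <= N x + N (fun i => x i - y i)).
  { apply N_of_leN; [assumption|].
    apply leN_plus with x (fun i => - (x i - y i)); [now apply leN_of_N | | intros; ring].
    apply leN_opp with (fun i => x i - y i); [now apply leN_of_N | reflexivity]. }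
  apply Rabs_le. lra.
Qed.

Lemma finsupp_rsum n (a : nat -> R) (v : nat -> nat -> R) :
  (forall j, (j < n)%nat -> finsupp (v j)) -> finsupp (fun i => rsum n (fun j => a j * v j i)).
Proof.
  induction n as [|n IH]; intros H; simpl; [apply finsupp_zero|].
  destruct IH as [b Hb]; [intros; apply H; lia|].
  destruct (H n) as [b' Hb']; [lia|]. exists (max b b').
  intros i Hi. rewrite Hb, Hb' by lia. ring.
Qed.

(** In finite dimension the coordinates dominate the norm. This turns coordinatewise limits along an
    ultrafilter into norm limits on initial segments. *)
Lemma N_seg_le_coords c : exists C, 0 < C /\
  forall v e, 0 <= e -> (forall i, (i < c)%nat -> Rabs (v i) <= e) -> N (seg 0 c v) <= C * e.
Proof.
  set (u := fun j => seg j (S j) (fun _ => 1)).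
  exists (1 + rsum c (fun j => N (u j))). split.
  - enough (0 <= rsum c (fun j => N (u j))) by lra.
    apply rsum_nonneg. intros. apply N_nonneg, seg_finsupp.
  - intros v e He Hv.
    replace (seg 0 c v) with (fun l => rsum c (fun j => v j * u j l)).
    + eapply Rle_trans.
      * apply N_of_leN; [apply finsupp_rsum; intros; apply seg_finsupp|].
        apply leN_rsum with (A := fun j => N (u j)). intros. apply leN_of_N, seg_finsupp.
      * apply Rle_trans with (rsum c (fun j => e * N (u j))).
        -- apply rsum_le. intros j Hj. apply Rmult_le_compat_r; [apply N_nonneg, seg_finsupp|].
           now apply Hv.
        -- rewrite rsum_scal. lra.
    + apply functional_extensionality. intros l.
      destruct (seg_cases 0 c v l) as [[Hl ->]|[Hl ->]].
      * rewrite (rsum_single c _ l) by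
          (try lia; intros j Hj Hne; unfold u; rewrite seg_out by lia; ring).
        unfold u. rewrite seg_in by lia. ring.
      * apply rsum_zero. intros j Hj. unfold u. rewrite seg_out by lia. ring.
Qed.

Lemma ulim_coords_N {A} (W : (A -> Prop) -> Prop) (v : A -> nat -> R) l c e :
  ultra W -> (forall i, is_ulim W (fun a => v a i) (l i)) -> 0 < e ->
  W (fun a => N (seg 0 c (fun i => v a i - l i)) <= e).
Proof.
  intros HW H He. destruct (N_seg_le_coords c) as [C [HC Hc]].
  assert (He' : 0 < e / C) by now apply Rdiv_lt_0_compat.
  apply (ultra_mono W _ _ HW) with (2 := ultra_forall_lt W c _ HW (fun i _ => H i _ He')).
  intros a Ha. replace e with (C * (e / C)) by (field; lra).
  apply Hc; [lra|]. intros i Hi. left. now apply Ha.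
Qed.

Lemma leN_beyond v c0 e : 0 <= e ->
  (forall a b, (c0 <= a)%nat -> N (seg a b v) <= e) ->
  leN (fun i => if i <? c0 then 0 else v i) e.
Proof.
  intros He H c. eapply Rle_trans; [|apply (H c0 c); lia].
  right. f_equal. apply functional_extensionality. intros i.
  destruct (seg_cases 0 c (fun i => if i <? c0 then 0 else v i) i) as [[Hi ->]|[Hi ->]].
  - destruct (Nat.ltb_spec i c0); symmetry; [apply seg_out | apply seg_in]; lia.
  - symmetry. apply seg_out. lia.
Qed.

Lemma le_of_le_eps x y K : 0 <= K -> (forall e, 0 < e -> x <= y + e * K) -> x <= y.
Proof.
  intros HK H. apply Rnot_lt_le. intros Hlt.
  specialize (H ((x - y) / 2 / (K + 1)) ltac:(apply Rdiv_lt_0_compat; lra)).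
  assert ((x - y) / 2 / (K + 1) * K <= (x - y) / 2).
  { apply Rle_trans with ((x - y) / 2 / (K + 1) * (K + 1)).
    - apply Rmult_le_compat_l; [|lra]. left. apply Rdiv_lt_0_compat; lra.
    - right. field. lra. }
  lra.
Qed.

(** * Level decomposition of a k-sequence *)

Section Levels.
Variable U : (nat -> Prop) -> Prop.
Hypothesis HU : ultra U.
Variables (k : nat) (x : list nat -> nat -> R) (B : R).
Hypothesis HxB : forall t, leN (x t) B.
Hypothesis Hxf : forall t, finsupp (x t).

(* Y d t is the iterated limit of x over the d last elements of its k-set, t being the
   remaining initial segment. *)
Fixpoint Y (d : nat) (t : list nat) : nat -> R :=
  match d with
  | O => x t
  | S d' => fun i => ulim U (fun n => Y d' (t ++ n :: nil) i)
  end.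

(** [leN] tests initial segments, on which a coordinatewise limit is a limit in norm; the bound
    therefore survives each of the iterated limits. *)
Lemma Y_bound d t : leN (Y d t) B.
Proof.
  revert t. induction d as [|d IH]; intros t; [apply HxB|].
  assert (Hlim : forall i, is_ulim U (fun n => Y d (t ++ n :: nil) i) (Y (S d) t i)).
  { intros i. simpl. apply ulim_spec with B; auto. intros n. apply leN_coord, IH. }
  intros c. apply le_of_le_eps with 1; [lra|]. intros e He. rewrite Rmult_1_r.
  destruct (ultra_ex U _ HU (ulim_coords_N U _ _ c e HU Hlim He)) as [n Hn].
  pose proof (IH (t ++ n :: nil) c) as Hc.
  apply N_of_leN; [apply seg_finsupp|].
  apply leN_plus with (seg 0 c (Y d (t ++ n :: nil)))
    (fun i => - seg 0 c (fun i => Y d (t ++ n :: nil) i - Y (S d) t i) i).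
  - eapply leN_weaken; [apply leN_of_N, seg_finsupp | exact Hc].
  - eapply leN_opp; [|reflexivity].
    eapply leN_weaken; [apply leN_of_N, seg_finsupp | exact Hn].
  - intros i. destruct (le_lt_dec c i).
    + rewrite !seg_out by lia. ring.
    + rewrite !seg_in by lia. ring.
Qed.

Lemma Y_lim d t i : is_ulim U (fun n => Y d (t ++ n :: nil) i) (Y (S d) t i).
Proof. simpl. apply ulim_spec with B; auto. intros n. apply leN_coord, Y_bound. Qed.

Definition prefix (s : cfg) (j r : nat) : list nat := map (s j) (seq 0 r).

Lemma prefix_S s j r : prefix s j (S r) = prefix s j r ++ s j r :: nil.
Proof. unfold prefix. now rewrite seq_S, map_app. Qed.

Lemma prefix_agree s s' j r :
  (forall r', (r' < r)%nat -> s j r' = s' j r') -> prefix s j r = prefix s' j r.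
Proof. intros H. apply map_ext_in. intros r' Hr. apply in_seq in Hr. apply H. lia. Qed.

(** The limit attached to the [j]-th set once its first [r] elements are known. At [r = 0] it is
    [Y k nil], common to all sets; at [r = k] it is the vector of the set itself. *)
Definition yv (s : cfg) (j r : nat) : nat -> R := Y (k - r) (prefix s j r).

Definition dv (s : cfg) (j r : nat) : nat -> R := fun i => yv s j (S r) i - yv s j r i.

Lemma yv_bound s j r : leN (yv s j r) B.
Proof. apply Y_bound. Qed.

Lemma dv_bound s j r : leN (dv s j r) (B + B).
Proof.
  apply leN_plus with (yv s j (S r)) (fun i => - yv s j r i); try apply yv_bound.
  - apply leN_opp with (yv s j r); [apply yv_bound | reflexivity].
  - reflexivity.
Qed.

Lemma yv_agree s s' j r :
  (forall r', (r' < r)%nat -> s j r' = s' j r') -> yv s j r = yv s' j r.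
Proof. intros H. unfold yv. now rewrite (prefix_agree s s' j r H). Qed.

(** An arbitrary start: every entry with [j < L] and [r < k] is overwritten along
    [positions k L]. *)
Definition s0 : cfg := fun _ _ => 0%nat.

Definition often (L : nat) (P : cfg -> Prop) : Prop := prodU U (positions k L) s0 P.

Lemma often_ultra L : ultra (often L).
Proof. apply prodU_ultra, HU. Qed.

(* Up to e, the level-r piece of the j-th vector lives on the interval number r L + j. *)
Definition cuts_ok (L : nat) (e : R) (s : cfg) (c : nat -> nat) : Prop :=
  (forall p, (c p < c (S p))%nat) /\
  forall r j, (r < k)%nat -> (j < L)%nat ->
    leN (fun i => dv s j r i - seg (c (r * L + j)%nat) (c (S (r * L + j))) (dv s j r) i) e.

(** A sliding hump along the order of choice. When entry [r] of set [j] is chosen, [dv s j r] tends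
    to 0 coordinatewise along [U], so its part below the last cut is small for almost every choice;
    the next cut is placed where the tail of the new limit [yv s j (S r)] has become small. *)
Lemma cuts_often L e : 0 < e -> often L (fun s => exists c, cuts_ok L e s c).
Proof.
  intros He. set (e' := e / 3). assert (He' : 0 < e') by (unfold e'; lra).
  (* Invariant after [p] choices: the heads of the chosen pieces and the tails of the chosen limits
     are small. The first cut takes care of [Y k nil], which precedes all choices. *)
  set (Q := fun p s => exists c : nat -> nat, (forall q, (c q < c (S q))%nat) /\
    (forall a b, (c 0%nat <= a)%nat -> N (seg a b (Y k nil)) <= e') /\
    forall r j, (r < k)%nat -> (j < L)%nat -> (r * L + j < p)%nat ->
      N (seg 0 (c (r * L + j)%nat) (dv s j r)) <= e' /\
      forall a b, (c (S (r * L + j)) <= a)%nat -> N (seg a b (yv s j (S r))) <= e').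
  assert (HQ : often L (Q (length (positions k L)))).
  { apply prodU_invariant; auto.
    - intros p s Hp [c [Hc [Hc0 Hcp]]]. rewrite positions_length in Hp.
      destruct (position_index k L p Hp) as [r [j [Hr [Hj Ep]]]].
      rewrite Ep, positions_nth by assumption. rewrite <- Ep.
      assert (Hlim : U (fun n => N (seg 0 (c p)
         (fun i => Y (k - S r) (prefix s j r ++ n :: nil) i - Y (S (k - S r)) (prefix s j r) i)) <= e')).
      { apply ulim_coords_N; auto. intros i. apply Y_lim. }
      apply (ultra_mono U _ _ HU) with (2 := Hlim). intros n Hn.
      assert (Eyr : yv (upd s (j, r) n) j r = Y (S (k - S r)) (prefix s j r)).
      { rewrite (yv_agree _ s) by (intros; apply upd_other; lia). unfold yv. f_equal. lia. }
      assert (EyS : yv (upd s (j, r) n) j (S r) = Y (k - S r) (prefix s j r ++ n :: nil)).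
      { unfold yv. rewrite prefix_S, upd_same.
        now rewrite (prefix_agree _ s) by (intros; apply upd_other; lia). }
      destruct (leN_tail (yv (upd s (j, r) n) j (S r)) B e' (yv_bound _ _ _) He') as [c1 Hc1].
      (* Cuts up to [p] are kept, cut [p + 1] is the new one, and later ones are provisional values
         that keep [c] increasing. *)
      exists (fun q => if q <=? p then c q else (max (c p) c1 + (q - p))%nat).
      repeat split.
      + intros q. destruct (Nat.leb_spec q p); destruct (Nat.leb_spec (S q) p); try lia.
        * apply Hc.
        * assert (q = p) by lia. subst q. lia.
      + simpl. exact Hc0.
      + destruct (Nat.eq_dec (r0 * L + j0) p) as [E|E].
        * destruct (position_inj L r j r0 j0) as [-> ->]; try assumption; try congruence.
          rewrite E, Nat.leb_refl. unfold dv. rewrite Eyr, EyS. exact Hn.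
        * destruct (Nat.leb_spec (r0 * L + j0) p); [|lia].
          assert (j0 <> j \/ (r0 < r)%nat) by (destruct (position_lt L r j r0 j0); lia).
          replace (dv (upd s (j, r) n) j0 r0) with (dv s j0 r0);
            [apply Hcp; auto; lia|].
          unfold dv. rewrite (yv_agree (upd s (j, r) n) s j0 (S r0)),
            (yv_agree (upd s (j, r) n) s j0 r0); auto; intros; apply upd_other; lia.
      + intros a b. destruct (Nat.eq_dec (r0 * L + j0) p) as [E|E].
        * destruct (position_inj L r j r0 j0) as [-> ->]; try assumption; try congruence.
          rewrite E. destruct (Nat.leb_spec (S p) p); [lia|]. intros Ha. apply Hc1. lia.
        * destruct (Nat.leb_spec (S (r0 * L + j0)) p); [|lia].
          assert (j0 <> j \/ (r0 < r)%nat) by (destruct (position_lt L r j r0 j0); lia).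
          rewrite (yv_agree (upd s (j, r) n) s j0 (S r0)) by (intros; apply upd_other; lia).
          apply Hcp; auto; lia.
    - destruct (leN_tail (Y k nil) B e' (Y_bound _ _) He') as [c1 Hc1].
      exists (fun q => (c1 + q)%nat). repeat split; intros; try lia. apply Hc1. lia. }
  rewrite positions_length in HQ.
  apply (ultra_mono _ _ _ (often_ultra L)) with (2 := HQ).
  intros s [c [Hc [Hc0 Hcp]]]. exists c. split; [exact Hc|].
  assert (Hmon : forall q q', (q <= q')%nat -> (c q <= c q')%nat).
  { intros q q' Hq. induction Hq as [|q' Hq IH]; [lia|]. specialize (Hc q'). lia. }
  intros r j Hr Hj. set (p := (r * L + j)%nat).
  assert (Hp : (p < k * L)%nat) by (unfold p; nia).
  destruct (Hcp r j Hr Hj Hp) as [H1 H2]. fold p in H1, H2.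
  (* [yv s j r] was fixed one level earlier, hence at an earlier position, or is [Y k nil]; its tail
     has already been cut off. *)
  assert (H3 : forall a b, (c (S p) <= a)%nat -> N (seg a b (yv s j r)) <= e').
  { intros a b Ha. destruct r as [|r].
    - unfold yv. simpl. rewrite Nat.sub_0_r. apply Hc0. pose proof (Hmon 0%nat (S p)). lia.
    - apply (Hcp r j); [lia | assumption | nia |].
      pose proof (Hmon (S (r * L + j)) (S p)). unfold p in *. nia. }
  (* Three errors: the head of the piece and, beyond its interval, the tails of the two limits whose
     difference it is. *)
  replace e with ((e' + e') + e') by (unfold e'; lra).
  apply leN_plus with
    (fun i => seg 0 (c p) (dv s j r) i + (if i <? c (S p) then 0 else yv s j (S r) i))
    (fun i => - (if i <? c (S p) then 0 else yv s j r i)).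
  - apply leN_plus with (seg 0 (c p) (dv s j r))
      (fun i => if i <? c (S p) then 0 else yv s j (S r) i); [| |reflexivity].
    + eapply leN_weaken; [apply leN_of_N, seg_finsupp | exact H1].
    + apply leN_beyond; [lra | exact H2].
  - eapply leN_opp; [|reflexivity]. apply leN_beyond; [lra | exact H3].
  - intros i. specialize (Hc p). destruct (Nat.ltb_spec i (c (S p))).
    + destruct (le_lt_dec (c p) i).
      * rewrite seg_in, seg_out by lia. ring.
      * rewrite seg_out, seg_in by lia. ring.
    + rewrite !seg_out by lia. unfold dv. ring.
Qed.

(** * Linear combinations of a plegma family, level by level *)

Definition lev (L r : nat) (a : nat -> R) (s : cfg) : nat -> R :=
  fun i => rsum L (fun j => a j * dv s j r i).

Definition real (L : nat) (a : nat -> R) (s : cfg) : nat -> R :=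
  fun i => rsum L (fun j => a j * x (prefix s j k) i).

Definition l1 (L : nat) (a : nat -> R) : R := rsum L (fun j => Rabs (a j)).

Lemma l1_nonneg L a : 0 <= l1 L a.
Proof. apply rsum_nonneg. intros; apply Rabs_pos. Qed.

Lemma real_finsupp L a s : finsupp (real L a s).
Proof. apply finsupp_rsum. intros; apply Hxf. Qed.

Lemma lev_bound L r a s : leN (lev L r a s) (l1 L a * (B + B)).
Proof.
  unfold l1. rewrite <- rsum_scal_r.
  apply leN_rsum with (A := fun _ => B + B). intros; apply dv_bound.
Qed.

Lemma real_eq_sum_lev L a s : rsum L a = 0 ->
  forall i, real L a s i = rsum k (fun r => lev L r a s i).
Proof.
  intros Ha i. unfold real, lev. rewrite rsum_exchange.
  rewrite (rsum_ext L (fun j => rsum k _)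
    (fun j => a j * x (prefix s j k) i - a j * Y k nil i)).
  - rewrite rsum_minus, rsum_scal_r, Ha. ring.
  - intros j _. unfold dv. rewrite rsum_scal, (rsum_telescope k (fun r => yv s j r i)).
    unfold yv. rewrite Nat.sub_diag, Nat.sub_0_r.
    change (prefix s j 0) with (@nil nat). change (Y 0 (prefix s j k)) with (x (prefix s j k)).
    ring.
Qed.

Lemma lev_ext L L' r a s : (L <= L')%nat -> (forall j, (L <= j)%nat -> a j = 0) ->
  lev L' r a s = lev L r a s.
Proof.
  intros HL Ha. apply functional_extensionality. intros i.
  apply rsum_extend; [assumption|]. intros j Hj. rewrite Ha by assumption. ring.
Qed.

Lemma lev_agree L r a s s' :
  (forall j r', a j <> 0 -> s j r' = s' j r') -> lev L r a s = lev L r a s'.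
Proof.
  intros H. apply functional_extensionality. intros i. apply rsum_ext. intros j _.
  destruct (Req_dec (a j) 0) as [->|Hne]; [ring|].
  unfold dv. now rewrite (yv_agree s s' j (S r)), (yv_agree s s' j r) by auto.
Qed.

(** [lev] with every piece cut down to its own interval: true blocks, at the price of an error
    [l1 L a * e]. *)
Definition blk (L : nat) (c : nat -> nat) (r : nat) (a : nat -> R) (s : cfg) : nat -> R :=
  fun i => rsum L (fun j => a j * seg (c (r * L + j)%nat) (c (S (r * L + j))) (dv s j r) i).

Lemma blk_finsupp L c r a s : finsupp (blk L c r a s).
Proof. apply finsupp_rsum. intros; apply seg_finsupp. Qed.

Lemma lev_blk L c e r a s : cuts_ok L e s c -> (r < k)%nat ->
  leN (fun i => lev L r a s i - blk L c r a s i) (l1 L a * e).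
Proof.
  intros [_ H] Hr. unfold l1. rewrite <- rsum_scal_r.
  replace (fun i => lev L r a s i - blk L c r a s i) with
    (fun i => rsum L (fun j => a j *
       (dv s j r i - seg (c (r * L + j)%nat) (c (S (r * L + j))) (dv s j r) i))).
  - apply leN_rsum with (A := fun _ => e)
      (y := fun j i => dv s j r i - seg (c (r * L + j)%nat) (c (S (r * L + j))) (dv s j r) i).
    intros j Hj. now apply H.
  - apply functional_extensionality. intros i. unfold lev, blk. rewrite <- rsum_minus.
    apply rsum_ext. intros; ring.
Qed.

Lemma cuts_mono L e s c : cuts_ok L e s c -> forall q q', (q <= q')%nat -> (c q <= c q')%nat.
Proof.
  intros [Hc _] q q' Hq. induction Hq as [|q' Hq IH]; [lia|]. specialize (Hc q'). lia.
Qed.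

Lemma blk_supp L c e r a s f f' i : cuts_ok L e s c ->
  (forall j, a j <> 0 -> (f <= j < f')%nat) ->
  (i < c (r * L + f) \/ c (r * L + f') <= i)%nat -> blk L c r a s i = 0.
Proof.
  intros Hc Ha Hi. pose proof (cuts_mono _ _ _ _ Hc) as Hmon.
  apply rsum_zero. intros j _. destruct (Req_dec (a j) 0) as [->|Hne]; [ring|].
  apply Ha in Hne. rewrite seg_out; [ring|].
  pose proof (Hmon (r * L + f) (r * L + j) ltac:(lia))%nat.
  pose proof (Hmon (S (r * L + j)) (r * L + f') ltac:(lia))%nat. lia.
Qed.

(** Positions are ordered level by level, so the pieces of level [r] with index in [[f, f')] occupy
    consecutive intervals, and no piece of another level intrudes. Restriction to one interval thus
    isolates a block of coefficients within one level. *)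
Lemma seg_sum_blk L c e s a a' r f f' : cuts_ok L e s c -> (r < k)%nat -> (f' <= L)%nat ->
  (forall j, a' j <> 0 -> (f <= j < f')%nat) ->
  (forall j, (f <= j < f')%nat -> a' j = a j) ->
  seg (c (r * L + f)%nat) (c (r * L + f')%nat) (fun i => rsum k (fun r' => blk L c r' a s i))
  = blk L c r a' s.
Proof.
  intros Hc Hr Hf' Ha' Haa. pose proof (cuts_mono _ _ _ _ Hc) as Hmon.
  apply functional_extensionality. intros i.
  match goal with |- seg ?a ?b ?v i = _ => destruct (seg_cases a b v i) as [[Hi ->]|[Hi ->]] end.
  - rewrite (rsum_single k _ r Hr).
    + apply rsum_ext. intros j Hj.
      destruct (le_lt_dec f j); [destruct (le_lt_dec f' j)|].
      * rewrite seg_out; [ring|].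
        pose proof (Hmon (r * L + f') (r * L + j) ltac:(lia))%nat. lia.
      * now rewrite Haa by lia.
      * rewrite seg_out; [ring|].
        pose proof (Hmon (S (r * L + j)) (r * L + f) ltac:(lia))%nat. lia.
    + intros r' Hr' Hne. apply rsum_zero. intros j Hj. rewrite seg_out; [ring|].
      destruct (Nat.lt_ge_cases r' r).
      * pose proof (Hmon (S (r' * L + j)) (r * L + f) ltac:(nia))%nat. lia.
      * pose proof (Hmon (r * L + f') (r' * L + j) ltac:(nia))%nat. lia.
  - symmetry. eapply blk_supp; eauto.
Qed.

Lemma real_sum_blk L c e a s : cuts_ok L e s c -> rsum L a = 0 ->
  leN (fun i => real L a s i - rsum k (fun r => blk L c r a s i)) (INR k * (l1 L a * e)).
Proof.
  intros Hc Ha.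
  replace (fun i => real L a s i - rsum k (fun r => blk L c r a s i)) with
    (fun i => rsum k (fun r => lev L r a s i - blk L c r a s i)).
  - rewrite <- rsum_const.
    apply leN_rsum1 with (y := fun r i => lev L r a s i - blk L c r a s i).
    intros r Hr. now apply lev_blk.
  - apply functional_extensionality. intros i. rewrite real_eq_sum_lev by assumption.
    rewrite <- rsum_minus. reflexivity.
Qed.

Lemma sum_blk_finsupp L c a s : finsupp (fun i => rsum k (fun r => blk L c r a s i)).
Proof.
  replace (fun i => rsum k (fun r => blk L c r a s i)) with
    (fun i => rsum k (fun r => 1 * blk L c r a s i)).
  - apply finsupp_rsum. intros; apply blk_finsupp.
  - apply functional_extensionality. intros i. apply rsum_ext. intros; ring.
Qed.

Lemma N_sum_blk_le L c e a s : cuts_ok L e s c -> rsum L a = 0 ->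
  N (fun i => rsum k (fun r => blk L c r a s i)) <= N (real L a s) + INR k * (l1 L a * e).
Proof.
  intros Hc Ha. apply N_of_leN; [apply sum_blk_finsupp|].
  apply leN_plus with (real L a s)
    (fun i => - (real L a s i - rsum k (fun r => blk L c r a s i))); [| |intros; ring].
  - apply leN_of_N, real_finsupp.
  - eapply leN_opp; [exact (real_sum_blk L c e a s Hc Ha) | reflexivity].
Qed.

Lemma N_real_le L c e a s : cuts_ok L e s c -> rsum L a = 0 ->
  N (real L a s) <= rsum k (fun r => N (blk L c r a s)) + INR k * (l1 L a * e).
Proof.
  intros Hc Ha. apply N_of_leN; [apply real_finsupp|].
  apply leN_plus with (fun i => rsum k (fun r => blk L c r a s i))
    (fun i => real L a s i - rsum k (fun r => blk L c r a s i)); [| |intros; ring].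
  - apply leN_rsum1. intros. apply leN_of_N, blk_finsupp.
  - now apply real_sum_blk.
Qed.

(** * Transfer between the spreading model and the levels *)

Variable nu : (nat -> R) -> R.
Hypothesis Hreal : forall L a e, (1 <= L)%nat -> (forall j, (L <= j)%nat -> a j = 0) -> 0 < e ->
  often L (fun s => Rabs (N (real L a s) - nu a) <= e).

(** Up to truncation errors, [nu (a q)] is at most the sum of the norms of [k] level parts. Within
    one level, the parts of the various [a q] are restrictions of a single vector to [nseq J]
    successive intervals, so their norms sum to at most [m_J] times its norm. Adding up the levels
    gives the factor [k]. *)
Lemma nu_blocks_lower J (a : nat -> nat -> R) (f : nat -> nat) :
  (forall q, (q < nseq J)%nat -> (f q < f (S q))%nat) ->
  (forall q j, (q < nseq J)%nat -> a q j <> 0 -> (f q <= j < f (S q))%nat) ->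
  (forall q, (q < nseq J)%nat -> rsum (f (nseq J)) (a q) = 0) ->
  rsum (nseq J) (fun q => nu (a q))
    <= INR k * (INR (mseq J) * nu (fun j => rsum (nseq J) (fun q => a q j))).
Proof.
  intros Hf Ha Hz. set (n := nseq J) in *. set (L := f n) in *.
  set (At := fun j => rsum n (fun q => a q j)).
  assert (Hfm : forall q q', (q <= q')%nat -> (q' <= n)%nat -> (f q <= f q')%nat).
  { intros q q' Hq. induction Hq as [|q' Hq IH]; intros Hq'; [lia|].
    specialize (Hf q' ltac:(lia)). specialize (IH ltac:(lia)). lia. }
  assert (HL : (1 <= L)%nat).
  { pose proof (Hn_pos J). fold n in H. specialize (Hf 0%nat H).
    pose proof (Hfm 1%nat n ltac:(lia) ltac:(lia)). unfold L. lia. }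
  assert (HaL : forall q j, (q < n)%nat -> (L <= j)%nat -> a q j = 0).
  { intros q j Hq Hj. apply NNPP. intros Hne. apply Ha in Hne; [|assumption].
    pose proof (Hfm (S q) n ltac:(lia) ltac:(lia)). unfold L in *. lia. }
  assert (HAt : forall q j, (q < n)%nat -> (f q <= j < f (S q))%nat -> a q j = At j).
  { intros q j Hq Hj. unfold At. symmetry. apply (rsum_single n (fun q => a q j) q Hq).
    intros q' Hq' Hne. apply NNPP. intros Hne'. apply Ha in Hne'; [|assumption].
    destruct (Nat.lt_ge_cases q' q).
    - pose proof (Hfm (S q') q ltac:(lia) ltac:(lia)). lia.
    - pose proof (Hfm (S q) q' ltac:(lia) ltac:(lia)). lia. }
  assert (HAtL : forall j, (L <= j)%nat -> At j = 0).
  { intros j Hj. apply rsum_zero. intros q Hq. now apply HaL. }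
  assert (HAtz : rsum L At = 0).
  { unfold At. rewrite rsum_exchange. now apply rsum_zero. }
  (* The constant collects all errors; it depends on [L] and on the coefficients, but not on [e]. *)
  apply le_of_le_eps with (INR k * (INR (mseq J) * (1 + INR k * l1 L At)) +
    rsum n (fun q => INR k * l1 L (a q) + 1)).
  { pose proof (pos_INR k). pose proof (pos_INR (mseq J)). pose proof (l1_nonneg L At).
    apply Rplus_le_le_0_compat.
    - repeat apply Rmult_le_pos; auto. assert (0 <= INR k * l1 L At) by now apply Rmult_le_pos. lra.
    - apply rsum_nonneg. intros q _. pose proof (l1_nonneg L (a q)).
      assert (0 <= INR k * l1 L (a q)) by now apply Rmult_le_pos. lra. }
  intros e He. pose proof (often_ultra L) as HW.
  destruct (ultra_ex _ _ HW (ultra_and _ _ _ HW (cuts_often L e He)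
    (ultra_and _ _ _ HW (Hreal L At e HL HAtL He)
      (ultra_forall_lt _ n _ HW (fun q Hq => Hreal L (a q) e HL (fun j => HaL q j Hq) He)))))
    as [s [[c Hc] [HA Hq]]].
  apply Rabs_le_bounds in HA.
  assert (H1 : forall q, (q < n)%nat ->
    nu (a q) <= rsum k (fun r => N (blk L c r (a q) s)) + e * (INR k * l1 L (a q) + 1)).
  { intros q Hq'. pose proof (N_real_le L c e (a q) s Hc (Hz q Hq')).
    specialize (Hq q Hq'). apply Rabs_le_bounds in Hq. lra. }
  assert (H2 : forall r, (r < k)%nat ->
    rsum n (fun q => N (blk L c r (a q) s)) <= INR (mseq J) * (nu At + e * (1 + INR k * l1 L At))).
  { intros r Hr. pose proof (N_sum_blk_le L c e At s Hc HAtz) as HZ.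
    set (Zt := fun i => rsum k (fun r => blk L c r At s i)) in *.
    apply Rle_trans with (INR (mseq J) * N Zt).
    - rewrite (rsum_ext n _ (fun q => N (seg (c (r * L + f q)%nat) (c (r * L + f (S q))%nat) Zt))).
      + apply (rsum_N_seg_le Zt J (fun q => c (r * L + f q)%nat)); [apply sum_blk_finsupp|].
        intros q Hq'. specialize (Hf q Hq').
        pose proof (cuts_mono _ _ _ _ Hc (S (r * L + f q)) (r * L + f (S q)) ltac:(lia)).
        pose proof (proj1 Hc (r * L + f q)%nat). lia.
      + intros q Hq'. f_equal. symmetry. apply (seg_sum_blk L c e s At (a q) r); auto.
        pose proof (Hfm (S q) n ltac:(lia) ltac:(lia)). unfold L. lia.
    - apply Rmult_le_compat_l; [apply pos_INR|]. lra. }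
  apply Rle_trans with (rsum n (fun q => rsum k (fun r => N (blk L c r (a q) s))
    + e * (INR k * l1 L (a q) + 1))); [now apply rsum_le|].
  rewrite rsum_plus, rsum_exchange, rsum_scal.
  assert (rsum k (fun r => rsum n (fun q => N (blk L c r (a q) s))) <=
    INR k * (INR (mseq J) * (nu At + e * (1 + INR k * l1 L At)))).
  { rewrite <- rsum_const. now apply rsum_le. }
  lra.
Qed.

(** The same bound is demanded for every large [L], because the length of the family is fixed only
    after further vectors have been added to the combination. *)
Definition lev_le (r : nat) (a : nat -> R) (R0 : R) : Prop :=
  exists L0, (forall j, (L0 <= j)%nat -> a j = 0) /\
    forall L, (L0 <= L)%nat -> (1 <= L)%nat -> often L (fun s => leN (lev L r a s) R0).

(** Up to errors, a level is the restriction of the realized vector to an interval, and restriction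
    does not increase the norm. *)
Lemma lev_le_nu r a L0 eps : (r < k)%nat -> (forall j, (L0 <= j)%nat -> a j = 0) ->
  rsum L0 a = 0 -> 0 < eps -> lev_le r a (nu a + eps).
Proof.
  intros Hr Ha Hz Heps. exists L0. split; [assumption|]. intros L HL HL1.
  assert (HzL : rsum L a = 0) by (rewrite (rsum_extend L0 L); assumption).
  assert (HaL : forall j, (L <= j)%nat -> a j = 0) by (intros; apply Ha; lia).
  (* Shares of the error: 1 for the realization, [INR k * l1 L a] for cutting all levels, [l1 L a]
     for restoring the uncut level [r]. *)
  set (K := 1 + INR k * l1 L a + l1 L a).
  pose proof (pos_INR k). pose proof (l1_nonneg L a).
  assert (HK : 0 < K) by (assert (0 <= INR k * l1 L a) by (now apply Rmult_le_pos); unfold K; lra).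
  set (e := eps / K). assert (He : 0 < e) by now apply Rdiv_lt_0_compat.
  pose proof (often_ultra L) as HW.
  apply (ultra_mono _ _ _ HW) with (2 := ultra_and _ _ _ HW (cuts_often L e He)
    (Hreal L a e HL1 HaL He)).
  intros s [[c Hc] Hs]. apply Rabs_le_bounds in Hs.
  pose proof (N_sum_blk_le L c e a s Hc HzL) as HZ.
  assert (Hb : leN (blk L c r a s) (N (real L a s) + INR k * (l1 L a * e))).
  { rewrite <- (seg_sum_blk L c e s a a r 0 L Hc Hr (le_n L)).
    - apply leN_seg. eapply leN_weaken; [apply leN_of_N, sum_blk_finsupp | exact HZ].
    - intros j Hj. split; [lia|]. apply Nat.nle_gt. intros Hle. now apply Hj, HaL.
    - reflexivity. }
  apply leN_weaken with ((N (real L a s) + INR k * (l1 L a * e)) + l1 L a * e).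
  - apply leN_plus with (blk L c r a s) (fun i => lev L r a s i - blk L c r a s i);
      [exact Hb | now apply lev_blk | intros; ring].
  - assert (e * K = eps) by (unfold e; field; lra). unfold K in *. lra.
Qed.

Lemma nu_le_of_lev_le a L0 R0 : (forall j, (L0 <= j)%nat -> a j = 0) -> rsum L0 a = 0 ->
  (forall r, (r < k)%nat -> lev_le r a R0) -> nu a <= INR k * R0.
Proof.
  intros Ha Hz H.
  assert (exists L, (1 <= L)%nat /\ (L0 <= L)%nat /\
    forall r, (r < k)%nat -> often L (fun s => leN (lev L r a s) R0)) as [L [HL1 [HL0 HL]]].
  { assert (Hex : forall n, (n <= k)%nat -> exists L1, forall L r, (L1 <= L)%nat -> (1 <= L)%nat ->
      (r < n)%nat -> often L (fun s => leN (lev L r a s) R0)).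
    { induction n as [|n IH]; intros Hn; [exists 0%nat; intros; lia|].
      destruct IH as [L1 HL1]; [lia|]. destruct (H n) as [L2 [_ HL2]]; [lia|].
      exists (max L1 L2). intros L r HL HL' Hr. destruct (Nat.eq_dec r n) as [->|].
      - apply HL2; lia.
      - apply HL1; lia. }
    destruct (Hex k (le_n k)) as [L1 HL1]. exists (S (max L0 L1)).
    repeat split; try lia. intros r Hr. apply HL1; lia. }
  apply le_of_le_eps with 1; [lra|]. intros e He.
  assert (HzL : rsum L a = 0) by (rewrite (rsum_extend L0 L); assumption).
  assert (HaL : forall j, (L <= j)%nat -> a j = 0) by (intros; apply Ha; lia).
  pose proof (often_ultra L) as HW.
  destruct (ultra_ex _ _ HW (ultra_and _ _ _ HW (ultra_forall_lt _ k _ HW HL)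
    (Hreal L a e HL1 HaL He))) as [s [Hs1 Hs2]].
  apply Rabs_le_bounds in Hs2.
  assert (N (real L a s) <= INR k * R0).
  { apply N_of_leN; [apply real_finsupp|]. rewrite <- rsum_const.
    replace (real L a s) with (fun i => rsum k (fun r => lev L r a s i)).
    - now apply leN_rsum1.
    - apply functional_extensionality. intros i. now rewrite real_eq_sum_lev. }
  lra.
Qed.

(** * Averages of far blocks and the shrinking of levels *)

Hypothesis Hn_inc : forall j, (nseq j < nseq (S j))%nat.

Lemma nseq_mono i j : (i <= j)%nat -> (nseq i <= nseq j)%nat.
Proof. induction 1 as [|j Hj IH]; [lia|]. specialize (Hn_inc j). lia. Qed.

Definition avg (M : nat) (w : nat -> nat -> R) : nat -> R :=
  fun j => / INR M * rsum M (fun i => w i j).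

Lemma lev_avg L r M w s i :
  lev L r (avg M w) s i = / INR M * rsum M (fun q => lev L r (w q) s i).
Proof.
  unfold lev, avg. rewrite rsum_exchange, <- rsum_scal. apply rsum_ext. intros j _.
  rewrite rsum_scal_r. ring.
Qed.

Lemma lev_avg_le L r M w s R0 : (1 <= M)%nat ->
  (forall i, (i < M)%nat -> leN (lev L r (w i) s) R0) -> leN (lev L r (avg M w) s) R0.
Proof.
  intros HM H. assert (HM0 : 0 < INR M) by (apply lt_0_INR; lia).
  apply leN_weaken with (Rabs (/ INR M) * rsum M (fun _ => R0)).
  - eapply leN_scal; [|intros; apply lev_avg].
    now apply leN_rsum1 with (A := fun _ => R0) (y := fun q => lev L r (w q) s).
  - rewrite rsum_const, Rabs_pos_eq by (left; now apply Rinv_0_lt_compat).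
    right. field. lra.
Qed.

Definition half_sum (u v : nat -> R) : nat -> R := fun j => (u j + v j) / 2.

Lemma lev_half_sum L r u v s i :
  lev L r (half_sum u v) s i = / 2 * lev L r u s i + / 2 * lev L r v s i.
Proof.
  unfold lev, half_sum. rewrite <- !rsum_scal, <- rsum_plus. apply rsum_ext.
  intros; field.
Qed.

Definition beyond (J : nat) (f : nat -> R) : nat -> R := fun i => if i <? J then 0 else f i.

(** * The shrinking step at one configuration *)

Section Shrink_at.
Variables (L r M J : nat) (s : cfg) (c : nat -> nat) (e R0 : R).
Variables (y1 : nat -> R) (w : nat -> nat -> R) (g : nat -> nat).
Hypothesis Hr : (r < k)%nat.
Hypothesis Hc : cuts_ok L e s c.
Hypothesis He : 0 < e.
Hypothesis HR : 0 < R0.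
Hypothesis Hy1 : forall j, y1 j <> 0 -> (0 <= j < g 0)%nat.
Hypothesis Hw : forall i j, w i j <> 0 -> (g i <= j < g (S i))%nat.
Hypothesis Hg : forall i, (g i < g (S i))%nat.
Hypothesis HM : (1 <= M)%nat.
Hypothesis HMJ : (J <= M)%nat.
Hypothesis HMn : forall i, (i < J)%nat -> (100 * nseq i <= M)%nat.
Hypothesis Hsmall : (l1 L y1 + rsum M (fun i => l1 L (w i))) * e <= R0 / 1000.
Hypothesis Hlev1 : leN (lev L r y1 s) R0.
Hypothesis Hlevw : forall i, (i < M)%nat -> leN (lev L r (w i) s) R0.
Hypothesis Hinner : forall m,
  rsum m (fun i => beyond J (fun i => Tn i (lev L r y1 s)) i
                 * beyond J (fun i => Tn i (lev L r (avg M w) s)) i) <= R0 ^ 2 * (11 / 1000).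

Let IM : 0 < / INR M.
Proof. apply Rinv_0_lt_compat, lt_0_INR. lia. Qed.

Let gmono : forall i i', (i <= i')%nat -> (g i <= g i')%nat.
Proof. intros i i' H. induction H as [|i' H IH]; [lia|]. specialize (Hg i'). lia. Qed.

Let sum_l1_small : rsum M (fun i => l1 L (w i)) * e <= R0 / 1000.
Proof. pose proof (l1_nonneg L y1). nra. Qed.

Let l1_small : forall i, (i < M)%nat -> l1 L (w i) * e <= R0 / 1000.
Proof.
  intros i Hi. eapply Rle_trans; [|apply sum_l1_small].
  apply Rmult_le_compat_r; [lra|].
  apply (rsum_ge_term M (fun i => l1 L (w i))); [assumption|]. intros; apply l1_nonneg.
Qed.

Let Hlev2 : leN (lev L r (avg M w) s) R0.
Proof. now apply lev_avg_le. Qed.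

(** [Zs] is a sum of true blocks, to which the staircase estimate applies; [Es] collects the
    truncation errors. *)
Let Zs : nat -> R := fun i => rsum M (fun q => blk L c r (w q) s i).
Let Es : nat -> R := fun i => rsum M (fun q => lev L r (w q) s i - blk L c r (w q) s i).

Let HEs : leN Es (R0 / 1000).
Proof.
  eapply leN_weaken; [|apply sum_l1_small]. rewrite <- rsum_scal_r.
  apply leN_rsum1 with (y := fun q i => lev L r (w q) s i - blk L c r (w q) s i).
  intros q _. exact (lev_blk L c e r (w q) s Hc Hr).
Qed.

Let lev_avg_split : forall i, lev L r (avg M w) s i = / INR M * Zs i + / INR M * Es i.
Proof.
  intros i. rewrite lev_avg. unfold Zs, Es. rewrite <- Rmult_plus_distr_l, <- rsum_plus.
  f_equal. apply rsum_ext. intros; ring.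
Qed.

Let blk_le : forall q, (q < M)%nat -> N (blk L c r (w q) s) <= R0 + R0 / 1000.
Proof.
  intros q Hq. apply N_of_leN; [apply blk_finsupp|].
  apply leN_plus with (lev L r (w q) s) (fun i => - (lev L r (w q) s i - blk L c r (w q) s i)).
  - now apply Hlevw.
  - apply leN_opp with (fun i => lev L r (w q) s i - blk L c r (w q) s i); [|reflexivity].
    eapply leN_weaken; [exact (lev_blk L c e r (w q) s Hc Hr) | now apply l1_small].
  - intros; ring.
Qed.

(** The staircase estimate for [M >= 100 n_i] blocks of norm at most [1.001 R0] gives, after
    division by [M], the factor 1.001 * 1.01 < 1.02; the second summand comes from [Es]. *)
Lemma Tn_lev_avg_low i : (i < J)%nat ->
  Tn i (lev L r (avg M w) s) <= R0 * (102 / 100) * / INR (mseq i) + R0 / 1000 * / INR M.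
Proof.
  intros Hi.
  assert (HZf : finsupp Zs).
  { exists (c (r * L + g M)%nat). intros l Hl. apply rsum_zero. intros q Hq.
    apply (blk_supp L c e r (w q) s (g q) (g (S q))); [assumption | apply Hw |].
    right. pose proof (gmono (S q) M ltac:(lia)).
    pose proof (cuts_mono _ _ _ _ Hc (r * L + g (S q)) (r * L + g M) ltac:(lia)). lia. }
  assert (H1 : Tn i (lev L r (avg M w) s) <= / INR M * Tn i Zs + / INR M * Tn i Es).
  { eapply leN_Tn_comb; try lra; [exact Hlev2 | apply leN_of_N, HZf | apply HEs |].
    intros l. rewrite lev_avg_split. eapply Rle_trans; [apply Rabs_triang|].
    rewrite !Rabs_mult, !(Rabs_pos_eq (/ INR M)) by lra. lra. }
  pose proof (leN_Tn_le Es _ i HEs) as H2.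
  assert (H3 : Tn i Zs <= / INR (mseq i) * ((R0 + R0 / 1000) * INR (nseq i + M))).
  { apply (Tn_block_sum_le i M (fun q => blk L c r (w q) s) (fun q => c (r * L + g q)%nat)).
    - intros q q' Hq. apply (cuts_mono _ _ _ _ Hc). pose proof (gmono q q' Hq). lia.
    - intros q l Hl. apply (blk_supp L c e r (w q) s (g q) (g (S q))); auto.
    - apply blk_le.
    - lra. }
  assert (H4 : INR (nseq i + M) <= 101 / 100 * INR M).
  { rewrite plus_INR. pose proof (le_INR _ _ (HMn i Hi)) as H. rewrite mult_INR in H.
    simpl (INR 100) in H. lra. }
  pose proof (inv_mseq_pos i) as Hm.
  assert (H5 : / INR M * Tn i Zs <= R0 * (102 / 100) * / INR (mseq i)).
  { apply Rle_trans with (/ INR M * (/ INR (mseq i) * ((R0 + R0 / 1000) * (101 / 100 * INR M)))).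
    - apply Rmult_le_compat_l; [lra|]. eapply Rle_trans; [apply H3|].
      apply Rmult_le_compat_l; [lra|]. apply Rmult_le_compat_l; lra.
    - assert (HM0 : INR M <> 0) by (apply Rgt_not_eq, lt_0_INR; lia).
      replace (/ INR M * (/ INR (mseq i) * ((R0 + R0 / 1000) * (101 / 100 * INR M))))
        with ((R0 + R0 / 1000) * (101 / 100) * / INR (mseq i))
        by (field; split; [apply Rgt_not_eq, INR_mseq_pos | assumption]).
      apply Rmult_le_compat_r; lra. }
  assert (/ INR M * Tn i Es <= R0 / 1000 * / INR M).
  { rewrite Rmult_comm. apply Rmult_le_compat_r; lra. }
  lra.
Qed.

(** Below [J] the first profile is at most [R0] and the second is bounded by [Tn_lev_avg_low]. As
    the [1 / m_i] sum to at most 1/10 and [J <= M], this part contributes 0.102 + 0.001; together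
    with 0.011 from [Hinner] it stays below 0.115. *)
Lemma inner_le m : rsum m (fun i => Tn i (lev L r y1 s) * Tn i (lev L r (avg M w) s))
  <= R0 ^ 2 * (115 / 1000).
Proof.
  set (p1 := fun i => Tn i (lev L r y1 s)) in *.
  set (p2 := fun i => Tn i (lev L r (avg M w) s)) in *.
  assert (Hp1 : forall i, 0 <= p1 i) by (intros; now apply leN_Tn_nonneg with R0).
  assert (Hp2 : forall i, 0 <= p2 i) by (intros; now apply leN_Tn_nonneg with R0).
  assert (Hlow : rsum J (fun i => p1 i * p2 i) <= R0 ^ 2 * (103 / 1000)).
  { apply Rle_trans with
      (rsum J (fun i => R0 * (R0 * (102 / 100) * / INR (mseq i) + R0 / 1000 * / INR M))).
    - apply rsum_le. intros i Hi. apply Rmult_le_compat; auto.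
      + now apply leN_Tn_le.
      + now apply Tn_lev_avg_low.
    - rewrite rsum_scal, rsum_plus, rsum_scal, rsum_const.
      pose proof (rsum_inv_mseq J) as Hs.
      assert (HJ : INR J * / INR M <= 1).
      { apply Rle_trans with (INR M * / INR M).
        - apply Rmult_le_compat_r; [lra | now apply le_INR].
        - rewrite Rinv_r; [lra|]. apply Rgt_not_eq, lt_0_INR. lia. }
      replace (R0 ^ 2 * (103 / 1000)) with
        (R0 * (R0 * (102 / 100) * (1 / 10) + R0 / 1000 * 1)) by field.
      apply Rmult_le_compat_l; [lra|]. apply Rplus_le_compat.
      + apply Rmult_le_compat_l; lra.
      + replace (INR J * (R0 / 1000 * / INR M)) with (R0 / 1000 * (INR J * / INR M)) by ring.
        apply Rmult_le_compat_l; lra. }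
  apply Rle_trans with (rsum (J + m) (fun i => p1 i * p2 i)).
  { apply rsum_mono_length; [lia|]. intros; now apply Rmult_le_pos. }
  rewrite rsum_app.
  assert (rsum m (fun i => p1 (J + i)%nat * p2 (J + i)%nat) <= R0 ^ 2 * (11 / 1000)).
  { eapply Rle_trans; [|apply (Hinner (J + m))]. rewrite rsum_app, (rsum_zero J).
    - rewrite Rplus_0_l. right. apply rsum_ext. intros i _. unfold beyond.
      destruct (Nat.ltb_spec (J + i) J); [lia | reflexivity].
    - intros i Hi. unfold beyond. rewrite (proj2 (Nat.ltb_lt i J) Hi). ring. }
  nra.
Qed.

(** The blocks of [y1] lie to the left of those of the average, so at each coordinate one of the two
    levels is a mere truncation error, crudely at most [R0 / 2]. Half of [R0 + R0 / 2] is the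
    bound. *)
Lemma lev_half_sum_coord i :
  Rabs (lev L r (half_sum y1 (avg M w)) s i) <= 3 / 4 * R0.
Proof.
  rewrite lev_half_sum.
  assert (H1 : Rabs (lev L r y1 s i) <= R0) by now apply leN_coord.
  assert (H2 : Rabs (lev L r (avg M w) s i) <= R0) by now apply leN_coord.
  assert (H : Rabs (lev L r y1 s i) <= R0 / 2 \/ Rabs (lev L r (avg M w) s i) <= R0 / 2).
  { destruct (le_lt_dec (c (r * L + g 0)%nat) i) as [Hi|Hi].
    - left. pose proof (lev_blk L c e r y1 s Hc Hr) as Hb.
      apply leN_coord with (i := i) in Hb. cbv beta in Hb.
      rewrite (blk_supp L c e r y1 s 0 (g 0%nat) i Hc Hy1) in Hb by lia.
      rewrite Rminus_0_r in Hb. eapply Rle_trans; [apply Hb|].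
      assert (0 <= rsum M (fun i => l1 L (w i))) by (apply rsum_nonneg; intros; apply l1_nonneg).
      nra.
    - right. rewrite lev_avg_split. unfold Zs. rewrite rsum_zero.
      + rewrite Rmult_0_r, Rplus_0_l, Rabs_mult, Rabs_pos_eq by lra.
        pose proof (leN_coord _ _ i HEs).
        assert (/ INR M <= 1).
        { rewrite <- Rinv_1. apply Rinv_le_contravar; [lra|]. change 1 with (INR 1).
          now apply le_INR. }
        pose proof (Rabs_pos (Es i)). nra.
      + intros q Hq. apply (blk_supp L c e r (w q) s (g q) (g (S q))); auto. left.
        pose proof (gmono 0%nat q ltac:(lia)).
        pose proof (cuts_mono _ _ _ _ Hc (r * L + g 0%nat) (r * L + g q) ltac:(lia)). lia. }
  eapply Rle_trans; [apply Rabs_triang|].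
  rewrite !Rabs_mult, !(Rabs_pos_eq (/ 2)) by lra. lra.
Qed.

Lemma shrink_at : leN (lev L r (half_sum y1 (avg M w)) s) (3 / 4 * R0).
Proof.
  set (v := lev L r (half_sum y1 (avg M w)) s).
  assert (Hv : leN v (/ 2 * R0 + / 2 * R0)).
  { apply leN_comb with (lev L r y1 s) (lev L r (avg M w) s); try lra;
      [assumption | exact Hlev2 |].
    intros i. unfold v. rewrite lev_half_sum. eapply Rle_trans; [apply Rabs_triang|].
    rewrite !Rabs_mult, !(Rabs_pos_eq (/ 2)) by lra. lra. }
  apply leN_of_l2 with (/ 2 * R0 + / 2 * R0); [assumption | apply lev_half_sum_coord |].
  intros m. set (p1 := fun i => Tn i (lev L r y1 s)).
  set (p2 := fun i => Tn i (lev L r (avg M w) s)).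
  apply Rle_trans with (l2 m (fun i => / 2 * (p1 i + p2 i))).
  { apply l2_mono. intros i _. split; [now apply leN_Tn_nonneg with (/ 2 * R0 + / 2 * R0)|].
    replace (/ 2 * (p1 i + p2 i)) with (/ 2 * p1 i + / 2 * p2 i) by ring.
    eapply leN_Tn_comb; try lra; [exact Hv | exact Hlev1 | exact Hlev2 |].
    intros l. unfold v. rewrite lev_half_sum. eapply Rle_trans; [apply Rabs_triang|].
    rewrite !Rabs_mult, !(Rabs_pos_eq (/ 2)) by lra. lra. }
  apply l2_le_iff; [lra|].
  rewrite (rsum_ext m _ (fun i => / 4 * ((p1 i ^ 2 + p2 i ^ 2) + 2 * (p1 i * p2 i))))
    by (intros; field).
  rewrite rsum_scal, !rsum_plus, rsum_scal.
  pose proof (inner_le m) as H3. fold p1 p2 in H3.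
  pose proof (leN_l2 _ _ m Hlev1) as H1. apply l2_le_iff in H1; [|lra].
  pose proof (leN_l2 _ _ m Hlev2) as H2. apply l2_le_iff in H2; [|lra].
  fold p1 in H1. fold p2 in H2.
  change (rsum m (fun i => p1 i ^ 2) <= R0 ^ 2) in H1.
  change (rsum m (fun i => p2 i ^ 2) <= R0 ^ 2) in H2.
  change (rsum m (fun i => p1 i * p2 i) <= R0 ^ 2 * (115 / 1000)) in H3.
  pose proof (pow2_ge_0 R0).
  (* The squared norm is at most (1 + 1 + 2 * 0.115) / 4 = 0.5575 times [R0 ^ 2], which is below
     9/16. *)
  replace ((3 / 4 * R0) ^ 2) with (R0 ^ 2 * (9 / 16)) by field. lra.
Qed.

End Shrink_at.

Lemma beyond_nonneg J f i : (forall i, 0 <= f i) -> 0 <= beyond J f i.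
Proof. intros H. unfold beyond. destruct (i <? J); [lra | apply H]. Qed.

Lemma l2_beyond_le J J' f m : (J <= J')%nat -> (forall i, 0 <= f i) ->
  l2 m (beyond J' f) <= l2 m (beyond J f).
Proof.
  intros HJ Hf. apply l2_mono. intros i _. split; [now apply beyond_nonneg|].
  unfold beyond. destruct (Nat.ltb_spec i J); destruct (Nat.ltb_spec i J'); try lia; auto; lra.
Qed.

Lemma l2_beyond_le_full J f m : (forall i, 0 <= f i) -> l2 m (beyond J f) <= l2 m f.
Proof.
  intros Hf. apply l2_mono. intros i _. split; [now apply beyond_nonneg|].
  unfold beyond. destruct (i <? J); auto; lra.
Qed.

Lemma is_ulim_beyond {A} (W : (A -> Prop) -> Prop) J (h : A -> nat -> R) b :
  ultra W -> (forall i, is_ulim W (fun a => h a i) (b i)) ->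
  forall i, is_ulim W (fun a => beyond J (h a) i) (beyond J b i).
Proof.
  intros HW H i e He. unfold beyond. destruct (i <? J).
  - apply ultra_true; auto. intros _. rewrite Rminus_diag, Rabs_R0. assumption.
  - now apply H.
Qed.

(* The limit of the profile i |-> ||lev a||_i does not depend on the number L of sets in the
   plegma family; hence it may be used before L is known. *)
Lemma profile_limit L1 r a : (forall j, (L1 <= j)%nat -> a j = 0) ->
  exists b : nat -> R, (forall i, 0 <= b i) /\ (forall n, l2 n b <= l1 L1 a * (B + B)) /\
    forall L i, (L1 <= L)%nat -> is_ulim (often L) (fun s => Tn i (lev L r a s)) (b i).
Proof.
  intros Ha.
  set (b := fun i => ulim (often L1) (fun s => Tn i (lev L1 r a s))).
  assert (Hb : forall i, is_ulim (often L1) (fun s => Tn i (lev L1 r a s)) (b i)).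
  { intros i. apply ulim_spec with (l1 L1 a * (B + B)); [apply often_ultra|].
    intros s. pose proof (lev_bound L1 r a s) as H. rewrite Rabs_pos_eq.
    - now apply leN_Tn_le.
    - now apply leN_Tn_nonneg with (l1 L1 a * (B + B)). }
  assert (Hb0 : forall i, 0 <= b i).
  { intros i. apply (is_ulim_ge _ _ _ _ (often_ultra L1) (Hb i)).
    apply ultra_true; [apply often_ultra|]. intros s.
    apply leN_Tn_nonneg with (l1 L1 a * (B + B)), lev_bound. }
  exists b. repeat split; auto.
  - intros n. apply (l2_ulim_le (often L1) (fun s i => Tn i (lev L1 r a s))); auto.
    + apply often_ultra.
    + apply ultra_true; [apply often_ultra|]. intros s. apply leN_l2, lev_bound.
  - intros L i HL e He. specialize (Hb i e He). unfold often in *.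
    apply (prodU_filter U HU (fun p => fst p <? L1)).
    + intros s s' Hs. rewrite (lev_agree L r a s s'); [auto|].
      intros j r' Hj. apply Hs. apply Nat.ltb_lt. simpl. apply Nat.nle_gt. intros Hle.
      now apply Hj, Ha.
    + rewrite positions_filter by assumption.
      apply (ultra_mono _ _ _ (often_ultra L1)) with (2 := Hb).
      intros s. now rewrite (lev_ext L1 L r a s HL Ha).
Qed.

(** One [J] must serve all levels: it determines the length of the average, and the average is the
    same vector for every level. *)
Lemma profile_tails n L1 a eta : (forall j, (L1 <= j)%nat -> a j = 0) -> 0 < eta ->
  exists J, forall r, (r < n)%nat -> exists b : nat -> R, (forall i, 0 <= b i) /\
    (forall m, l2 m (beyond J b) <= eta) /\
    forall L i, (L1 <= L)%nat -> is_ulim (often L) (fun s => Tn i (lev L r a s)) (b i).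
Proof.
  intros Ha Heta. induction n as [|n [J HJ]]; [exists 0%nat; intros; lia|].
  destruct (profile_limit L1 n a Ha) as [b [Hb0 [HbB Hb]]].
  destruct (l2_tail b _ eta HbB Heta) as [J' HJ'].
  exists (max J J'). intros r Hr. destruct (Nat.eq_dec r n) as [->|Hne].
  - exists b. repeat split; auto. intros m. eapply Rle_trans; [|apply (HJ' m)].
    apply (l2_beyond_le J'); [lia | assumption].
  - destruct (HJ r ltac:(lia)) as [b' [Hb0' [HbJ Hb']]]. exists b'. repeat split; auto.
    intros m. eapply Rle_trans; [|apply (HbJ m)]. apply (l2_beyond_le J); [lia | assumption].
Qed.

Lemma lev_le_uniform r M (w : nat -> nat -> R) R0 :
  (forall i, (i < M)%nat -> lev_le r (w i) R0) ->
  exists L0, forall L, (L0 <= L)%nat -> (1 <= L)%nat ->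
    often L (fun s => forall i, (i < M)%nat -> leN (lev L r (w i) s) R0).
Proof.
  intros H.
  assert (exists L0, forall i L, (i < M)%nat -> (L0 <= L)%nat -> (1 <= L)%nat ->
    often L (fun s => leN (lev L r (w i) s) R0)) as [L0 HL0].
  { induction M as [|M IH]; [exists 0%nat; intros; lia|].
    destruct IH as [L1 HL1]; [intros; apply H; lia|].
    destruct (H M ltac:(lia)) as [L2 [_ HL2]]. exists (max L1 L2).
    intros i L Hi HL HL'. destruct (Nat.eq_dec i M) as [->|]; [apply HL2; lia|].
    apply HL1; lia. }
  exists L0. intros L HL HL1. apply ultra_forall_lt; [apply often_ultra|].
  intros i Hi. now apply HL0.
Qed.

Variable K : (nat -> R) -> Prop.
Hypothesis Kavg : forall M w, (1 <= M)%nat -> (forall i, K (w i)) -> K (avg M w).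
Hypothesis Khalf : forall u v, K u -> K v -> K (half_sum u v).

(** [K] stands for a convex set of vectors, and the number in the pair bounds the support. Asking
    for members beyond every [i0] lets the property reproduce itself, since averages are formed from
    successively farther members. *)
Definition far_small (R0 : R) : Prop :=
  forall i0, exists p : (nat -> R) * nat, (i0 < snd p)%nat /\ K (fst p) /\
    (forall j, fst p j <> 0 -> (i0 <= j < snd p)%nat) /\
    forall r, (r < k)%nat -> lev_le r (fst p) R0.

(* Average y1 with an average y2 of so many far blocks that y2 has small i-th seminorms
   for the finitely many i on which the limit profile of y1 lives; the two profiles are then
   almost orthogonal in l^2. *)
Lemma far_small_shrink R0 : 0 < R0 -> far_small R0 -> far_small (3 / 4 * R0).
Proof.
  intros HR H i0. destruct (H i0) as [[y1 i1] [Hi1 [Ky1 [Hy1 Ly1]]]]. simpl in *.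
  assert (Hy1z : forall j, (i1 <= j)%nat -> y1 j = 0).
  { intros j Hj. apply NNPP. intros Hne. apply Hy1 in Hne. lia. }
  destruct (profile_tails k i1 y1 (R0 / 100) Hy1z ltac:(lra)) as [J HJ].
  set (nx := fun i => proj1_sig (constructive_indefinite_description _ (H i))).
  assert (Hnx : forall i, (i < snd (nx i))%nat /\ K (fst (nx i)) /\
    (forall j, fst (nx i) j <> 0 -> (i <= j < snd (nx i))%nat) /\
    forall r, (r < k)%nat -> lev_le r (fst (nx i)) R0).
  { intros i. unfold nx. apply proj2_sig. }
  set (g := fix g i := match i with O => i1 | S i => snd (nx (g i)) end).
  set (w := fun i => fst (nx (g i))).
  assert (Hg : forall i, (g i < g (S i))%nat) by (intros i; exact (proj1 (Hnx (g i)))).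
  assert (Hw : forall i j, w i j <> 0 -> (g i <= j < g (S i))%nat) by (intros i; exact (proj1 (proj2 (proj2 (Hnx (g i)))))).
  assert (gmono : forall i i', (i <= i')%nat -> (g i <= g i')%nat).
  { intros i i' Hi. induction Hi as [|i' Hi IH]; [lia|]. specialize (Hg i'). lia. }
  (* [100 * nseq J] makes [n_i / M] at most 1/100 for all [i < J]; the summands [J] and 1 secure
     [J <= M] and [1 <= M]. *)
  set (M := (100 * nseq J + J + 1)%nat).
  assert (HM : (1 <= M)%nat) by (unfold M; lia).
  assert (HwM : forall i j, (i < M)%nat -> (g M <= j)%nat -> w i j = 0).
  { intros i j Hi Hj. apply NNPP. intros Hne. apply Hw in Hne.
    pose proof (gmono (S i) M ltac:(lia)). lia. }
  assert (Hy2z : forall j, (j < i1 \/ g M <= j)%nat -> avg M w j = 0).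
  { intros j Hj. unfold avg. rewrite rsum_zero; [ring|]. intros i Hi.
    destruct Hj as [Hj|Hj]; [|now apply HwM]. apply NNPP. intros Hne. apply Hw in Hne.
    pose proof (gmono 0%nat i ltac:(lia)) as H0. change (g 0%nat) with i1 in H0. lia. }
  assert (HgM : (i1 < g M)%nat).
  { pose proof (gmono 1%nat M HM). pose proof (Hg 0%nat) as H1. change (g 0%nat) with i1 in H1. lia. }
  exists (half_sum y1 (avg M w), g M). simpl. split; [lia|]. split; [|split].
  - apply Khalf; auto. apply Kavg; auto. intros i. exact (proj1 (proj2 (Hnx (g i)))).
  - intros j Hj. apply NNPP. intros Hout. apply Hj. unfold half_sum.
    rewrite Hy2z by lia. replace (y1 j) with 0; [field|]. symmetry. apply NNPP.
    intros Hne. apply Hy1 in Hne. lia.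
  - intros r Hr. destruct (HJ r Hr) as [b1 [Hb10 [Hb1J Hb1]]].
    destruct (Ly1 r Hr) as [Ly [_ HLy]].
    destruct (lev_le_uniform r M w R0) as [Lw HLw]; [intros i _; exact (proj2 (proj2 (proj2 (Hnx (g i)))) r Hr)|].
    exists (max (g M) (max Ly Lw)). split.
    { intros j Hj. unfold half_sum. rewrite Hy1z, Hy2z by lia. field. }
    intros L HL HL1. pose proof (often_ultra L) as HW.
    set (S := l1 L y1 + rsum M (fun i => l1 L (w i))).
    assert (HS : 0 <= S).
    { pose proof (l1_nonneg L y1).
      assert (0 <= rsum M (fun i => l1 L (w i))) by (apply rsum_nonneg; intros; apply l1_nonneg).
      unfold S. lra. }
    set (e := R0 / 1000 / (1 + S)).
    assert (He : 0 < e) by (apply Rdiv_lt_0_compat; lra).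
    assert (HSe : S * e <= R0 / 1000).
    { apply Rle_trans with ((1 + S) * e); [nra|]. unfold e. right. field. lra. }
    specialize (HLy L ltac:(lia) HL1). specialize (HLw L ltac:(lia) HL1).
    destruct (profile_limit (g M) r (avg M w)) as [b2 [Hb20 [_ Hb2]]];
      [intros; apply Hy2z; lia|].
    set (p1 := fun (s : cfg) i => Tn i (lev L r y1 s)).
    set (p2 := fun (s : cfg) i => Tn i (lev L r (avg M w) s)).
    assert (Hp1 : forall s i, 0 <= p1 s i)
      by (intros; eapply leN_Tn_nonneg, lev_bound).
    assert (Hp2 : forall s i, 0 <= p2 s i)
      by (intros; eapply leN_Tn_nonneg, lev_bound).
    set (C := Rmax (l1 L y1 * (B + B)) (l1 L (avg M w) * (B + B))).
    (* [y1] and the average involve indices on opposite sides of [i1], so their profiles may be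
       passed to the limit separately. Beyond [J] the limits have norms at most [R0 / 100] and [R0];
       the additional [R0 ^ 2 / 1000] is the error of the passage. *)
    assert (Hin : often L (fun s => forall m,
      rsum m (fun i => beyond J (p1 s) i * beyond J (p2 s) i) <= R0 / 100 * R0 + R0 ^ 2 / 1000)).
    { apply (prodU_inner U HU (fun s => beyond J (p1 s)) (fun s => beyond J (p2 s))
        (fun j _ => (j < i1)%nat) (fun j _ => (i1 <= j)%nat) C) with (b := beyond J b1) (b' := beyond J b2).
      - intros; lia.
      - intros s s' Hs i. unfold p1. rewrite (lev_agree L r y1 s s'); [reflexivity|].
        intros j r' Hj. apply Hs. apply Hy1 in Hj. lia.
      - intros s s' Hs i. unfold p2. rewrite (lev_agree L r (avg M w) s s'); [reflexivity|].
        intros j r' Hj. apply Hs. apply Nat.nlt_ge. intros Hlt. apply Hj, Hy2z. lia.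
      - intros; now apply beyond_nonneg.
      - intros; now apply beyond_nonneg.
      - intros s n. eapply Rle_trans; [now apply l2_beyond_le_full|].
        eapply Rle_trans; [apply leN_l2, lev_bound | apply Rmax_l].
      - intros s n. eapply Rle_trans; [now apply l2_beyond_le_full|].
        eapply Rle_trans; [apply leN_l2, lev_bound | apply Rmax_r].
      - apply (is_ulim_beyond (often L)); auto. intros i. apply Hb1. lia.
      - apply (is_ulim_beyond (often L)); auto. intros i. apply Hb2. lia.
      - intros m. eapply Rle_trans; [apply rsum_cauchy_schwarz|].
        apply Rmult_le_compat; try apply l2_nonneg; [apply Hb1J|].
        apply (l2_ulim_le (often L) (fun s => beyond J (p2 s))); auto.
        + apply is_ulim_beyond; auto. intros i. apply Hb2. lia.
        + intros; now apply beyond_nonneg.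
        + apply (ultra_mono _ _ _ HW) with (2 := HLw). intros s Hs.
          eapply Rle_trans; [now apply l2_beyond_le_full|]. apply leN_l2.
          now apply lev_avg_le.
      - pose proof (pow_lt R0 2 HR). lra. }
    apply (ultra_mono _ _ _ HW) with (2 := ultra_and _ _ _ HW (cuts_often L e He)
      (ultra_and _ _ _ HW HLy (ultra_and _ _ _ HW HLw Hin))).
    intros s [[c Hc] [Hs1 [Hs2 Hs3]]].
    apply (shrink_at L r M J s c e R0 y1 w g); auto.
    + intros j Hj. apply Hy1 in Hj. change (g 0%nat) with i1. lia.
    + unfold M. lia.
    + intros i Hi. pose proof (nseq_mono i J ltac:(lia)). unfold M. lia.
    + intros m. eapply Rle_trans; [apply (Hs3 m)|]. right. field.
Qed.

Lemma far_small_iter R0 n : 0 < R0 -> far_small R0 -> far_small ((3 / 4) ^ n * R0).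
Proof.
  intros HR H. induction n as [|n IH]; simpl; [now rewrite Rmult_1_l|].
  rewrite Rmult_assoc. apply far_small_shrink; [|assumption].
  apply Rmult_lt_0_compat; [apply pow_lt; lra | assumption].
Qed.

(** Returning from the levels to [nu] costs the fixed factor [k], which enough shrinking steps
    outweigh. *)
Lemma far_small_nu_small R0 eps : 0 < R0 -> far_small R0 ->
  (forall u, K u -> exists L, (forall j, (L <= j)%nat -> u j = 0) /\ rsum L u = 0) ->
  0 < eps -> exists u, K u /\ nu u <= eps.
Proof.
  intros HR H Kz Heps. pose proof (pos_INR k) as Hk.
  destruct (pow_lt_1_zero (3 / 4) ltac:(rewrite Rabs_pos_eq; lra) (eps / ((INR k + 1) * R0)))
    as [n Hn]; [apply Rdiv_lt_0_compat; nra|].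
  specialize (Hn n (le_n n)). rewrite Rabs_pos_eq in Hn by (apply pow_le; lra).
  destruct (far_small_iter R0 n HR H 0%nat) as [[u i1] [_ [Ku [_ Hu]]]]. simpl in *.
  exists u. split; [assumption|]. destruct (Kz u Ku) as [L [HL HL0]].
  eapply Rle_trans; [exact (nu_le_of_lev_le u L _ HL HL0 Hu)|].
  assert (0 < (3 / 4) ^ n) by (apply pow_lt; lra).
  apply Rmult_lt_compat_r with (r := (INR k + 1) * R0) in Hn; [|nra].
  unfold Rdiv in Hn at 2. rewrite Rmult_assoc, Rinv_l, Rmult_1_r in Hn by nra. nra.
Qed.

End Levels.

(** * Realizing a k-spreading model along a product ultrafilter *)

Lemma nat_bound n (h : nat -> nat) : exists b, forall i, (i < n)%nat -> (h i < b)%nat.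
Proof.
  induction n as [|n [b Hb]]; [exists 0%nat; intros; lia|].
  exists (S (max b (h n))). intros i Hi. destruct (Nat.eq_dec i n) as [->|]; [lia|].
  specialize (Hb i ltac:(lia)). lia.
Qed.

Lemma prefix_length s j r : length (prefix s j r) = r.
Proof. unfold prefix. now rewrite length_map, length_seq. Qed.

Lemma prefix_nth s j r i : (i < r)%nat -> nth i (prefix s j r) 0%nat = s j i.
Proof.
  intros Hi. unfold prefix.
  rewrite (nth_indep _ _ (s j 0%nat)) by now rewrite length_map, length_seq.
  rewrite map_nth. now rewrite seq_nth.
Qed.

Section Realize.
Variable U : (nat -> Prop) -> Prop.
Hypothesis HU : ultra U.
Hypothesis Hfree : forall m, U (fun n => le m n).

(** Increase along the order of choice contains both plegma conditions and the monotonicity of each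
    set. The entries are indices into the enumeration of [M], which is applied afterwards by
    [map Menum]. *)
Definition plegma_cfg (k L l : nat) (s : cfg) : Prop :=
  (forall r j r' j', (r < k)%nat -> (j < L)%nat -> (r' < k)%nat -> (j' < L)%nat ->
     (r * L + j < r' * L + j')%nat -> (s j r < s j' r')%nat) /\
  forall r j, (r < k)%nat -> (j < L)%nat -> (l <= s j r)%nat.

Lemma plegma_cfg_often k L l : often U k L (plegma_cfg k L l).
Proof.
  set (Q := fun p (s : cfg) =>
    (forall r j r' j', (r < k)%nat -> (j < L)%nat -> (r' < k)%nat -> (j' < L)%nat ->
       (r' * L + j' < p)%nat -> (r * L + j < r' * L + j')%nat -> (s j r < s j' r')%nat) /\
    forall r j, (r < k)%nat -> (j < L)%nat -> (r * L + j < p)%nat -> (l <= s j r)%nat).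
  assert (HQ : often U k L (Q (length (positions k L)))).
  { apply prodU_invariant; auto.
    - intros p s Hp [H1 H2]. rewrite positions_length in Hp.
      destruct (position_index k L p Hp) as [r [j [Hr [Hj Ep]]]].
      rewrite Ep, positions_nth by assumption. rewrite <- Ep.
      (* A common bound for all relevant entries of [s], which the new entry exceeds by freeness of
         [U]. *)
      assert (exists b, forall r j, (r < k)%nat -> (j < L)%nat -> (s j r < b)%nat) as [b Hb].
      { destruct (nat_bound (k * L) (fun p => s (p mod L)%nat (p / L)%nat)) as [b Hb].
        exists b. intros r' j' Hr' Hj'. specialize (Hb (r' * L + j')%nat ltac:(nia)).
        rewrite Nat.add_comm, Nat.Div0.mod_add, Nat.mod_small, Nat.div_add, Nat.div_small in Hb;
          simpl in Hb; auto; lia. }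
      apply (ultra_mono U _ _ HU) with (2 := Hfree (max l b)). intros n Hn. split.
      + intros r1 j1 r2 j2 Hr1 Hj1 Hr2 Hj2 Hlt Hlt'.
        assert (E1 : upd s (j, r) n j1 r1 = s j1 r1).
        { apply upd_other. destruct (Nat.eq_dec j1 j) as [->|]; [|now left]. right.
          intros ->. lia. }
        rewrite E1. destruct (Nat.eq_dec (r2 * L + j2) p) as [E|E].
        * destruct (position_inj L r j r2 j2) as [-> ->]; try assumption; try congruence.
          rewrite upd_same. specialize (Hb r1 j1 Hr1 Hj1). lia.
        * rewrite upd_other; [apply H1; auto; lia|].
          destruct (Nat.eq_dec j2 j) as [->|]; [|now left]. right. intros ->. lia.
      + intros r1 j1 Hr1 Hj1 Hlt. destruct (Nat.eq_dec (r1 * L + j1) p) as [E|E].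
        * destruct (position_inj L r j r1 j1) as [-> ->]; try assumption; try congruence.
          rewrite upd_same. lia.
        * rewrite upd_other; [apply H2; auto; lia|].
          destruct (Nat.eq_dec j1 j) as [->|]; [|now left]. right. intros ->. lia.
    - split; intros; lia. }
  rewrite positions_length in HQ.
  apply (ultra_mono _ _ _ (often_ultra U HU k L)) with (2 := HQ).
  intros s [H1 H2]. split; intros; [apply H1 | apply H2]; auto; nia.
Qed.

(** The vectors of the [k]-sequence lie in the completion, while the level decomposition starts from
    finitely supported ones. Each is replaced by one term of its Cauchy sequence, with a tolerance
    that tends to 0 as the first element of its set grows; far plegma families hardly notice the
    change. *)
Lemma spreading_model_realized k nu : (1 <= k)%nat -> is_k_spreading_model N k nu ->
  exists (x : list nat -> nat -> R) (B : R),
    (forall t, leN (x t) B) /\ (forall t, finsupp (x t)) /\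
    forall L a e, (1 <= L)%nat -> (forall j, (L <= j)%nat -> a j = 0) -> 0 < e ->
      often U k L (fun s => Rabs (N (real k x L a s) - nu a) <= e).
Proof.
  intros Hk [[_ Hhom] [xs [Menum [delta [Hxs [HM [Hdpos [Hdelta Hsm]]]]]]]].
  assert (HMlt : forall i j, (i < j)%nat -> (Menum i < Menum j)%nat).
  { intros i j Hij. induction Hij as [|j Hij IH]; [apply HM|]. specialize (HM j). lia. }
  assert (HMle : forall i j, (i <= j)%nat -> (Menum i <= Menum j)%nat).
  { intros i j Hij. destruct (Nat.eq_dec i j) as [->|]; [lia|].
    pose proof (HMlt i j ltac:(lia)). lia. }
  set (good := fun t => length t = k /\ strictly_incr_list t).
  assert (Hnth : forall t i, (i < length t)%nat ->
    nth i (map Menum t) 0%nat = Menum (nth i t 0%nat)).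
  { intros t i Hi. rewrite (nth_indep _ _ (Menum 0%nat)) by now rewrite length_map.
    apply map_nth. }
  assert (Hincr : forall t, good t -> strictly_incr_list (map Menum t)).
  { intros t [Ht Hs] i Hi. rewrite length_map in Hi. rewrite !Hnth by lia.
    apply HMlt, Hs. assumption. }
  assert (Hmk : forall t, good t -> in_Mk Menum k (map Menum t)).
  { intros t Ht. split; [rewrite length_map; apply Ht|]. split; [now apply Hincr|].
    intros i Hi. apply in_map_iff in Hi as [l [<- _]]. eauto. }
  assert (Hcau : forall t, good t -> cauchy_in N (xs (map Menum t))).
  { intros t Ht. apply Hxs; [rewrite length_map; apply Ht | now apply Hincr]. }
  set (tol := fun t : list nat => / INR (S (nth 0 t 0%nat))).
  assert (Htol : forall t, 0 < tol t) by (intros; apply Rinv_0_lt_compat, lt_0_INR; lia).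
  set (tau := fun t => epsilon (inhabits 0%nat) (fun T => forall u u',
    (T <= u)%nat -> (T <= u')%nat ->
    N (vsub (xs (map Menum t) u) (xs (map Menum t) u')) < tol t)).
  assert (Htau : forall t, good t -> forall u u', (tau t <= u)%nat -> (tau t <= u')%nat ->
    N (vsub (xs (map Menum t) u) (xs (map Menum t) u')) < tol t).
  { intros t Ht. unfold tau. apply epsilon_spec.
    exact (proj2 (Hcau t Ht) (tol t) (Htol t)). }
  (* The limits range over all extensions of a list, including non-increasing ones; the value 0
     keeps [x] bounded and finitely supported there. *)
  set (x := fun t => if excluded_middle_informative (good t)
    then xs (map Menum t) (tau t) else (fun _ => 0)).
  assert (Hx : forall t, good t -> x t = xs (map Menum t) (tau t)).
  { intros t Ht. unfold x. destruct (excluded_middle_informative (good t)); tauto. }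
  assert (Hxf : forall t, finsupp (x t)).
  { intros t. unfold x. destruct (excluded_middle_informative (good t)) as [Ht|_].
    - exact (proj1 (Hcau t Ht) _).
    - apply finsupp_zero. }
  (* A single set is a plegma family, so the case [l = m = 1] bounds every vector by [nu] of the
     first unit vector plus [delta 1]. The remaining 2 covers the distance to the limit norm and the
     tolerance. *)
  set (B := Rabs (nu (trunc 1 (fun _ => 1))) + Rabs (delta 1%nat) + 2).
  exists x, B. split; [|split; [exact Hxf|]].
  - intros t.
    assert (HB0 : 0 <= B).
    { unfold B. pose proof (Rabs_pos (nu (trunc 1 (fun _ => 1)))).
      pose proof (Rabs_pos (delta 1%nat)). lra. }
    destruct (classic (good t)) as [Ht|Ht].
    2:{ apply leN_weaken with 0; [|assumption]. apply leN_zero. intros i. unfold x.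
        destruct (excluded_middle_informative (good t)); tauto. }
    eapply leN_weaken; [apply leN_of_N, Hxf|].
    destruct (Hsm 1%nat 1%nat (fun _ => map Menum t) (fun _ => 1)) as [v [Hv Hvnu]]; auto.
    + split; [intros; now apply Hmk|]. split; [intros; lia|]. intros _ i Hi.
      apply (Hincr t Ht). rewrite length_map. now rewrite (proj1 Ht).
    + simpl. rewrite Hnth by (rewrite (proj1 Ht); lia). apply HMle. lia.
    + intros; lra.
    + destruct (Hv 1 Rlt_0_1) as [u0 Hu0].
      specialize (Hu0 (max u0 (tau t)) ltac:(lia)). unfold Rdist in Hu0.
      apply Rabs_def2 in Hu0. apply Rabs_le_bounds in Hvnu.
      set (u := max u0 (tau t)) in *.
      replace (comb 1 (fun _ => 1) (fun _ => map Menum t) xs u) with (xs (map Menum t) u) in Hu0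
        by (apply functional_extensionality; intros i; unfold comb; simpl; ring).
      pose proof (Htau t Ht u (tau t) ltac:(lia) ltac:(lia)) as H1.
      pose proof (N_diff (xs (map Menum t) u) (x t) (proj1 (Hcau t Ht) u) (Hxf t)) as H2.
      rewrite (Hx t Ht) in *. apply Rabs_le_bounds in H2. unfold vsub in H1.
      assert (tol t <= 1).
      { unfold tol. rewrite <- Rinv_1. apply Rinv_le_contravar; [lra|].
        rewrite S_INR. pose proof (pos_INR (nth 0 t 0%nat)). lra. }
      unfold B. pose proof (Rle_abs (nu (trunc 1 (fun _ => 1)))).
      pose proof (Rle_abs (delta 1%nat)). lra.
  - intros L a e HL Ha He.
    (* Division by [C] brings the coefficients into [-1, 1] and their absolute sum below 1;
       homogeneity of [nu] and [N] undoes it. *)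
    set (C := 1 + l1 L a).
    assert (HC : 0 < C) by (pose proof (l1_nonneg L a); unfold C; lra).
    set (e' := e / 3 / C). assert (He' : 0 < e') by (apply Rdiv_lt_0_compat; lra).
    destruct (Hdelta e' He') as [l1' Hl1'].
    destruct (archimed_cor1 e' He') as [l2' [Hl2' Hl2pos]].
    set (l := max L (max l1' l2')).
    assert (Hdl : delta l <= e').
    { specialize (Hl1' l ltac:(unfold l; lia)). unfold Rdist in Hl1'.
      rewrite Rminus_0_r in Hl1'. apply Rabs_def2 in Hl1'. lra. }
    apply (ultra_mono _ _ _ (often_ultra U HU k L)) with (2 := plegma_cfg_often k L l).
    intros s [Hs1 Hs2].
    assert (Hgood : forall j, (j < L)%nat -> good (prefix s j k)).
    { intros j Hj. split; [apply prefix_length|]. intros i Hi. rewrite prefix_length in Hi.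
      rewrite !prefix_nth by lia. apply Hs1; auto; nia. }
    assert (Hnth' : forall i j, (i < k)%nat ->
      nth i (map Menum (prefix s j k)) 0%nat = Menum (s j i)).
    { intros i j Hi. rewrite Hnth by (rewrite prefix_length; lia). now rewrite prefix_nth. }
    set (a' := fun j => / C * a j).
    assert (Ha'1 : rsum L (fun j => Rabs (a' j)) <= 1).
    { unfold a'. rewrite (rsum_ext L _ (fun j => / C * Rabs (a j))).
      - rewrite rsum_scal. apply Rmult_le_reg_l with C; [assumption|].
        rewrite <- Rmult_assoc, Rinv_r by lra. change (rsum L (fun i => Rabs (a i))) with (l1 L a).
        unfold C. lra.
      - intros j _. rewrite Rabs_mult, Rabs_pos_eq; [reflexivity|].
        left. now apply Rinv_0_lt_compat. }
    destruct (Hsm l L (fun j => map Menum (prefix s j k)) a') as [v [Hv Hvnu]];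
      try (unfold l; lia).
    + split; [intros; now apply Hmk, Hgood|]. split.
      * intros i j Hi Hj. rewrite !Hnth' by assumption. apply HMlt, Hs1; auto; lia.
      * intros _ i Hi. rewrite !Hnth' by lia. apply HMlt, Hs1; auto; nia.
    + rewrite Hnth' by lia. apply HMle. specialize (Hs2 0%nat 0%nat Hk HL). lia.
    + intros j Hj. apply Rabs_le_bounds. eapply Rle_trans; [|apply Ha'1].
      apply (rsum_ge_term L (fun j => Rabs (a' j))); [assumption|]. intros; apply Rabs_pos.
    + destruct (Hv e' He') as [u0 Hu0].
      destruct (nat_bound L (fun j => tau (prefix s j k))) as [u1 Hu1].
      set (u := max u0 u1). specialize (Hu0 u ltac:(unfold u; lia)). unfold Rdist in Hu0.
      set (cu := comb L a' (fun j => map Menum (prefix s j k)) xs u) in *.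
      assert (Hcuf : finsupp cu).
      { apply finsupp_rsum. intros j Hj. exact (proj1 (Hcau _ (Hgood j Hj)) u). }
      assert (Hdiff : Rabs (N cu - N (real k x L a' s)) <= e').
      { eapply Rle_trans; [apply N_diff; [assumption | now apply real_finsupp]|].
        apply Rle_trans with (rsum L (fun j => Rabs (a' j) * e')).
        - apply N_of_leN.
          + destruct Hcuf as [b Hb]. destruct (real_finsupp k x Hxf L a' s) as [b' Hb'].
            exists (max b b'). intros n Hn. rewrite Hb, Hb' by lia. ring.
          + replace (fun i => cu i - real k x L a' s i) with
              (fun i => rsum L (fun j => a' j *
                 (xs (map Menum (prefix s j k)) u i - x (prefix s j k) i))).
            * apply leN_rsum with (A := fun _ => e')
                (y := fun j i => xs (map Menum (prefix s j k)) u i - x (prefix s j k) i).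
              intros j Hj. pose proof (Hgood j Hj) as Hgj.
              assert (Hfd : finsupp (vsub (xs (map Menum (prefix s j k)) u) (x (prefix s j k)))).
              { destruct (proj1 (Hcau _ Hgj) u) as [b Hb]. destruct (Hxf (prefix s j k)) as [b' Hb'].
                exists (max b b'). intros n Hn. unfold vsub. rewrite Hb, Hb' by lia. ring. }
              eapply leN_weaken; [apply leN_of_N, Hfd|].
              rewrite (Hx _ Hgj). left. eapply Rlt_le_trans; [apply Htau; auto|].
              -- specialize (Hu1 j Hj). cbv beta in Hu1. unfold u. lia.
              -- unfold tol. rewrite prefix_nth by lia.
                 eapply Rle_trans; [|left; apply Hl2'].
                 apply Rinv_le_contravar; [now apply lt_0_INR|]. apply le_INR.
                 specialize (Hs2 0%nat j Hk Hj). unfold l in Hs2. lia.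
            * apply functional_extensionality. intros i. unfold cu, comb, real.
              rewrite <- rsum_minus. apply rsum_ext. intros; ring.
        - rewrite rsum_scal_r. nra. }
      assert (Htr : trunc L a' = vscal (/ C) a).
      { apply functional_extensionality. intros j. unfold trunc, vscal, a'.
        destruct (Nat.ltb_spec j L); [reflexivity|]. rewrite Ha by assumption. ring. }
      rewrite Htr, Hhom in Hvnu by (exists L; exact Ha).
      assert (Hra : N (real k x L a' s) = / C * N (real k x L a s)).
      { rewrite <- (Rabs_pos_eq (/ C)) by (left; now apply Rinv_0_lt_compat).
        rewrite <- N_scal by now apply real_finsupp. f_equal.
        apply functional_extensionality. intros i. unfold real. rewrite <- rsum_scal.
        apply rsum_ext. intros j _. unfold a'. ring. }
      rewrite (Rabs_pos_eq (/ C)) in Hvnu by (left; now apply Rinv_0_lt_compat).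
      rewrite Hra in Hdiff.
      (* Three errors of at most [e'] each: replacing the vectors by their approximations, stopping
         the Cauchy sequences at [u], and [delta l]. *)
      assert (H3 : Rabs (/ C * (N (real k x L a s) - nu a)) <= 3 * e').
      { replace (/ C * (N (real k x L a s) - nu a)) with
          (- (N cu - / C * N (real k x L a s)) + (N cu - v) + (v - / C * nu a)) by ring.
        eapply Rle_trans; [apply Rabs_triang|].
        eapply Rle_trans; [apply Rplus_le_compat_r, Rabs_triang|]. rewrite Rabs_Ropp. lra. }
      rewrite Rabs_mult, (Rabs_pos_eq (/ C)) in H3 by (left; now apply Rinv_0_lt_compat).
      apply Rmult_le_reg_l with (/ C); [now apply Rinv_0_lt_compat|].
      eapply Rle_trans; [apply H3|]. unfold e'. right. field. lra.
Qed.

End Realize.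

Hypothesis Hn_inc : forall j, (nseq j < nseq (S j))%nat.

Lemma spreading_model_blocks_lower k nu J (a : nat -> nat -> R) (f : nat -> nat) :
  (1 <= k)%nat -> is_k_spreading_model N k nu ->
  (forall q, (q < nseq J)%nat -> (f q < f (S q))%nat) ->
  (forall q j, (q < nseq J)%nat -> a q j <> 0 -> (f q <= j < f (S q))%nat) ->
  (forall q, (q < nseq J)%nat -> rsum (f (nseq J)) (a q) = 0) ->
  rsum (nseq J) (fun q => nu (a q))
    <= INR k * (INR (mseq J) * nu (fun j => rsum (nseq J) (fun q => a q j))).
Proof.
  intros Hk Hsm. destruct free_ultrafilter_exists as [U [HU Hfree]].
  destruct (spreading_model_realized U HU Hfree k nu Hk Hsm) as [x [B [HxB [Hxf Hreal]]]].
  exact (nu_blocks_lower U HU k x B HxB Hxf nu Hreal J a f).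
Qed.

Lemma spreading_model_convex_small k nu (K : (nat -> R) -> Prop) C eps :
  (1 <= k)%nat -> is_k_spreading_model N k nu ->
  (forall M w, (1 <= M)%nat -> (forall i, K (w i)) -> K (avg M w)) ->
  (forall u v, K u -> K v -> K (half_sum u v)) ->
  (forall u, K u -> exists L, (forall j, (L <= j)%nat -> u j = 0) /\ rsum L u = 0) ->
  (forall i0, exists p : (nat -> R) * nat, (i0 < snd p)%nat /\ K (fst p) /\
    (forall j, fst p j <> 0 -> (i0 <= j < snd p)%nat) /\ nu (fst p) <= C) ->
  0 < eps -> exists u, K u /\ nu u <= eps.
Proof.
  intros Hk Hsm Kavg Khalf Kz Kfar Heps.
  destruct free_ultrafilter_exists as [U [HU Hfree]].
  destruct (spreading_model_realized U HU Hfree k nu Hk Hsm) as [x [B [HxB [Hxf Hreal]]]].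
  pose proof (Rabs_pos C) as HC0. pose proof (Rle_abs C) as HC.
  (* [Rabs C + 1] is positive and leaves a margin above [nu w] for the errors in [lev_le_nu]. *)
  apply (far_small_nu_small U HU k x B HxB Hxf nu Hreal Hn_inc K Kavg Khalf (Rabs C + 1));
    auto; [lra|].
  intros i0. destruct (Kfar i0) as [[w i1] [Hi [Kw [Hw Hnu]]]]. simpl in *.
  exists (w, i1). simpl. repeat (split; [assumption|]). intros r Hr.
  destruct (Kz w Kw) as [L [HL HL0]].
  replace (Rabs C + 1) with (nu w + (Rabs C + 1 - nu w)) by ring.
  apply (lev_le_nu U HU k x B HxB Hxf nu Hreal r w L); auto. lra.
Qed.

End Norm.

(** * Block sequences in a space containing l^p or c_0 *)

Section Seminorm.
Variable nu : (nat -> R) -> R.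
Hypothesis Hnu : seminorm_c00 nu.

Lemma finsupp_comb n (c : nat -> R) (v : nat -> nat -> R) :
  (forall i, finsupp (v i)) -> finsupp (fun j => rsum n (fun i => c i * v i j)).
Proof.
  intros H. induction n as [|n [b Hb]]; simpl; [exists 0%nat; auto|].
  destruct (H n) as [b' Hb']. exists (max b b').
  intros i Hi. rewrite Hb, Hb' by lia. ring.
Qed.

Lemma nu_scal c v : finsupp v -> nu (fun j => c * v j) = Rabs c * nu v.
Proof. intros Hv. exact (proj2 Hnu c v Hv). Qed.

Lemma nu_plus u v : finsupp u -> finsupp v -> nu (fun j => u j + v j) <= nu u + nu v.
Proof. intros Hu Hv. exact (proj1 Hnu u v Hu Hv). Qed.

Lemma nu_zero : nu (fun _ => 0) = 0.
Proof.
  assert (Hf : finsupp (fun _ => 0)) by (exists 0%nat; auto).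
  transitivity (nu (fun _ => 0 * 0)).
  - f_equal. apply functional_extensionality. intros; ring.
  - rewrite (nu_scal 0 (fun _ => 0) Hf), Rabs_R0. ring.
Qed.

Lemma nu_comb_le n (c : nat -> R) (v : nat -> nat -> R) :
  (forall i, finsupp (v i)) ->
  nu (fun j => rsum n (fun i => c i * v i j)) <= rsum n (fun i => Rabs (c i) * nu (v i)).
Proof.
  intros H. induction n as [|n IH]; simpl; [rewrite nu_zero; lra|].
  eapply Rle_trans; [apply (nu_plus (fun j => rsum n (fun i => c i * v i j)) (fun j => c n * v n j))|].
  - now apply finsupp_comb.
  - destruct (H n) as [b Hb]. exists b. intros j Hj. rewrite Hb by assumption. ring.
  - rewrite nu_scal by auto. lra.
Qed.

Lemma nu_diff u v : finsupp u -> finsupp v -> Rabs (nu u - nu v) <= nu (fun j => u j - v j).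
Proof.
  intros Hu Hv.
  assert (Hf : finsupp (fun j => u j - v j)).
  { destruct Hu as [b Hb]. destruct Hv as [b' Hb']. exists (max b b').
    intros j Hj. rewrite Hb, Hb' by lia. ring. }
  assert (Hf' : finsupp (fun j => -1 * (u j - v j))).
  { destruct Hf as [b Hb]. exists b. intros j Hj. rewrite Hb by assumption. ring. }
  pose proof (nu_plus v (fun j => u j - v j) Hv Hf) as H1. cbv beta in H1.
  replace (fun j => v j + (u j - v j)) with u in H1
    by (apply functional_extensionality; intros; ring).
  pose proof (nu_plus u (fun j => -1 * (u j - v j)) Hu Hf') as H2. cbv beta in H2.
  replace (fun j => u j + -1 * (u j - v j)) with v in H2
    by (apply functional_extensionality; intros; ring).
  rewrite (nu_scal (-1) _ Hf), Rabs_left in H2 by lra.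
  apply Rabs_le. lra.
Qed.

(** * Copies of [l^p] and [c_0] under a common gauge *)

Variable G : nat -> (nat -> R) -> R.
Hypothesis G_coord : forall n c i, (i < n)%nat -> Rabs (c i) <= G n c.
Hypothesis G_nonneg : forall n c, 0 <= G n c.
Hypothesis G_scal : forall n l c, G n (fun i => l * c i) = Rabs l * G n c.

(** Common form of [contains_lp] and [contains_c0], with [G n c] in the role of the norm of the
    first [n] coordinates. *)
Definition contains_G : Prop :=
  exists (y : nat -> nat -> nat -> R) (C : R),
    0 < C /\ (forall i, cauchy_in nu (y i)) /\
    forall (n : nat) (c : nat -> R), exists L,
      compl_norm_is nu (ycomb n c y) L /\ / C * G n c <= L <= C * G n c.

(** Each coefficient is at most [G n c], so errors [eta / 2^(i+1)] in the vectors change the norm by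
    at most [eta] times the gauge. As [eta] is at most [1 / (2C)] and at most 1, the constants
    become [1 / (2C)] and [C + 1]. *)
Lemma contains_G_finsupp : contains_G ->
  exists (y : nat -> nat -> R) (A D : R), 0 < A /\ 0 < D /\ (forall i, finsupp (y i)) /\
    forall n c, A * G n c <= nu (fun j => rsum n (fun i => c i * y i j)) <= D * G n c.
Proof.
  intros [y [C [HC [Hy HL]]]].
  assert (HIC : 0 < / C) by now apply Rinv_0_lt_compat.
  set (eta := / (2 * C + 1)).
  assert (Heta : 0 < eta) by (apply Rinv_0_lt_compat; lra).
  assert (Heta1 : eta <= 1).
  { unfold eta. rewrite <- Rinv_1. apply Rinv_le_contravar; lra. }
  assert (Heta2 : eta <= / C / 2).
  { replace (/ C / 2) with (/ (2 * C)) by (field; lra). apply Rinv_le_contravar; lra. }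
  set (et := fun i => eta * (/ 2) ^ S i).
  assert (Het : forall i, 0 < et i) by (intros; apply Rmult_lt_0_compat; [lra | apply pow_lt; lra]).
  assert (Hets : forall n, rsum n et <= eta).
  { intros n. enough (rsum n et = eta * (1 - (/ 2) ^ n)) as ->.
    - pose proof (pow_lt (/ 2) n ltac:(lra)). nra.
    - induction n as [|n IH]; simpl; [ring|]. rewrite IH. unfold et. simpl. field. }
  set (tau := fun i => epsilon (inhabits 0%nat) (fun T => forall t t',
    (T <= t)%nat -> (T <= t')%nat -> nu (vsub (y i t) (y i t')) < et i)).
  assert (Htau : forall i t t', (tau i <= t)%nat -> (tau i <= t')%nat ->
    nu (vsub (y i t) (y i t')) < et i).
  { intros i. unfold tau. apply epsilon_spec. exact (proj2 (Hy i) (et i) (Het i)). }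
  exists (fun i => y i (tau i)), (/ C / 2), (C + 1).
  split; [lra|]. split; [lra|]. split; [intros i; apply (proj1 (Hy i))|].
  intros n c. destruct (HL n c) as [L [HLim [HL1 HL2]]].
  assert (HLd : Rabs (L - nu (fun j => rsum n (fun i => c i * y i (tau i) j))) <= G n c * eta).
  { apply le_of_le_eps with 1; [lra|]. intros e He. rewrite Rmult_1_r.
    destruct (HLim e He) as [t0 Ht0]. destruct (nat_bound n tau) as [t1 Ht1].
    set (t := max t0 t1). specialize (Ht0 t ltac:(unfold t; lia)). unfold Rdist in Ht0.
    set (Yt := ycomb n c y t) in *.
    set (Y0 := fun j => rsum n (fun i => c i * y i (tau i) j)).
    assert (Hd : Rabs (nu Yt - nu Y0) <= G n c * eta).
    { eapply Rle_trans; [apply nu_diff|].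
      - apply finsupp_comb. intros i. apply (proj1 (Hy i)).
      - apply (finsupp_comb n c (fun i => y i (tau i))). intros i. apply (proj1 (Hy i)).
      - replace (fun j => Yt j - Y0 j) with
          (fun j => rsum n (fun i => c i * vsub (y i t) (y i (tau i)) j)).
        + eapply Rle_trans; [apply nu_comb_le|].
          * intros i. destruct (proj1 (Hy i) t) as [b Hb]. destruct (proj1 (Hy i) (tau i)) as [b' Hb'].
            exists (max b b'). intros j Hj. unfold vsub. rewrite Hb, Hb' by lia. ring.
          * apply Rle_trans with (rsum n (fun i => G n c * et i)).
            -- apply rsum_le. intros i Hi. specialize (Ht1 i Hi).
               pose proof (Htau i t (tau i) ltac:(unfold t; lia) ltac:(lia)).
               pose proof (G_coord n c i Hi). specialize (Het i). pose proof (Rabs_pos (c i)).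
               apply Rle_trans with (Rabs (c i) * et i).
               ++ apply Rmult_le_compat_l; [lra | left; assumption].
               ++ apply Rmult_le_compat_r; lra.
            -- rewrite rsum_scal. apply Rmult_le_compat_l; [apply G_nonneg | apply Hets].
        + apply functional_extensionality. intros j. unfold Yt, Y0, ycomb.
          rewrite <- rsum_minus. apply rsum_ext. intros i _. unfold vsub. ring. }
    replace (L - nu Y0) with (- (nu Yt - L) + (nu Yt - nu Y0)) by ring.
    eapply Rle_trans; [apply Rabs_triang|]. rewrite Rabs_Ropp. lra. }
  apply Rabs_le_bounds in HLd. pose proof (G_nonneg n c) as Hg.
  assert (G n c * eta <= G n c * (/ C / 2)) by (apply Rmult_le_compat_l; lra).
  assert (G n c * eta <= G n c * 1) by (apply Rmult_le_compat_l; lra).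
  lra.
Qed.

(* Fewer equations than unknowns; each further equation is met by combining two solutions
   with disjoint supports. *)
Lemma linear_system_solvable D (g : nat -> nat -> R) l0 :
  exists c : nat -> R, (exists l, c l <> 0) /\
    (forall l, c l <> 0 -> (l0 <= l < l0 + 2 ^ D)%nat) /\
    forall d, (d < D)%nat -> rsum (l0 + 2 ^ D) (fun l => c l * g d l) = 0.
Proof.
  revert l0. induction D as [|D IH]; intros l0.
  { exists (fun l => if l =? l0 then 1 else 0). split; [|split].
    - exists l0. rewrite Nat.eqb_refl. lra.
    - intros l. destruct (Nat.eqb_spec l l0); simpl; [lia | lra].
    - intros; lia. }
  destruct (IH l0) as [c [[l Hl] [Hc Hcd]]].
  destruct (IH (l0 + 2 ^ D)%nat) as [c' [[l' Hl'] [Hc' Hcd']]].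
  set (n := (l0 + 2 ^ S D)%nat).
  assert (Hn : n = (l0 + 2 ^ D + 2 ^ D)%nat) by (unfold n; simpl; lia).
  assert (E : forall d, rsum n (fun l => c l * g d l) = rsum (l0 + 2 ^ D) (fun l => c l * g d l)).
  { intros d. apply rsum_extend; [lia|]. intros i Hi.
    destruct (Req_dec (c i) 0) as [->|Hne]; [ring|]. apply Hc in Hne. lia. }
  rewrite <- Hn in Hcd'.
  set (al := rsum n (fun l => c' l * g D l)). set (be := rsum n (fun l => c l * g D l)).
  destruct (Req_dec be 0) as [Hbe|Hbe].
  - exists c. split; [eauto|]. split.
    + intros i Hi. apply Hc in Hi. lia.
    + intros d Hd. destruct (Nat.eq_dec d D) as [->|]; [exact Hbe|].
      fold n. rewrite E. apply Hcd. lia.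
  - exists (fun l => al * c l - be * c' l). split; [|split].
    + exists l'. replace (c l') with 0.
      * intros H0. assert (be * c' l' = 0) by lra. apply Rmult_integral in H. tauto.
      * symmetry. apply NNPP. intros Hne. apply Hc in Hne. apply Hc' in Hl'. lia.
    + intros i Hi. destruct (Req_dec (c i) 0) as [H0|H0].
      * destruct (Req_dec (c' i) 0) as [H1|H1]; [|apply Hc' in H1; lia].
        rewrite H0, H1 in Hi. exfalso. apply Hi. ring.
      * apply Hc in H0. lia.
    + intros d Hd. fold n.
      rewrite (rsum_ext n _ (fun l => al * (c l * g d l) - be * (c' l * g d l)))
        by (intros; ring).
      rewrite rsum_minus, !rsum_scal. destruct (Nat.eq_dec d D) as [->|].
      * fold al be. ring.
      * rewrite E, Hcd, Hcd' by lia. ring.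
Qed.

(** Vanishing of the coordinates below [j0] and of the total sum amounts to [j0 + 1] linear
    conditions, met by a nonzero combination of finitely many [y l] with [l >= l0]. By [G_coord] its
    gauge is positive and can be normalized. *)
Lemma normalized_block (y : nat -> nat -> R) l0 j0 : (forall i, finsupp (y i)) ->
  exists p : (nat -> R) * (nat * nat),
    let c := fst p in let h := fst (snd p) in let f := snd (snd p) in
    (l0 < h)%nat /\ (j0 < f)%nat /\ (forall l, c l <> 0 -> (l0 <= l < h)%nat) /\ G h c = 1 /\
    (forall j, rsum h (fun l => c l * y l j) <> 0 -> (j0 <= j < f)%nat) /\
    (forall L, (f <= L)%nat -> rsum L (fun j => rsum h (fun l => c l * y l j)) = 0).
Proof.
  intros Hy.
  set (bd := fun l => proj1_sig (constructive_indefinite_description _ (Hy l))).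
  assert (Hbd : forall l j, (bd l <= j)%nat -> y l j = 0).
  { intros l. unfold bd. apply proj2_sig. }
  set (g := fun d l => if d <? j0 then y l d else rsum (bd l) (y l)).
  destruct (linear_system_solvable (S j0) g l0) as [c [[l Hl] [Hc Hcd]]].
  set (h := (l0 + 2 ^ S j0)%nat) in *.
  destruct (nat_bound h bd) as [f0 Hf0]. set (f := S (max j0 f0)).
  assert (HG : 0 < G h c).
  { eapply Rlt_le_trans; [apply (Rabs_pos_lt (c l) Hl)|]. apply G_coord. now apply Hc. }
  set (t := / G h c). assert (Ht : 0 < t) by now apply Rinv_0_lt_compat.
  assert (Hh : (l0 < h)%nat).
  { unfold h. pose proof (Nat.pow_nonzero 2 (S j0)). lia. }
  exists (fun l => t * c l, (h, f)). simpl fst; simpl snd. cbv zeta.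
  assert (E : forall w : nat -> R, rsum h (fun l => t * c l * w l) = t * rsum h (fun l => c l * w l)).
  { intros w. rewrite <- rsum_scal. apply rsum_ext. intros; ring. }
  split; [exact Hh|]. split; [unfold f; lia|]. split; [|split; [|split]].
  - intros i Hi. apply Hc. intros H0. apply Hi. rewrite H0. ring.
  - rewrite G_scal, Rabs_pos_eq by lra. unfold t. apply Rinv_l. lra.
  - intros j Hj. rewrite E in Hj. split.
    + apply Nat.nlt_ge. intros Hlt. apply Hj. specialize (Hcd j ltac:(lia)). unfold g in Hcd.
      rewrite (proj2 (Nat.ltb_lt j j0) Hlt) in Hcd. rewrite Hcd. ring.
    + apply Nat.nle_gt. intros Hle. apply Hj. rewrite rsum_zero; [ring|].
      intros i Hi. rewrite Hbd; [ring|]. specialize (Hf0 i Hi). unfold f in Hle. lia.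
  - intros L HL. rewrite (rsum_ext L _ (fun j => t * rsum h (fun l => c l * y l j)))
      by (intros; apply E).
    rewrite rsum_scal, rsum_exchange.
    rewrite (rsum_ext h _ (fun l => c l * g j0 l)).
    + rewrite Hcd by lia. ring.
    + intros i Hi. rewrite rsum_scal. unfold g. destruct (Nat.ltb_spec j0 j0); [lia|].
      f_equal. specialize (Hf0 i Hi). apply rsum_extend; [unfold f in HL; lia | apply Hbd].
Qed.

(** [normalized_block] is iterated, [h i] and [f i] recording how far the vectors [y l] and the
    basis of the spreading model have been used. The estimate is the one for the [y l] with the
    coefficients regrouped. *)
Lemma contains_G_blocks : contains_G ->
  exists (v c : nat -> nat -> R) (h f : nat -> nat) (A D : R),
    0 < A /\ 0 < D /\ (forall i, (h i < h (S i))%nat) /\ (forall i, (f i < f (S i))%nat) /\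
    (forall i l, c i l <> 0 -> (h i <= l < h (S i))%nat) /\ (forall i, G (h (S i)) (c i) = 1) /\
    (forall i j, v i j <> 0 -> (f i <= j < f (S i))%nat) /\
    (forall i L, (f (S i) <= L)%nat -> rsum L (v i) = 0) /\
    forall n a, A * G (h n) (fun l => rsum n (fun i => a i * c i l))
        <= nu (fun j => rsum n (fun i => a i * v i j))
        <= D * G (h n) (fun l => rsum n (fun i => a i * c i l)).
Proof.
  intros HG. destruct (contains_G_finsupp HG) as [y [A [D [HA [HD [Hy Hest]]]]]].
  set (nb := fun q : nat * nat =>
    proj1_sig (constructive_indefinite_description _ (normalized_block y (fst q) (snd q) Hy))).
  set (st := fix st i := match i with O => (0%nat, 0%nat) | S i => snd (nb (st i)) end).
  set (h := fun i => fst (st i)). set (f := fun i => snd (st i)).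
  set (c := fun i => fst (nb (st i))).
  set (v := fun i j => rsum (h (S i)) (fun l => c i l * y l j)).
  assert (Hstep : forall i, (h i < h (S i))%nat /\ (f i < f (S i))%nat /\
    (forall l, c i l <> 0 -> (h i <= l < h (S i))%nat) /\ G (h (S i)) (c i) = 1 /\
    (forall j, v i j <> 0 -> (f i <= j < f (S i))%nat) /\
    (forall L, (f (S i) <= L)%nat -> rsum L (v i) = 0)).
  { intros i. exact (proj2_sig (constructive_indefinite_description _
      (normalized_block y (fst (st i)) (snd (st i)) Hy))). }
  exists v, c, h, f, A, D. split; [exact HA|]. split; [exact HD|].
  split; [exact (fun i => proj1 (Hstep i))|].
  split; [exact (fun i => proj1 (proj2 (Hstep i)))|].
  split; [exact (fun i => proj1 (proj2 (proj2 (Hstep i))))|].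
  split; [exact (fun i => proj1 (proj2 (proj2 (proj2 (Hstep i)))))|].
  split; [exact (fun i => proj1 (proj2 (proj2 (proj2 (proj2 (Hstep i))))))|].
  split; [exact (fun i => proj2 (proj2 (proj2 (proj2 (proj2 (Hstep i))))))|].
  intros n a.
  assert (hmono : forall i i', (i <= i')%nat -> (h i <= h i')%nat).
  { intros i i' Hi. induction Hi as [|i' Hi IH]; [lia|]. pose proof (proj1 (Hstep i')). lia. }
  replace (fun j => rsum n (fun i => a i * v i j)) with
    (fun j => rsum (h n) (fun l => rsum n (fun i => a i * c i l) * y l j)); [apply Hest|].
  apply functional_extensionality. intros j.
  rewrite (rsum_ext (h n) _ (fun l => rsum n (fun i => a i * c i l * y l j)))
    by (intros; now rewrite rsum_scal_r).
  rewrite rsum_exchange. apply rsum_ext. intros i Hi. unfold v.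
  rewrite (rsum_ext (h n) _ (fun l => a i * (c i l * y l j))) by (intros; ring).
  rewrite rsum_scal. f_equal. apply rsum_extend; [apply hmono; lia|].
  intros l Hl. destruct (Req_dec (c i l) 0) as [->|Hne]; [ring|].
  apply (proj1 (proj2 (proj2 (Hstep i)))) in Hne. lia.
Qed.

End Seminorm.

(** * The l^p and c_0 gauges *)

Lemma rpow0_nonpos x p : x <= 0 -> rpow0 x p = 0.
Proof. intros H. unfold rpow0. destruct (Rle_dec x 0); [reflexivity | lra]. Qed.

Lemma rpow0_pos x p : 0 < x -> rpow0 x p = Rpower x p.
Proof. intros H. unfold rpow0. destruct (Rle_dec x 0); [lra | reflexivity]. Qed.

Lemma Rpower_pos x p : 0 < Rpower x p.
Proof. apply exp_pos. Qed.

Lemma rpow0_nonneg x p : 0 <= rpow0 x p.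
Proof. unfold rpow0. destruct (Rle_dec x 0); [lra | left; apply Rpower_pos]. Qed.

Lemma rpow0_mono x y p : 0 <= p -> x <= y -> rpow0 x p <= rpow0 y p.
Proof.
  intros Hp H. destruct (Rle_dec x 0) as [Hx|Hx].
  - rewrite (rpow0_nonpos x) by assumption. apply rpow0_nonneg.
  - rewrite !rpow0_pos by lra. apply Rle_Rpower_l; lra.
Qed.

Lemma rpow0_mult x y p : 0 <= x -> 0 <= y -> rpow0 (x * y) p = rpow0 x p * rpow0 y p.
Proof.
  intros [Hx|<-] [Hy|<-].
  - rewrite !rpow0_pos by (try apply Rmult_lt_0_compat; assumption).
    now rewrite Rpower_mult_distr.
  - rewrite Rmult_0_r, (rpow0_nonpos 0) by lra. ring.
  - rewrite Rmult_0_l, (rpow0_nonpos 0) by lra. ring.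
  - rewrite Rmult_0_l, (rpow0_nonpos 0) by lra. ring.
Qed.

Lemma rpow0_root x p : p <> 0 -> 0 <= x -> rpow0 (rpow0 x p) (/ p) = x.
Proof.
  intros Hp [Hx|<-].
  - rewrite (rpow0_pos x), rpow0_pos by (try apply Rpower_pos; assumption).
    rewrite Rpower_mult, Rinv_r by assumption. now apply Rpower_1.
  - rewrite (rpow0_nonpos 0) by lra. apply rpow0_nonpos. lra.
Qed.

Lemma rpow0_one p : rpow0 1 p = 1.
Proof. rewrite rpow0_pos by lra. unfold Rpower. rewrite ln_1, Rmult_0_r. apply exp_0. Qed.

Lemma lp_norm_coord n c p i : 1 <= p -> (i < n)%nat -> Rabs (c i) <= lp_norm n c p.
Proof.
  intros Hp Hi. unfold lp_norm. rewrite <- (rpow0_root (Rabs (c i)) p) by (try apply Rabs_pos; lra).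
  apply rpow0_mono; [left; apply Rinv_0_lt_compat; lra|].
  apply (rsum_ge_term n (fun i => rpow0 (Rabs (c i)) p)); [assumption|].
  intros; apply rpow0_nonneg.
Qed.

Lemma lp_norm_scal n l c p : 1 <= p -> lp_norm n (fun i => l * c i) p = Rabs l * lp_norm n c p.
Proof.
  intros Hp. unfold lp_norm.
  rewrite (rsum_ext n _ (fun i => rpow0 (Rabs l) p * rpow0 (Rabs (c i)) p))
    by (intros; rewrite Rabs_mult; apply rpow0_mult; apply Rabs_pos).
  rewrite rsum_scal, rpow0_mult.
  - rewrite rpow0_root; [reflexivity | lra | apply Rabs_pos].
  - apply rpow0_nonneg.
  - apply rsum_nonneg. intros; apply rpow0_nonneg.
Qed.

Lemma block_unique (h : nat -> nat) (c : nat -> nat -> R) i i' l :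
  (forall i, (h i < h (S i))%nat) -> (forall i l, c i l <> 0 -> (h i <= l < h (S i))%nat) ->
  c i l <> 0 -> c i' l <> 0 -> i = i'.
Proof.
  intros Hh Hc Hi Hi'. apply Hc in Hi. apply Hc in Hi'.
  assert (hmono : forall i i', (i <= i')%nat -> (h i <= h i')%nat).
  { intros j j' Hj. induction Hj as [|j' Hj IH]; [lia|]. specialize (Hh j'). lia. }
  destruct (Nat.lt_trichotomy i i') as [H|[H|H]]; [|assumption|].
  - pose proof (hmono (S i) i' H). lia.
  - pose proof (hmono (S i') i H). lia.
Qed.

(** The blocks have disjoint supports, so at each coordinate a single block contributes and the p-th
    powers add. *)
Lemma lp_norm_blocks p (h : nat -> nat) (c : nat -> nat -> R) n a : 1 <= p ->
  (forall i, (h i < h (S i))%nat) -> (forall i l, c i l <> 0 -> (h i <= l < h (S i))%nat) ->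
  (forall i, lp_norm (h (S i)) (c i) p = 1) ->
  lp_norm (h n) (fun l => rsum n (fun i => a i * c i l)) p = lp_norm n a p.
Proof.
  intros Hp Hh Hc H1. unfold lp_norm. f_equal.
  assert (hmono : forall i i', (i <= i')%nat -> (h i <= h i')%nat).
  { intros j j' Hj. induction Hj as [|j' Hj IH]; [lia|]. specialize (Hh j'). lia. }
  rewrite (rsum_ext (h n) _
    (fun l => rsum n (fun i => rpow0 (Rabs (a i)) p * rpow0 (Rabs (c i l)) p))).
  - rewrite rsum_exchange. apply rsum_ext. intros i Hi. rewrite rsum_scal.
    enough (rsum (h n) (fun l => rpow0 (Rabs (c i l)) p) = 1) as -> by ring.
    rewrite (rsum_extend (h (S i)) (h n)).
    + assert (Hs : 0 <= rsum (h (S i)) (fun l => rpow0 (Rabs (c i l)) p))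
        by (apply rsum_nonneg; intros; apply rpow0_nonneg).
      rewrite <- (rpow0_root (rsum _ _) (/ p)) by (try apply Rinv_neq_0_compat; lra).
      rewrite Rinv_inv. specialize (H1 i). unfold lp_norm in H1. rewrite H1. apply rpow0_one.
    + apply hmono. lia.
    + intros l Hl. destruct (Req_dec (c i l) 0) as [->|Hne].
      * rewrite Rabs_R0. apply rpow0_nonpos. lra.
      * apply Hc in Hne. lia.
  - intros l _.
    destruct (classic (exists i, (i < n)%nat /\ c i l <> 0)) as [[i [Hi Hne]]|Hno].
    + assert (H0 : forall i', i' <> i -> c i' l = 0).
      { intros i' Hi'. apply NNPP. intros Hne'. apply Hi'.
        now apply (block_unique h c i' i l). }
      rewrite (rsum_single n (fun i => a i * c i l) i Hi)
        by (intros i' _ Hi'; rewrite H0 by assumption; ring).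
      rewrite (rsum_single n _ i Hi).
      * rewrite Rabs_mult. apply rpow0_mult; apply Rabs_pos.
      * intros i' _ Hi'. rewrite H0, Rabs_R0, (rpow0_nonpos 0) by (assumption || lra). ring.
    + assert (H0 : forall i, (i < n)%nat -> c i l = 0).
      { intros i Hi. apply NNPP. intros Hne. apply Hno. eauto. }
      rewrite rsum_zero by (intros i Hi; rewrite H0 by assumption; ring).
      rewrite Rabs_R0, rpow0_nonpos by lra. symmetry. apply rsum_zero.
      intros i Hi. rewrite H0, Rabs_R0, (rpow0_nonpos 0) by (assumption || lra). ring.
Qed.

Lemma max_abs_coord n c i : (i < n)%nat -> Rabs (c i) <= max_abs n c.
Proof.
  induction n as [|n IH]; intros Hi; [lia|]. simpl.
  destruct (Nat.eq_dec i n) as [->|]; [apply Rmax_r|].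
  eapply Rle_trans; [apply IH; lia | apply Rmax_l].
Qed.

Lemma max_abs_nonneg n c : 0 <= max_abs n c.
Proof.
  induction n as [|n IH]; simpl; [lra|]. eapply Rle_trans; [apply IH | apply Rmax_l].
Qed.

Lemma max_abs_le n c B : 0 <= B -> (forall i, (i < n)%nat -> Rabs (c i) <= B) -> max_abs n c <= B.
Proof.
  intros HB. induction n as [|n IH]; intros H; simpl; [assumption|].
  apply Rmax_lub; [apply IH; intros; apply H; lia | apply H; lia].
Qed.

Lemma max_abs_scal n l c : max_abs n (fun i => l * c i) = Rabs l * max_abs n c.
Proof.
  induction n as [|n IH]; simpl; [ring|].
  rewrite IH, Rabs_mult, RmaxRmult; [reflexivity | apply Rabs_pos].
Qed.

Lemma max_abs_blocks (h : nat -> nat) (c : nat -> nat -> R) n :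
  (forall i, (h i < h (S i))%nat) -> (forall i l, c i l <> 0 -> (h i <= l < h (S i))%nat) ->
  (forall i, max_abs (h (S i)) (c i) = 1) ->
  max_abs (h n) (fun l => rsum n (fun i => 1 * c i l)) <= 1.
Proof.
  intros Hh Hc H1. apply max_abs_le; [lra|]. intros l _.
  destruct (classic (exists i, (i < n)%nat /\ c i l <> 0)) as [[i [Hi Hne]]|Hno].
  - rewrite (rsum_single n (fun i => 1 * c i l) i Hi).
    + rewrite Rmult_1_l, <- (H1 i). apply max_abs_coord. now apply Hc.
    + intros i' _ Hi'. replace (c i' l) with 0; [ring|]. symmetry. apply NNPP.
      intros Hne'. apply Hi'. now apply (block_unique h c i' i l).
  - rewrite rsum_zero; [rewrite Rabs_R0; lra|]. intros i Hi.
    replace (c i l) with 0; [ring|]. symmetry. apply NNPP. eauto.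
Qed.

(** * Exclusion of l^p and c_0 *)

(** Generated by binary combinations, which makes closure under halving and averaging easy;
    [convex_hull_coords] recovers the coefficients. *)
Inductive convex_hull (v : nat -> nat -> R) : (nat -> R) -> Prop :=
| convex_hull_gen : forall i, convex_hull v (v i)
| convex_hull_comb : forall u w t, convex_hull v u -> convex_hull v w -> 0 <= t <= 1 ->
    convex_hull v (fun j => t * u j + (1 - t) * w j).

Lemma convex_hull_coords v u : convex_hull v u -> exists n a,
  (forall i, 0 <= a i) /\ (forall i, (n <= i)%nat -> a i = 0) /\ rsum n a = 1 /\
  u = fun j => rsum n (fun i => a i * v i j).
Proof.
  induction 1 as [i|u w t Hu [n [a [Ha [Ha0 [Ha1 ->]]]]] Hw [m [b [Hb [Hb0 [Hb1 ->]]]]] Ht].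
  - exists (S i), (fun i' => if i' =? i then 1 else 0). repeat split.
    + intros i'. destruct (i' =? i); lra.
    + intros i' Hi'. destruct (Nat.eqb_spec i' i); [lia | reflexivity].
    + rewrite (rsum_single (S i) _ i) by
        (lia || (intros i' _ Hne; destruct (Nat.eqb_spec i' i); [lia | reflexivity])).
      now rewrite Nat.eqb_refl.
    + apply functional_extensionality. intros j.
      rewrite (rsum_single (S i) _ i) by
        (lia || (intros i' _ Hne; destruct (Nat.eqb_spec i' i); [lia | ring])).
      rewrite Nat.eqb_refl. ring.
  - exists (max n m), (fun i => t * a i + (1 - t) * b i). repeat split.
    + intros i. specialize (Ha i). specialize (Hb i).
      apply Rplus_le_le_0_compat; apply Rmult_le_pos; lra.
    + intros i Hi. rewrite Ha0, Hb0 by lia. ring.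
    + rewrite rsum_plus, !rsum_scal, (rsum_extend n (max n m)), (rsum_extend m (max n m))
        by (auto; lia). rewrite Ha1, Hb1. ring.
    + apply functional_extensionality. intros j.
      rewrite (rsum_ext (max n m) _
        (fun i => t * (a i * v i j) + (1 - t) * (b i * v i j))) by (intros; ring).
      rewrite rsum_plus, !rsum_scal.
      rewrite (rsum_extend n (max n m) (fun i => a i * v i j)),
        (rsum_extend m (max n m) (fun i => b i * v i j)); try lia; [reflexivity| |].
      * intros i Hi. rewrite Hb0 by assumption. ring.
      * intros i Hi. rewrite Ha0 by assumption. ring.
Qed.

Lemma convex_hull_half v u w : convex_hull v u -> convex_hull v w -> convex_hull v (half_sum u w).
Proof.
  intros Hu Hw. replace (half_sum u w) with (fun j => / 2 * u j + (1 - / 2) * w j).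
  - apply convex_hull_comb; auto. lra.
  - apply functional_extensionality. intros j. unfold half_sum. field.
Qed.

Lemma convex_hull_avg v M w : (1 <= M)%nat -> (forall i, convex_hull v (w i)) ->
  convex_hull v (avg M w).
Proof.
  intros HM Hw. induction HM as [|M HM IH].
  - replace (avg 1 w) with (w 0%nat); [apply Hw|].
    apply functional_extensionality. intros j. unfold avg. simpl. field.
  - assert (HM0 : 0 < INR M) by (apply lt_0_INR; lia).
    (* Running average: the new vector enters with weight [1 / (M + 1)]. *)
    replace (avg (S M) w) with (fun j => INR M / (INR M + 1) * avg M w j +
      (1 - INR M / (INR M + 1)) * w M j).
    + apply convex_hull_comb; auto. split.
      * left. apply Rdiv_lt_0_compat; lra.
      * apply Rmult_le_reg_r with (INR M + 1); [lra|].
        unfold Rdiv. rewrite Rmult_assoc, Rinv_l by lra. lra.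
    + apply functional_extensionality. intros j. unfold avg. rewrite rsum_S, S_INR. field. lra.
Qed.

Theorem mainTheorem17 (nseq mseq : nat -> nat) (N : (nat -> R) -> R)
  (Hn_pos : forall j, (0 < nseq j)%nat) (Hm_pos : forall j, (0 < mseq j)%nat)
  (Hn_inc : forall j, (nseq j < nseq (S j))%nat)
  (Hm_inc : forall j, (mseq j < mseq (S j))%nat)
  (Hsum : exists S, infinite_sum (fun j => / INR (mseq j)) S /\ S <= 1 / 10)
  (Hgrowth : forall a, 0 < a ->
      cv_infty (fun j => Rpower (INR (nseq j)) a / INR (mseq j)))
  (Hratio : forall j, INR (nseq j) / INR (nseq (S j)) < / INR (mseq j))
  (HN : implicit_norm nseq mseq N) :
  forall (k : nat) (nu : (nat -> R) -> R),
    (1 <= k)%nat -> is_k_spreading_model N k nu ->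
    (forall p, 1 <= p -> ~ contains_lp nu p) /\ ~ contains_c0 nu.
Proof.
  intros k nu Hk Hsm. pose proof (proj1 Hsm) as Hnu.
  (* [th] bounds the growth of sums of normalized blocks: [1 / p] for [l^p], 0 for [c_0]. The
     resulting inequality [n A <= k m D n^th] contradicts the growth hypothesis for the exponent
     [1 - th]. *)
  assert (Hlow : forall (G : nat -> (nat -> R) -> R) th,
    (forall n c i, (i < n)%nat -> Rabs (c i) <= G n c) -> (forall n c, 0 <= G n c) ->
    (forall n l c, G n (fun i => l * c i) = Rabs l * G n c) ->
    (forall (h : nat -> nat) (c : nat -> nat -> R) n, (1 <= n)%nat ->
      (forall i, (h i < h (S i))%nat) -> (forall i l, c i l <> 0 -> (h i <= l < h (S i))%nat) ->
      (forall i, G (h (S i)) (c i) = 1) ->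
      G (h n) (fun l => rsum n (fun i => 1 * c i l)) <= Rpower (INR n) th) ->
    th < 1 -> ~ contains_G nu G).
  { intros G th Gc G0 Gs Gb Hth HG.
    destruct (contains_G_blocks nu Hnu G Gc G0 Gs HG)
      as [v [c [h [f [A [D [HA [HD [Hh [Hf [Hc [Hc1 [Hv [Hvz Hest]]]]]]]]]]]]]].
    assert (fmono : forall i i', (i <= i')%nat -> (f i <= f i')%nat).
    { intros j j' Hj. induction Hj as [|j' Hj IH]; [lia|]. specialize (Hf j'). lia. }
    destruct (Hgrowth (1 - th) ltac:(lra) (INR k * D / A)) as [J HJ].
    specialize (HJ J (le_n J)).
    pose proof (spreading_model_blocks_lower nseq mseq N Hn_pos Hm_pos Hsum Hgrowth HN k nu J v f
      Hk Hsm (fun q _ => Hf q) (fun q j _ => Hv q j)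
      (fun q Hq => Hvz q _ (fmono (S q) (nseq J) Hq))) as Hmain.
    assert (Hlo : forall q, A <= nu (v q)).
    { intros q. destruct (Hest (S q) (fun i => if i =? q then 1 else 0)) as [H1 _].
      assert (E : forall w : nat -> R, rsum (S q) (fun i => (if i =? q then 1 else 0) * w i) = w q).
      { intros w. rewrite (rsum_single (S q) _ q) by
          (lia || (intros i' _ Hne; destruct (Nat.eqb_spec i' q); [lia | ring])).
        rewrite Nat.eqb_refl. ring. }
      replace (fun l => rsum (S q) (fun i => (if i =? q then 1 else 0) * c i l)) with (c q) in H1
        by (apply functional_extensionality; intros l; now rewrite (E (fun i => c i l))).
      replace (fun j => rsum (S q) (fun i => (if i =? q then 1 else 0) * v i j)) with (v q) in H1
        by (apply functional_extensionality; intros l; now rewrite (E (fun i => v i l))).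
      rewrite Hc1 in H1. lra. }
    set (n := nseq J) in *. set (m := mseq J) in *.
    assert (Hhi : nu (fun j => rsum n (fun q => v q j)) <= D * Rpower (INR n) th).
    { replace (fun j => rsum n (fun q => v q j)) with (fun j => rsum n (fun q => 1 * v q j))
        by (apply functional_extensionality; intros j; apply rsum_ext; intros; ring).
      eapply Rle_trans; [apply (Hest n (fun _ => 1))|].
      apply Rmult_le_compat_l; [lra|]. apply Gb; auto. apply Hn_pos. }
    assert (HnA : INR n * A <= rsum n (fun q => nu (v q)))
      by (rewrite <- rsum_const; now apply rsum_le).
    assert (Hn0 : 0 < INR n) by apply lt_0_INR, Hn_pos.
    assert (Hm0 : 0 < INR m) by apply lt_0_INR, Hm_pos.
    pose proof (pos_INR k) as Hk0.
    assert (Hprod : INR n = Rpower (INR n) (1 - th) * Rpower (INR n) th).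
    { rewrite <- Rpower_plus. replace (1 - th + th) with 1 by ring. now rewrite Rpower_1. }
    pose proof (Rpower_pos (INR n) th) as Hth0.
    pose proof (Rpower_pos (INR n) (1 - th)) as Hth1.
    set (P := Rpower (INR n) (1 - th)) in *. set (Q := Rpower (INR n) th) in *.
    assert (H1 : P * A * Q <= INR k * INR m * D * Q).
    { apply Rle_trans with (INR k * (INR m * nu (fun j => rsum n (fun q => v q j)))).
      - replace (P * A * Q) with (P * Q * A) by ring. rewrite <- Hprod. lra.
      - replace (INR k * INR m * D * Q) with (INR k * (INR m * (D * Q))) by ring.
        apply Rmult_le_compat_l; [assumption|]. apply Rmult_le_compat_l; lra. }
    apply Rmult_le_reg_r in H1; [|assumption].
    apply Rmult_lt_compat_r with (r := A * INR m) in HJ; [|now apply Rmult_lt_0_compat].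
    replace (P / INR m * (A * INR m)) with (P * A) in HJ by (field; lra).
    replace (INR k * D / A * (A * INR m)) with (INR k * INR m * D) in HJ by (field; lra).
    lra. }
  split.
  - intros p Hp. destruct (Req_dec p 1) as [->|Hp1].
    + intros HG.
      destruct (contains_G_blocks nu Hnu (fun n c => lp_norm n c 1)
        (fun n c i => lp_norm_coord n c 1 i (Rle_refl 1)) (fun n c => rpow0_nonneg _ _)
        (fun n l c => lp_norm_scal n l c 1 (Rle_refl 1)) HG)
        as [v [c [h [f [A [D [HA [HD [Hh [Hf [Hc [Hc1 [Hv [Hvz Hest]]]]]]]]]]]]]].
      assert (fmono : forall i i', (i <= i')%nat -> (f i <= f i')%nat).
      { intros j j' Hj. induction Hj as [|j' Hj IH]; [lia|]. specialize (Hf j'). lia. }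
      assert (fge : forall i, (i <= f i)%nat).
      { induction i as [|i IH]; [lia|]. specialize (Hf i). lia. }
      (* Convex coefficients have [l^1] norm 1, and this passes to normalized blocks; so [nu] is at
         least [A] on the whole hull, which excludes a member with value at most [A / 2]. *)
      assert (Hconv : forall u, convex_hull v u -> A <= nu u <= D).
      { intros u Hu. destruct (convex_hull_coords v u Hu) as [n [a [Ha [Ha0 [Ha1 ->]]]]].
        specialize (Hest n a). cbv beta in Hest.
        rewrite (lp_norm_blocks 1 h c n a (Rle_refl 1) Hh Hc Hc1) in Hest.
        replace (lp_norm n a 1) with 1 in Hest; [lra|].
        unfold lp_norm. rewrite (rsum_ext n _ a).
        - rewrite Ha1. now rewrite rpow0_one.
        - intros i _. rewrite Rabs_pos_eq by auto. destruct (Ha i) as [Hi|<-].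
          + rewrite rpow0_pos by assumption. now apply Rpower_1.
          + apply rpow0_nonpos. lra. }
      destruct (spreading_model_convex_small nseq mseq N Hn_pos Hm_pos Hsum Hgrowth HN Hn_inc
        k nu (convex_hull v) D (A / 2) Hk Hsm) as [u [Hu Hnu']].
      * apply convex_hull_avg.
      * apply convex_hull_half.
      * intros u Hu. destruct (convex_hull_coords v u Hu) as [n [a [_ [_ [_ ->]]]]].
        exists (f n). split.
        -- intros j Hj. apply rsum_zero. intros i Hi. replace (v i j) with 0; [ring|].
           symmetry. apply NNPP. intros Hne. apply Hv in Hne.
           pose proof (fmono (S i) n Hi). lia.
        -- rewrite rsum_exchange. apply rsum_zero. intros i Hi.
           rewrite rsum_scal, Hvz; [ring|]. now apply fmono.
      * intros i0. exists (v i0, f (S i0)). simpl. split; [|split; [|split]].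
        -- specialize (fge (S i0)). lia.
        -- apply convex_hull_gen.
        -- intros j Hj. apply Hv in Hj. specialize (fge i0). lia.
        -- apply Hconv, convex_hull_gen.
      * lra.
      * specialize (Hconv u Hu). lra.
    + apply (Hlow (fun n c => lp_norm n c p) (/ p)).
      * intros. now apply lp_norm_coord.
      * intros. apply rpow0_nonneg.
      * intros. now apply lp_norm_scal.
      * intros h c n Hn Hh Hc Hc1. rewrite (lp_norm_blocks p h c n (fun _ => 1)) by assumption.
        unfold lp_norm. rewrite Rabs_R1, rpow0_one, rsum_const, Rmult_1_r, rpow0_pos; [lra|].
        apply lt_0_INR. lia.
      * rewrite <- Rinv_1. apply Rinv_lt_contravar; lra.
  - apply (Hlow max_abs 0).
    + apply max_abs_coord.
    + apply max_abs_nonneg.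
    + apply max_abs_scal.
    + intros h c n Hn Hh Hc Hc1. rewrite Rpower_O by (apply lt_0_INR; lia).
      now apply max_abs_blocks.
    + lra.
Qed.
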